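(* Let $z_0\in I$, $z_0>0$, be sufficiently small (depending on $w,S,b,h$). Let $\gamma$ be a unit speed geodesic of $(M,g_\varepsilon)$ starting at the waist $\{z=0\}$ upwards, at an angle of impact $\varphi\in(0,\frac\pi2)$, and ending in $\{z=z_0\}$. Then, as $\varepsilon\to0$, its total angular length satisfies $$\mathrm{length}_Y(\gamma)=\frac{1}{\varepsilon^{k-1}}\left[\mathcal{C}_\varphi\cos\varphi+R\right],$$ where the remainder $R$ depends on $\gamma$ and satisfies $$R=\begin{cases}\mathcal{O}(\varepsilon)&\text{if }k>2,\\ \mathcal{O}(\varepsilon\log\varepsilon)&\text{if }k=2,\end{cases}$$ the estimates being uniform for $\varphi$ in any compact subset of $(0,\pi/2]$. Here $$\mathcal{C}_\varphi=\int_0^\infty\frac{dZ}{f(Z)^k\sqrt{f(Z)^{2k}-\cos^2\varphi}} ,$$ and if $f-1$ vanishes to finite order $2\ell$ at $Z=0$, then for some constant $C>0$, as $\varphi\to0$, $$\mathcal{C}_\varphi\sim\begin{cases}C\,\varphi^{-\frac{\ell-1}{\ell}}&\text{if }\ell>1,\\ C\log(\varphi^{-1})&\text{if }\ell=1,\end{cases}$$ where $\sim$ means that the quotient tends to $1$.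
   Context: **Scaling function.** $k\ge2$ is an integer. $w=w(\varepsilon,z)$, $\varepsilon\ge0$, $z\in\mathbb{R}$, is continuous, is smooth and positive for $(\varepsilon,z)\ne(0,0)$, vanishes at $(0,0)$, and satisfies $\mathrm{sgn}(\partial_z w)=\mathrm{sgn}(z)$, $w(\varepsilon,0)=\varepsilon$, $w(0,z)=|z|$ and $w(\lambda\varepsilon,\lambda z)=\lambda w(\varepsilon,z)$ for $\lambda>0$. Put $f(Z)=w(1,Z)$, so $w=\varepsilon f(z/\varepsilon)$. **Metric.** $Y$ is a smooth compact manifold (without boundary) of dimension $n-1$, $I$ is an open interval containing $0$, $M=I\times Y$ with points $(z,y)$. For $\varepsilon\in(0,1)$, $$g_\varepsilon=(1-w^\kappa S)\,dz^2+2w^{2k}\,dz\cdot b+w^{2k}h,$$ where $\kappa\ge k$ is an integer and $S,b,h$ are a function, a one-form and a Riemannian metric on $Y$ depending on the parameters $(\varepsilon,z)$. Regularity: $S,b,h$ are smooth on the blow-up, i.e. when written in terms of $(r,\phi,y)$ with $\varepsilon=r\cos\phi$, $z=r\sin\phi$, they are (extend) smooth down to $r=0$, for $\phi\in[-\frac\pi2,\frac\pi2]$, with $h$ remaining a metric; $\partial_z h$ is bounded; and, in the coordinates $(E,z)$ with $E=\varepsilon/z$ (for $z\ge0$), $\partial_E S=0$ at $E=z=0$, and similarly in the coordinates $(E_-,z)$, $E_-=-\varepsilon/z$, for $z\le0$. It is assumed throughout that $I$ and the range of $\varepsilon$ are small enough that $g_\varepsilon$ is a Riemannian metric for $\varepsilon>0$.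 **Geodesics.** $\gamma(t)=(z(t),y(t))$ is a unit speed geodesic with $z(0)=0$ moving upwards ($\dot z(0)\geq 0$). The angle of impact $\varphi\in[0,\frac\pi2]$ is the angle (with respect to $g_\varepsilon$) between $\dot\gamma(0)$ and the waist $\{z=0\}$. The angular length of $\gamma$ up to height $z_0$ is $\mathrm{length}_Y(\gamma)=\int_0^T|\dot y(t)|\,dt$, where $z(T)=z_0$ and $|\cdot|$ is the norm with respect to $h$ at $\gamma(t)$ (and parameter $\varepsilon$). *)

(* Defs.v *)
From mathcomp Require Import all_boot all_order all_algebra.
From mathcomp Require Import all_classical all_reals all_analysis.
Set Implicit Arguments.
Unset Strict Implicit.
Unset Printing Implicit Defensive.
Import Order.TTheory GRing.Theory Num.Theory numFieldNormedType.Exports.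
Local Open Scope classical_set_scope.
Local Open Scope ring_scope.

(* C^n on an open set U, through iterated directional derivatives.  Used only
   for finite-dimensional V, where this is the usual notion: taking v in a
   basis gives the partial derivatives. *)
Fixpoint Cn (R : realType) (V W : normedModType R) (n : nat) (U : set V)
    (f : V -> W) : Prop :=
  (forall x, U x -> {for x, continuous f}) /\
  if n is n'.+1 then
    forall v, (forall x, U x -> derivable f x v) /\ Cn n' U (fun x => 'D_v f x)
  else True.

(* Smoothness on an arbitrary subset D (in particular up to a boundary or a
   corner): local existence of smooth extensions.  For D open it is ordinary
   smoothness. *)
Definition smooth_on (R : realType) (V W : normedModType R) (D : set V)
    (f : V -> W) : Prop :=
  forall p, D p -> exists (U : set V) (F : V -> W),
    [/\ open U, U p, (forall n, Cn n U F) &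
        forall x, U x -> D x -> F x = f x].

(* A smooth atlas of dimension m on Y.  The charts are cmap c : dom c -> R^m,
   with inverse cinv c; the values of cmap c outside dom c and of cinv c
   outside cmap c @` dom c are irrelevant.  chart_at y is a preferred chart
   around y, used below to represent tangent vectors at y. *)
Record atlas (R : realType) (m : nat) (Y : topologicalType) := Atlas {
  chart : Type ;
  dom : chart -> set Y ;
  cmap : chart -> Y -> 'rV[R]_m ;
  cinv : chart -> 'rV[R]_m -> Y ;
  chart_at : Y -> chart ;
  dom_chart_at : forall y, dom (chart_at y) y ;
  dom_open : forall c, open (dom c) ;
  img_open : forall c, open (cmap c @` dom c) ;
  cmapK : forall c y, dom c y -> cinv c (cmap c y) = y ;
  cmap_continuous : forall c y, dom c y -> {for y, continuous (cmap c)} ;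
  cinv_continuous : forall c y, dom c y ->
    {for cmap c y, continuous (cinv c)} ;
  transition_smooth : forall c c',
    smooth_on (cmap c @` (dom c `&` dom c')) (cmap c' \o cinv c)
}.

(* Compact manifold without boundary; second countability follows from
   compactness. *)
Definition closed_manifold (R : realType) (m : nat) (Y : topologicalType)
    (A : atlas R m Y) : Prop :=
  compact [set: Y] /\ hausdorff_space Y.

(* T_y Y is represented by R^m, through the coordinates given by the preferred
   chart at y.  tvec A c x v is the tangent vector at the point cinv c x having
   components v in the chart c. *)
Definition tvec (R : realType) (m : nat) (Y : topologicalType)
    (A : atlas R m Y) (c : chart A) (x v : 'rV[R]_m) : 'rV[R]_m :=
  'D_v (cmap (chart_at A (cinv c x)) \o cinv c) x.

Definition velocity (R : realType) (m : nat) (Y : topologicalType)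
    (A : atlas R m Y) (y : R -> Y) (t : R) : 'rV[R]_m :=
  derive1 (cmap (chart_at A (y t)) \o y) t.

Definition scaling_function (R : realType) (w : R -> R -> R) : Prop :=
  [/\ {within [set p : R * R | 0 <= p.1], continuous (fun p => w p.1 p.2)},
      smooth_on [set p : R * R | 0 <= p.1 /\ p <> (0, 0)]
        (fun p => w p.1 p.2) /\
      (forall e z, 0 <= e -> (e, z) <> (0, 0) -> 0 < w e z),
      w 0 0 = 0,
      forall e z, 0 <= e -> (e, z) <> (0, 0) ->
        Num.sg (derive1 (w e) z) = Num.sg z &
      [/\ forall e, 0 <= e -> w e 0 = e,
          forall z, w 0 z = `|z| &
          forall e z l, 0 <= e -> 0 < l -> w (l * e) (l * z) = l * w e z]].

(* Points (r, phi) of the blow-up over parameters eps = r cos phi in [0, eps0)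
   and z = r sin phi in J. *)
Definition blowup (R : realType) (eps0 : R) (J : set R) : set (R * R) :=
  [set p | [/\ 0 <= p.1, - (pi / 2) <= p.2 <= pi / 2,
               p.1 * cos p.2 < eps0 & J (p.1 * sin p.2)]].

(* F(r, phi, .) extends f(eps, z, .) from r > 0 to the whole blow-up. *)
Definition blowup_lift (R : realType) (X : Type) (eps0 : R) (J : set R)
    (f F : R -> R -> X) : Prop :=
  forall r phi, blowup eps0 J (r, phi) -> 0 < r ->
    F r phi = f (r * cos phi) (r * sin phi).

Definition blowup_chart (R : realType) (m : nat) (Y : topologicalType)
    (A : atlas R m Y) (eps0 : R) (J : set R) (c : chart A) :
    set (R * R * 'rV[R]_m) :=
  [set q | blowup eps0 J q.1 /\ (cmap c @` dom c) q.2].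

(* A function on Y depending on (eps, z), smooth on the blow-up, with
   d_E S = 0 at E = z = 0 in the coordinates E = +-eps/z.  These correspond to
   phi = +-(pi/2 - atan E) and r = |z| sqrt (1 + E^2), E >= 0; the derivative
   is one-sided because E = 0 is a boundary point. *)
Definition admissible_function (R : realType) (m : nat) (Y : topologicalType)
    (A : atlas R m Y) (eps0 : R) (J : set R) (S : R -> R -> Y -> R) : Prop :=
  exists SB : R -> R -> Y -> R,
    [/\ blowup_lift eps0 J S SB,
        forall c : chart A, smooth_on (blowup_chart eps0 J c)
          (fun q => SB q.1.1 q.1.2 (cinv c q.2)) &
        forall y,
          let Splus E z := SB (z * Num.sqrt (1 + E ^+ 2)) (pi / 2 - atan E) y in
          let Sminus E z :=
            SB (- z * Num.sqrt (1 + E ^+ 2)) (- (pi / 2 - atan E)) y in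
          ((Splus E 0 - Splus 0 0) / E @[E --> 0^'+] --> 0) /\
          ((Sminus E 0 - Sminus 0 0) / E @[E --> 0^'+] --> 0)].

Definition admissible_form (R : realType) (m : nat) (Y : topologicalType)
    (A : atlas R m Y) (eps0 : R) (J : set R)
    (b : R -> R -> Y -> 'rV[R]_m -> R) : Prop :=
  exists bB : R -> R -> Y -> 'rV[R]_m -> R,
    [/\ blowup_lift eps0 J b bB,
        (forall r phi y, blowup eps0 J (r, phi) ->
          forall (a : R) u v,
            bB r phi y (a *: u + v) = a * bB r phi y u + bB r phi y v) &
        forall (c : chart A) v, smooth_on (blowup_chart eps0 J c)
          (fun q => bB q.1.1 q.1.2 (cinv c q.2) (tvec c q.2 v))].

Definition inner_product (R : realType) (m : nat)
    (s : 'rV[R]_m -> 'rV[R]_m -> R) : Prop :=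
  [/\ forall u v, s u v = s v u,
      forall (a : R) u v v', s u (a *: v + v') = a * s u v + s u v' &
      forall u, u != 0 -> 0 < s u u].

(* A family of metrics, smooth on the blow-up and nondegenerate down to r = 0,
   with d_z h bounded as a family of tensors on Y: its components in any chart
   are bounded on compact sets of coordinates, uniformly in (eps, z). *)
Definition admissible_metric (R : realType) (m : nat) (Y : topologicalType)
    (A : atlas R m Y) (eps0 : R) (J : set R)
    (h : R -> R -> Y -> 'rV[R]_m -> 'rV[R]_m -> R) : Prop :=
  (exists hB : R -> R -> Y -> 'rV[R]_m -> 'rV[R]_m -> R,
    [/\ blowup_lift eps0 J h hB,
        (forall r phi y, blowup eps0 J (r, phi) ->
          inner_product (hB r phi y)) &
        forall (c : chart A) u v, smooth_on (blowup_chart eps0 J c)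
          (fun q => hB q.1.1 q.1.2 (cinv c q.2) (tvec c q.2 u) (tvec c q.2 v))])
  /\
  (forall (c : chart A) (K : set 'rV[R]_m) u v,
     compact K -> K `<=` cmap c @` dom c ->
     exists B : R, forall e z x, 0 < e < eps0 -> J z -> K x ->
       `| derive1 (fun z' => h e z' (cinv c x) (tvec c x u) (tvec c x v)) z |
         <= B).

(* g_eps at (z, y), on tangent vectors (zeta, v) of R x Y; dz.b is the
   symmetric product. *)
Definition pmetric (R : realType) (m : nat) (Y : topologicalType)
    (w : R -> R -> R) (k kappa : nat) (S : R -> R -> Y -> R)
    (b : R -> R -> Y -> 'rV[R]_m -> R)
    (h : R -> R -> Y -> 'rV[R]_m -> 'rV[R]_m -> R)
    (e z : R) (y : Y) (p q : R * 'rV[R]_m) : R :=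
  (1 - w e z ^+ kappa * S e z y) * (p.1 * q.1)
  + w e z ^+ (2 * k) * (p.1 * b e z y q.2 + q.1 * b e z y p.2)
  + w e z ^+ (2 * k) * h e z y p.2 q.2.

Definition chart_metric (R : realType) (m : nat) (Y : topologicalType)
    (A : atlas R m Y) (g : R -> Y -> R * 'rV[R]_m -> R * 'rV[R]_m -> R)
    (c : chart A) (x p q : R * 'rV[R]_m) : R :=
  g x.1 (cinv c x.2) (p.1, tvec c x.2 p.2) (q.1, tvec c x.2 q.2).

(* Christoffel symbols of the first kind of a metric G on an open subset of V,
   i.e. G_x(Gamma_x(u, v), e). *)
Definition christoffel1 (R : realType) (V : normedModType R)
    (G : V -> V -> V -> R) (x u v e : V) : R :=
  ('D_u (fun x' => G x' v e) x + 'D_v (fun x' => G x' u e) x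
   - 'D_e (fun x' => G x' u v) x) / 2.

(* t |-> (z t, y t) is a geodesic of J x Y on the open interval ]a, b[ :
   x'' + Gamma(x', x') = 0 in every chart, paired with an arbitrary vector. *)
Definition geodesic (R : realType) (m : nat) (Y : topologicalType)
    (A : atlas R m Y) (J : set R)
    (g : R -> Y -> R * 'rV[R]_m -> R * 'rV[R]_m -> R)
    (a b : R) (z : R -> R) (y : R -> Y) : Prop :=
  forall t, a < t < b ->
    [/\ J (z t), {for t, continuous y} &
        forall c : chart A, dom c (y t) ->
          let x s := (z s, cmap c (y s)) in
          let x' := derive1 x in
          [/\ derivable x t 1, derivable x' t 1 &
              forall e, chart_metric g c (x t) (derive1 x' t) e
                + christoffel1 (chart_metric g c) (x t) (x' t) (x' t) e = 0]].

Definition unit_speed (R : realType) (m : nat) (Y : topologicalType)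
    (A : atlas R m Y) (g : R -> Y -> R * 'rV[R]_m -> R * 'rV[R]_m -> R)
    (a b : R) (z : R -> R) (y : R -> Y) : Prop :=
  forall t, a < t < b ->
    let v := (derive1 z t, velocity A y t) in g (z t) (y t) v v = 1.

(* phi is the angle, for the inner product s, between v and the subspace
   {0} x R^m (the tangent space of a level of z): the angle between v and its
   orthogonal projection (0, p). *)
Definition angle_with_level (R : realType) (m : nat)
    (s : R * 'rV[R]_m -> R * 'rV[R]_m -> R) (v : R * 'rV[R]_m) (phi : R) :
    Prop :=
  0 <= phi <= pi / 2 /\
  exists p : 'rV[R]_m,
    (forall u : 'rV[R]_m, s (v - (0, p)) (0, u) = 0) /\
    Num.sqrt (s (0, p) (0, p)) = cos phi * Num.sqrt (s v v).

Definition angular_length (R : realType) (m : nat) (Y : topologicalType)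
    (A : atlas R m Y) (h : R -> Y -> 'rV[R]_m -> 'rV[R]_m -> R)
    (z : R -> R) (y : R -> Y) (T : R) : R :=
  \int[lebesgue_measure]_(t in `[0, T])
    Num.sqrt (h (z t) (y t) (velocity A y t) (velocity A y t)).

(* A unit speed geodesic from {z = 0} upwards with angle of impact phi, whose
   first arrival at {z = z0} is at time T.  As J x Y has no boundary, a
   geodesic on [0, T] always extends to an open interval. *)
Definition rising_geodesic (R : realType) (m : nat) (Y : topologicalType)
    (A : atlas R m Y) (J : set R)
    (g : R -> Y -> R * 'rV[R]_m -> R * 'rV[R]_m -> R)
    (phi z0 T : R) (z : R -> R) (y : R -> Y) : Prop :=
  0 < T /\
  (exists a b, [/\ a < 0, T < b, geodesic A J g a b z y &
                   unit_speed A g a b z y]) /\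
  [/\ z 0 = 0, 0 <= derive1 z 0,
      angle_with_level (g 0 (y 0)) (derive1 z 0, velocity A y 0) phi,
      z T = z0 & forall t, 0 <= t < T -> z t < z0].

Definition Cphi (R : realType) (w : R -> R -> R) (k : nat) (phi : R) : R :=
  \int[lebesgue_measure]_(Z in `[0, +oo[)
    (w 1 Z ^+ k * Num.sqrt (w 1 Z ^+ (2 * k) - cos phi ^+ 2))^-1.

Definition vanishes_to_order (R : realType) (f : R -> R) (x : R) (n : nat) :
    Prop :=
  (forall j, (j < n)%N -> derive1n j f x = 0) /\ derive1n n f x != 0.

(* Main.v *)
Require Import Defs.
From HB Require Import structures.
From mathcomp Require Import all_boot all_order all_algebra.
From mathcomp Require Import all_classical all_reals all_analysis.
From mathcomp Require Import ring lra.
Import Order.TTheory GRing.Theory Num.Theory numFieldNormedType.Exports.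
Set Implicit Arguments.
Unset Strict Implicit.
Unset Printing Implicit Defensive.
Local Open Scope classical_set_scope.
Local Open Scope ring_scope.

(** Let [(z, y)] be the geodesic, [f = w 1] and [om = w ^ 2k].  The angular
    momentum is the covector which maps [v] to the product of the velocity with
    [(0, v)]; let [N] be its squared norm for the metric dual to [h].  On a
    surface of revolution [N] is constant by Clairaut's theorem.  In general the
    geodesic equation, paired with [(0, v)], says that the momentum varies only
    through the dependence of the metric on the point of [Y].  In the derivative
    of [N] the terms of highest order cancel, because the geodesics of [h] alone
    conserve the length of covectors, and the rest is bounded by a multiple of
    [|z'| * sqrt N * w ^ k] ([momentum_variation_le], [reduced_at_time]).  The
    bounds on [S], [b], [h] and their derivatives along [Y] are uniform because
    a part [0 <= r <= r1] of the blow-up and [Y] are compact ([uniformly_tame]);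
    the only derivative in the direction of [z] to occur is that of [h].  Unit
    speed becomes [z'^2 * (1 - rho) = 1 - N / om] with [rho] of order [w ^ k],
    the angular speed is [sqrt N / om] up to a multiple of [|z'|], and the angle
    of impact gives [N 0 = e ^ 2k * cos phi ^ 2] ([geodesic_reduction]).

    As long as [z] increases, integration shows that [sqrt N] differs from
    [e ^ k * cos phi] by at most [C * z * w ^ k].  Hence [sqrt N / w ^ k] stays
    away from [1]: low down because [cos phi] does, higher up because [e / w] is
    small.  So [z'] is bounded below and [z] never stops increasing.  The
    angular speed can then be compared with that of the model in which the
    momentum is constant and [z' ^ 2 = 1 - N / om].  The angular length of the
    model is [e ^ (1 - k) * cos phi] times the integral of the integrand of
    [Cphi] from [0] to [z0 / e], and the difference is at most a multiple of the
    integral of [1 + (e + z) ^ (1 - k)] over [0 <= z <= z0] ([length_dist]).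
    Multiplied by [e ^ (k - 1)] the latter is of order [e] if [k > 2] and
    [e * |ln e|] if [k = 2].  The part of [Cphi] above [z0 / e] is of order [e]
    since [f Z] grows linearly ([profile_linear], [reduced_length]).

    For the behaviour at small angles put [s = sin phi], so that the root in
    [Cphi] is that of [s ^ 2 + (f ^ 2k - 1)], where [f ^ 2k - 1] is equivalent
    to [(alpha * Z) ^ 2l] at [Z = 0] ([profile_sandwich]).  Above any fixed
    height the integral is bounded uniformly in [phi]; below it is squeezed
    between multiples, as close to [1] as desired, of the integrals of
    [1 / sqrt (s ^ 2 + (b * Z) ^ 2l)] with [b] close to [alpha]
    ([Cphi_sandwich]).  With [v = s ^ (1 / l)] and [t = b * Z / v] these become
    [v / (s * b)] times integrals of [1 / sqrt (1 + t ^ 2l)] over intervals which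
    grow to the half line.  They converge for [l > 1] and grow like a logarithm
    for [l = 1] ([model_limit]). *)

(** * Continuously differentiable functions *)

Lemma is_derive_line (R : realType) (V W : normedModType R) (F : V -> W)
    (y v : V) (s : R) :
  derivable F (s *: v + y) v ->
  is_derive s 1 (fun h : R => F (h *: v + y)) ('D_v F (s *: v + y)).
Proof.
have E : (fun h : R => h^-1 *: (((fun h => F (h *: v + y)) \o shift s) (h *: 1)
     - F (s *: v + y))) =
   (fun h => h^-1 *: ((F \o shift (s *: v + y)) (h *: v) - F (s *: v + y))).
  apply/funext => h /=; rewrite /shift /= -[h *: 1]/(h * 1) mulr1.
  by rewrite scalerDl addrA.
by move=> dF; split; [rewrite /derivable E|rewrite /derive E].
Qed.

(** A basis whose coordinate functions are bounded for the given norm; this form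
    treats the line, row vectors and their products alike. *)
Definition frame (R : realType) (V : normedModType R) (I : finType)
    (e : I -> V) (c : I -> V -> R) : Prop :=
  [/\ forall v, v = \sum_i c i v *: e i,
      forall i (a : R) u v, c i (a *: u + v) = a * c i u + c i v &
      exists K : R, 0 < K /\ forall i v, `|c i v| <= K * `|v|].

(** Induction on the edges of a path parallel to the frame, with the mean value
    theorem on each edge.  The displacement [q] is the part of the path which
    has already been covered. *)
Lemma partial_increment (R : realType) (V : normedModType R) (I : finType)
    (e : I -> V) (c : I -> V -> R) (F : V -> R) (U : set V) (x : V) :
  frame e c -> open U -> U x ->
  (forall i y, U y -> derivable F y (e i)) ->
  (forall i, {for x, continuous (fun y => 'D_(e i) F y)}) ->
  forall (r : seq I) (eps : R), 0 < eps -> exists d : R, 0 < d /\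
    forall q v, `|q| < d -> `|v| < d ->
      `|F (x + q + \sum_(i <- r) c i v *: e i) - F (x + q)
         - \sum_(i <- r) c i v * 'D_(e i) F x|
        <= eps * \sum_(i <- r) `|c i v|.
Proof.
move=> [_ _ [K [K0 cK]]] oU Ux dF cF.
elim=> [|i r IH] eps eps0.
  exists 1; split=> // q v _ _.
  by rewrite !big_nil addr0 !subrr normr0 mulr0.
have [d1 [d10 {}IH]] := IH eps eps0.
have [d2 /= d20 Ud2] : exists2 d2 : R, 0 < d2 & forall y, `|x - y| < d2 ->
    U y /\ `|'D_(e i) F x - 'D_(e i) F y| <= eps.
  have A : \forall y \near x, U y /\ `|'D_(e i) F x - 'D_(e i) F y| <= eps.
    near=> y; split; first by near: y; exact: open_nbhs_nbhs.
    by near: y; move/cvgr_dist_le : (cF i) => /(_ _ eps0).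
  have [d /= d0 H] := (nbhs_normP _ _).1 A.
  by exists d => // y xy; apply: H.
set M := 1 + K * `|e i|.
have M0 : 0 < M by rewrite ltr_wpDr// mulr_ge0 // ltW.
have d0 : 0 < Num.min d1 d2 / (2 * M).
  by rewrite divr_gt0 ?mulr_gt0// lt_min d10 d20.
exists (Num.min d1 d2 / (2 * M)); split => // q v qd vd.
set dd := Num.min d1 d2 in d0 qd vd.
have dd1 : dd <= d1 by rewrite /dd ge_min lexx.
have dd2 : dd <= d2 by rewrite /dd ge_min lexx orbT.
have dd0 : 0 < dd by rewrite /dd lt_min d10 d20.
have small : dd / (2 * M) <= dd / 2.
  rewrite ler_pM2l// lef_pV2 ?posrE ?mulr_gt0//.
  by rewrite ler_peMr// /M lerDl mulr_ge0// ltW.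
have civ : `|c i v| * `|e i| <= dd / 2.
  have H1 : `|c i v| * `|e i| <= K * `|v| * `|e i| by rewrite ler_wpM2r.
  apply: (le_trans H1).
  have H2 : K * `|v| * `|e i| = K * `|e i| * `|v| by ring.
  rewrite H2; apply: (le_trans (y := M * (dd / (2 * M)))).
    apply: ler_pM => //; first by rewrite mulr_ge0// ltW.
    - by rewrite /M lerDr.
    - exact: ltW.
  by rewrite le_eqVlt; apply/orP; left; apply/eqP; field; rewrite gt_eqF.
have qn : `|q| < dd / 2 by exact: lt_le_trans small.
have pt (t : R) : 0 <= t <= 1 -> `|q + (t * c i v) *: e i| < dd.
  move=> /andP[t0 t1]; apply: le_lt_trans (ler_normD _ _) _.
  rewrite normrZ normrM (ger0_norm t0).
  have : t * `|c i v| * `|e i| <= dd / 2.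
    apply: le_trans civ; rewrite ler_wpM2r// -[leRHS]mul1r ler_wpM2r//.
  by move=> H; rewrite [ltRHS]splitr ltr_leD.
rewrite !big_cons.
have key : `|F (x + q + c i v *: e i) - F (x + q) - c i v * 'D_(e i) F x|
    <= eps * `|c i v|.
  pose g (t : R) := F ((t * c i v) *: e i + (x + q)).
  have Ut (t : R) : 0 <= t <= 1 -> U ((t * c i v) *: e i + (x + q)) /\
     `|'D_(e i) F x - 'D_(e i) F ((t * c i v) *: e i + (x + q))| <= eps.
    move=> t01; apply: Ud2.
    rewrite (_ : x - _ = - (q + (t * c i v) *: e i)); last first.
      by rewrite !opprD addrCA [x + _]addrA subrr add0r addrC.
    by rewrite normrN; apply: lt_le_trans (pt t t01) _.
  have dg (t : R) : t \in `]0, 1[ -> is_derive t 1 g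
      (c i v * 'D_(e i) F ((t * c i v) *: e i + (x + q))).
    rewrite in_itv/= => /andP[t0 t1].
    have [Utt _] := Ut t (introT andP (conj (ltW t0) (ltW t1))).
    have D1 := is_derive_line (dF i _ Utt).
    have D2 : is_derive t 1 (fun h : R => h * c i v) (c i v).
      apply: is_derive_eq; rewrite /= scaler0 add0r.
      by rewrite -[LHS]/(c i v * 1) mulr1.
    have := @is_derive1_comp R (fun h => F (h *: e i + (x + q)))
      (fun h : R => h * c i v) t _ _ D1 D2.
    by rewrite mulrC.
  have cg : {within `[0, 1], continuous g}.
    apply: derivable_within_continuous => t; rewrite in_itv/= => t01.
    have [Utt _] := Ut t t01.
    have D1 := is_derive_line (dF i _ Utt).
    have D2 : is_derive t 1 (fun h : R => h * c i v) (c i v).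
      apply: is_derive_eq; rewrite /= scaler0 add0r.
      by rewrite -[LHS]/(c i v * 1) mulr1.
    by have [] := @is_derive1_comp R (fun h => F (h *: e i + (x + q)))
      (fun h : R => h * c i v) t _ _ D1 D2.
  have [t tin] := MVT_segment ler01 dg cg.
  rewrite /g mul1r mul0r scale0r add0r subr0 mulr1 => E.
  rewrite [_ + c i v *: e i]addrC E -mulrBr normrM mulrC ler_wpM2r// distrC.
  by have [] := Ut t tin.
have IH2 := IH (q + c i v *: e i) v.
have q1 : `|q + c i v *: e i| < d1.
  by have := pt 1; rewrite mul1r ler01 lexx => /(_ isT) /lt_le_trans; apply.
have v1 : `|v| < d1.
  by rewrite (lt_le_trans vd)// (le_trans small)// (le_trans _ dd1)// ler_pdivrMr// ler_peMr// ?ltW// ltr1n.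
have {}IH2 := IH2 q1 v1.
rewrite mulrDr; set s1 := \sum_(j <- r) _ in IH2 *.
set s2 := \sum_(j <- r) _ in IH2 *.
set s3 := \sum_(j <- r) _ in IH2 *.
have -> : F (x + q + (c i v *: e i + s1)) - F (x + q) -
    (c i v * 'D_(e i) F x + s2) =
   (F (x + q + c i v *: e i) - F (x + q) - c i v * 'D_(e i) F x) +
   (F (x + (q + c i v *: e i) + s1) - F (x + (q + c i v *: e i)) - s2).
  by rewrite !addrA; ring.
by apply: le_trans (ler_normD _ _) _; exact: lerD.
Unshelve. all: by end_near. Qed.

(** The increment of a function is the sum of its increments along the
    successive edges of a path parallel to the frame, and the mean value theorem
    applies to each edge. *)
Lemma C1_differentiable (R : realType) (V : normedModType R) (I : finType)
    (e : I -> V) (c : I -> V -> R) (F : V -> R) (U : set V) (x : V) :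
  frame e c -> open U -> U x ->
  (forall i y, U y -> derivable F y (e i)) ->
  (forall i, {for x, continuous (fun y => 'D_(e i) F y)}) ->
  differentiable F x.
Proof.
move=> fr oU Ux dF cF; have [sumc linc [K [K0 cK]]] := fr.
pose L v := \sum_i c i v * 'D_(e i) F x.
have linL : linear L.
  move=> a u v; rewrite /L scaler_sumr -big_split/=; apply: eq_bigr => i _.
  by rewrite linc mulrDl -mulrA.
pose linM := GRing.isLinear.Build _ _ _ _ _ linL.
pose LL : {linear V -> R} := HB.pack L linM.
have Lb v : `|L v| <= (K * \sum_i `|'D_(e i) F x|) * `|v|.
  rewrite /L (le_trans (ler_norm_sum _ _ _))// mulrAC mulr_sumr.
  by apply: ler_sum => i _; rewrite normrM ler_wpM2r.
have contL : continuous LL.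
  apply: bounded_linear_continuous; apply/linear_boundedP.
  by near=> r => v; apply: (le_trans (Lb v)); rewrite ler_wpM2r.
suff H : F \o shift x = cst (F x) + LL +o_ 0 id.
  by apply/diff_locallyP; rewrite (diff_unique contL H).
apply/eqaddoP => eps eps0.
have cardp : 0 < K * #|I|%:R + 1 by rewrite ltr_wpDl// mulr_ge0// ltW.
have [d [d0 H]] := partial_increment fr oU Ux dF cF (index_enum I)
  (divr_gt0 eps0 cardp).
near=> v.
have vd : `|v| < d.
  near: v; apply/nbhs_normP; exists d => // v /=.
  by rewrite sub0r normrN.
have := H 0 v; rewrite normr0 => /(_ d0 vd).
rewrite addr0 -sumc -/(L v) /= => H1.
have -> : (F \o shift x - (cst (F x) + L)) v = F (x + v) - F x - L v.
  by rewrite !fctE /= [v + x]addrC; ring.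
apply: (le_trans H1); rewrite mulrAC ler_pdivrMr// -mulrA ler_pM2l//.
rewrite mulrDr mulr1 ler_wpDr//.
apply: (le_trans (y := \sum_(i : I) K * `|v|)); first by apply: ler_sum.
rewrite sumr_const -[_ *+ _]mulr_natr cardT.
by rewrite le_eqVlt; apply/orP; left; apply/eqP; ring.
Unshelve. all: by end_near. Qed.

Definition finite_dimensional (R : realType) (V : normedModType R) : Prop :=
  exists (I : finType) (e : I -> V) (c : I -> V -> R), frame e c.

Lemma finite_dimensional_real (R : realType) : @finite_dimensional R R.
Proof.
exists unit, (fun=> 1), (fun=> id); split.
- by move=> v; rewrite big_const card_unit /= addr0 -[RHS]/(v * 1) mulr1.
- by [].
- by exists 1; split => // _ v; rewrite mul1r.
Qed.

Lemma norm_coord_le (R : realType) (m : nat) (v : 'rV[R]_m) (i : 'I_m) :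
  `|v 0 i| <= `|v|.
Proof.
rewrite [leRHS]/Num.norm/= mx_normrE; apply/bigmax_geP; right => /=.
by exists (0, i).
Qed.

Lemma finite_dimensional_row (R : realType) (m : nat) :
  @finite_dimensional R 'rV[R]_m.
Proof.
exists 'I_m, (fun i => delta_mx 0 i), (fun i (v : 'rV[R]_m) => v 0 i); split.
- exact: row_sum_delta.
- by move=> i a u v; rewrite !mxE.
- exists 1; split => // i v; rewrite mul1r.
  exact: norm_coord_le.
Qed.

Lemma finite_dimensional_prod (R : realType) (V W : normedModType R) :
  finite_dimensional V -> finite_dimensional W ->
  @finite_dimensional R (V * W)%type.
Proof.
move=> [I [e [c [se le [K [K0 Ke]]]]]] [J [f [d [sf lf [L [L0 Lf]]]]]].
exists (I + J)%type,
  (fun k => match k with inl i => (e i, 0) | inr j => (0, f j) end),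
  (fun k v => match k with inl i => c i v.1 | inr j => d j v.2 end); split.
- move=> [v w]; rewrite big_sumType/=.
  have -> : \sum_i c i v *: (e i, 0 : W) = (v, 0).
    apply: injective_projections => /=.
      by rewrite [RHS](se v) (big_morph fst (id1 := 0) (op1 := +%R)).
    rewrite (big_morph snd (id1 := 0) (op1 := +%R))//.
    by rewrite big1// => i _; rewrite /= scaler0.
  have -> : \sum_i d i w *: (0 : V, f i) = (0, w).
    apply: injective_projections => /=; last first.
      by rewrite [RHS](sf w) (big_morph snd (id1 := 0) (op1 := +%R)).
    rewrite (big_morph fst (id1 := 0) (op1 := +%R))//.
    by rewrite big1// => i _; rewrite /= scaler0.
  by apply: injective_projections; rewrite /= ?addr0 ?add0r.
- by move=> [i|j] a u v /=; rewrite ?le ?lf.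
- exists (K + L); split; first exact: addr_gt0.
  move=> [i|j] [v w] /=; rewrite prod_normE/=.
    apply: (le_trans (Ke i v)); apply: ler_pM => //; first exact: ltW.
      by rewrite lerDl ltW.
    by rewrite le_max lexx.
  apply: (le_trans (Lf j w)); apply: ler_pM => //; first exact: ltW.
    by rewrite lerDr ltW.
  by rewrite le_max lexx orbT.
Qed.

Lemma Cn1_differentiable (R : realType) (V : normedModType R) (F : V -> R)
    (U : set V) (x : V) :
  finite_dimensional V -> open U -> U x -> Cn 1 U F -> differentiable F x.
Proof.
move=> [I [e [c fr]]] oU Ux [_ CF].
apply: (C1_differentiable fr oU Ux).
- by move=> i y Uy; exact: (CF (e i)).1.
- by move=> i; exact: (CF (e i)).2.1.
Qed.

Lemma differentiable_row (R : realType) (V : normedModType R) (n : nat)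
    (F : V -> 'rV[R]_n) (x : V) :
  (forall j, differentiable (fun y => F y 0 j) x) -> differentiable F x.
Proof.
move=> dF; rewrite (_ : F = \sum_j (fun y => F y 0 j *: delta_mx 0 j)); last first.
  by apply/funext => y; rewrite fct_sumE; exact: row_sum_delta.
by apply: differentiable_sum => j; exact: differentiableZl.
Qed.

Lemma Cn1_differentiable_row (R : realType) (V : normedModType R) (n : nat)
    (F : V -> 'rV[R]_n) (U : set V) (x : V) :
  finite_dimensional V -> open U -> U x -> Cn 1 U F -> differentiable F x.
Proof.
move=> [I [e [c fr]]] oU Ux [_ CF]; apply: differentiable_row => j.
have dj i y : U y -> derivable (fun y => F y 0 j) y (e i).
  by move=> Uy; have /derivable_mxP := (CF (e i)).1 y Uy; apply.
have Ej i y : U y -> 'D_(e i) (fun y => F y 0 j) y = ('D_(e i) F y) 0 j.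
  by move=> Uy; rewrite (derive_mx ((CF (e i)).1 y Uy)) mxE.
apply: (C1_differentiable fr oU Ux) => // i.
have cj : {for x, continuous (fun y => ('D_(e i) F y) 0 j)}.
  apply: (@continuous_comp _ _ _ ('D_(e i) F) (fun v : 'rV[R]_n => v 0 j)).
    exact: (CF (e i)).2.1.
  exact: coord_continuous.
suff : 'D_(e i) (fun y => F y 0 j) y @[y --> x] -->
    'D_(e i) (fun y => F y 0 j) x by [].
rewrite (Ej i x Ux); apply: cvg_trans cj; apply: near_eq_cvg; near=> y; rewrite Ej//.
by near: y; exact: open_nbhs_nbhs.
Unshelve. all: by end_near. Qed.

(** * Linear forms and inner products on coordinate space *)

Definition scalar_linear (R : realType) (V : lmodType R) (l : V -> R) : Prop :=
  forall (a : R) u v, l (a *: u + v) = a * l u + l v.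

Definition scalar_bilinear (R : realType) (V : lmodType R) (s : V -> V -> R) :
    Prop :=
  (forall u, scalar_linear (s u)) /\ (forall v, scalar_linear (s^~ v)).

Section scalar_linear.
Context (R : realType) (V : lmodType R) (l : V -> R) (ll : scalar_linear l).

Lemma scalar_linear0 : l 0 = 0.
Proof. by have := ll 1 0 0; rewrite scaler0 addr0 mul1r; lra. Qed.

Lemma scalar_linearZ a v : l (a *: v) = a * l v.
Proof. by have := ll a v 0; rewrite !addr0 scalar_linear0 addr0. Qed.

Lemma scalar_linearD u v : l (u + v) = l u + l v.
Proof. by have := ll 1 u v; rewrite scale1r mul1r. Qed.

Lemma scalar_linearB u v : l (u - v) = l u - l v.
Proof. by rewrite scalar_linearD -scaleN1r scalar_linearZ mulN1r. Qed.

Lemma scalar_linear_sum (I : finType) (v : I -> V) :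
  l (\sum_i v i) = \sum_i l (v i).
Proof. exact: (big_morph l scalar_linearD scalar_linear0). Qed.

End scalar_linear.

Lemma scalar_linear_row (R : realType) (m : nat) (l : 'rV[R]_m -> R) :
  scalar_linear l -> forall v, l v = \sum_i v 0 i * l (delta_mx 0 i).
Proof.
move=> ll v; rewrite {1}(row_sum_delta v) (scalar_linear_sum ll).
by apply: eq_bigr => i _; rewrite (scalar_linearZ ll).
Qed.

Lemma norm_row_le (R : realType) (m : nat) (v : 'rV[R]_m) (B : R) :
  0 <= B -> (forall i, `|v 0 i| <= B) -> `|v| <= B.
Proof.
move=> B0 vB; rewrite [leLHS]/Num.norm/= mx_normrE.
by apply/bigmax_leP; split => // -[i j] _; rewrite /= ord1.
Qed.

Lemma scalar_linear_le (R : realType) (m : nat) (l : 'rV[R]_m -> R) (B : R) :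
  scalar_linear l -> (forall i, `|l (delta_mx 0 i)| <= B) ->
  forall v, `|l v| <= m%:R * B * `|v|.
Proof.
move=> ll lB v; rewrite (scalar_linear_row ll).
apply: (le_trans (ler_norm_sum _ _ _)).
apply: (le_trans (y := \sum_(i < m) B * `|v|)).
  apply: ler_sum => i _; rewrite normrM mulrC; apply: ler_pM => //.
  exact: norm_coord_le.
by rewrite sumr_const card_ord -[_ *+ m]mulr_natl mulrA.
Qed.

Lemma scalar_bilinear_le (R : realType) (m : nat)
    (s : 'rV[R]_m -> 'rV[R]_m -> R) (B : R) :
  scalar_bilinear s ->
  (forall i j, `|s (delta_mx 0 i) (delta_mx 0 j)| <= B) ->
  forall u v, `|s u v| <= m%:R ^+ 2 * B * `|u| * `|v|.
Proof.
move=> [s1 s2] sB u v.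
apply: (le_trans (scalar_linear_le (s1 u) (B := m%:R * B * `|u|) _ v)).
  move=> i; exact: (scalar_linear_le (s2 (delta_mx 0 i))).
by rewrite expr2 !mulrA.
Qed.

Section inner_product.
Context (R : realType) (m : nat) (s : 'rV[R]_m -> 'rV[R]_m -> R).
Context (hs : inner_product s).

Lemma inner_product_bilinear : scalar_bilinear s.
Proof.
have [sC sl _] := hs; split => [u|v] a x y; first exact: sl.
by rewrite sC sl ![s v _]sC.
Qed.

Lemma inner_product_ge0 u : 0 <= s u u.
Proof.
have [_ _ sp] := hs; have [->|u0] := eqVneq u 0; last exact: ltW (sp _ u0).
by rewrite (scalar_linear0 (inner_product_bilinear.1 0)).
Qed.

Lemma inner_product_eq0 u : s u u = 0 -> u = 0.
Proof.
have [_ _ sp] := hs => su; apply/eqP; apply/negPn/negP => /sp.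
by rewrite su ltxx.
Qed.

Lemma cauchy_schwarz u v : s u v ^+ 2 <= s u u * s v v.
Proof.
have [sC _ sp] := hs; have [s1 s2] := inner_product_bilinear.
have [->|v0] := eqVneq v 0.
  by rewrite !(scalar_linear0 (s1 _)) expr2 !mulr0.
have vv := sp _ v0.
have := inner_product_ge0 (s v v *: u - s u v *: v).
rewrite !(scalar_linearB (s1 _)) !(scalar_linearB (s2 _)).
rewrite !(scalar_linearZ (s1 _)) !(scalar_linearZ (s2 _)) (sC v u) => H.
have {}H : 0 <= s v v * (s u u * s v v - s u v ^+ 2).
  by apply: le_trans H _; rewrite le_eqVlt; apply/orP; left; apply/eqP; ring.
by move: H; rewrite pmulr_rge0// subr_ge0.
Qed.

Let gram : 'M[R]_m := \matrix_(i, j) s (delta_mx 0 i) (delta_mx 0 j).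

Let mul_gram (v : 'rV[R]_m) j : (v *m gram) 0 j = s v (delta_mx 0 j).
Proof.
rewrite mxE (scalar_linear_row (inner_product_bilinear.2 (delta_mx 0 j)) v).
by apply: eq_bigr => i _; rewrite mxE.
Qed.

Let gram_unit : gram \in unitmx.
Proof.
rewrite -row_free_unit; apply: inj_row_free => v vG.
apply: inner_product_eq0.
rewrite (scalar_linear_row (inner_product_bilinear.1 v) v) big1// => j _.
by rewrite -mul_gram vG mxE mulr0.
Qed.

Lemma riesz (l : 'rV[R]_m -> R) : scalar_linear l ->
  exists p, forall u, s p u = l u.
Proof.
move=> ll; exists ((\row_j l (delta_mx 0 j)) *m invmx gram) => u.
rewrite (scalar_linear_row (inner_product_bilinear.1 _) u).
rewrite (scalar_linear_row ll u); apply: eq_bigr => j _.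
by rewrite -mul_gram mulmxKV// mxE.
Qed.

Lemma riesz_unique p q : (forall u, s p u = s q u) -> p = q.
Proof.
move=> pq; apply/eqP; rewrite -subr_eq0; apply/eqP/inner_product_eq0.
by rewrite (scalar_linearB (inner_product_bilinear.2 _)) pq subrr.
Qed.

(** The coordinates of a vector are recovered from its products with the basis
    by the inverse Gram matrix, and these products are controlled by the
    Cauchy-Schwarz inequality. *)
Lemma inner_product_coercive : exists C : R, 0 < C /\
  forall v, `|v| ^+ 2 <= C * s v v.
Proof.
pose a j := \sum_i Num.sqrt (s (delta_mx 0 i) (delta_mx 0 i))
  * `|invmx gram i j|.
have a0 j : 0 <= a j by apply: sumr_ge0 => i _; rewrite mulr_ge0// sqrtr_ge0.
have A0 : 0 <= \sum_j a j by apply: sumr_ge0 => j _.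
exists (1 + (\sum_j a j) ^+ 2); split.
  by rewrite ltr_wpDr// sqr_ge0.
move=> v; have vv := inner_product_ge0 v.
have H j : `|v 0 j| <= Num.sqrt (s v v) * \sum_k a k.
  have -> : v 0 j = \sum_i s v (delta_mx 0 i) * invmx gram i j.
    rewrite -{1}(mulmxK gram_unit v) mxE; apply: eq_bigr => i _.
    by rewrite mul_gram.
  apply: (le_trans (ler_norm_sum _ _ _)).
  apply: (le_trans (y := Num.sqrt (s v v) * a j)).
    rewrite mulr_sumr; apply: ler_sum => i _; rewrite normrM mulrA.
    rewrite ler_wpM2r// -sqrtrM// -[leLHS]sqrtr_sqr ler_sqrt.
      exact: cauchy_schwarz.
    by rewrite mulr_ge0// inner_product_ge0.
  rewrite ler_wpM2l ?sqrtr_ge0// (bigD1 j)//= lerDl.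
  by apply: sumr_ge0.
have {}H : `|v| <= Num.sqrt (s v v) * \sum_k a k.
  by apply: norm_row_le => //; rewrite mulr_ge0// sqrtr_ge0.
apply: (le_trans (y := (Num.sqrt (s v v) * \sum_k a k) ^+ 2)).
  by rewrite ler_sqr ?nnegrE// (le_trans _ H).
rewrite exprMn sqr_sqrtr// mulrC ler_wpM2r//.
by rewrite lerDr.
Qed.

End inner_product.

(** This makes the constant of [inner_product_coercive] locally uniform along a
    continuous family of metrics. *)
Lemma coercive_perturbation (R : realType) (m : nat)
    (s t : 'rV[R]_m -> 'rV[R]_m -> R) (C d : R) :
  scalar_bilinear s -> scalar_bilinear t -> 0 < C ->
  (forall v, `|v| ^+ 2 <= C * s v v) ->
  (forall i j, `|t (delta_mx 0 i) (delta_mx 0 j)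
                 - s (delta_mx 0 i) (delta_mx 0 j)| <= d) ->
  m%:R ^+ 2 * d * C <= 1 / 2 ->
  forall v, `|v| ^+ 2 <= 2 * C * t v v.
Proof.
move=> [s1 s2] [t1 t2] C0 sC std dC v.
have b : scalar_bilinear (fun u v => t u v - s u v).
  split=> [u a x y|w a x y]; first by rewrite (t1 u) (s1 u); ring.
  by rewrite (t2 w) (s2 w); ring.
have H := scalar_bilinear_le b std v v.
have H2 : C * (s v v - t v v) <= `|v| ^+ 2 / 2.
  apply: (le_trans (y := C * (m%:R ^+ 2 * d * `|v| * `|v|))).
    by rewrite ler_pM2l// (le_trans _ H)// distrC ler_norm.
  have -> : C * (m%:R ^+ 2 * d * `|v| * `|v|) =
    (m%:R ^+ 2 * d * C) * `|v| ^+ 2 by ring.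
  by rewrite [leRHS]mulrC -div1r; apply: ler_wpM2r => //; rewrite sqr_ge0.
have H3 := sC v; nra.
Qed.

(** * The derivative of a dual norm *)

Lemma is_derive_epsP (R : realType) (f : R -> R) (s d : R) :
  is_derive s 1 f d <->
  forall eps : R, 0 < eps -> exists del : R, 0 < del /\
    forall t, `|t - s| < del -> `|f t - f s - (t - s) * d| <= eps * `|t - s|.
Proof.
split=> [[fs fd] eps eps0|H].
  have /eqaddoP /(_ _ eps0) /nbhs_normP[del /= del0 Hd] := derivable_nbhs fs.
  exists del; split=> // t td.
  have := Hd (t - s); rewrite /= sub0r normrN => /(_ td).
  rewrite !fctE /= /shift fd -[(t - s)%:A]/((t - s) * 1) mulr1 subrK.
  by rewrite -[(t - s) *: d]/((t - s) * d) opprD addrA.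
have Q : (fun h => h^-1 *: ((f \o shift s) (h *: 1) - f s)) @ 0^' --> d.
  apply/cvgrPdist_le => eps eps0; have [del [del0 Hd]] := H _ eps0.
  near=> h.
  have h0 : h != 0 by near: h; exact: nbhs_dnbhs_neq.
  have hd : `|h| < del.
    by near: h; apply: dnbhs0_lt.
  have := Hd (h + s); rewrite addrK => /(_ hd).
  rewrite /= /shift -[h%:A]/(h * 1) mulr1 -[_ *: _]/(_ * _) => H1.
  have -> : d - h^-1 * (f (h + s) - f s) =
    - (h^-1 * (f (h + s) - f s - h * d)) by field.
  by rewrite normrN normrM normfV mulrC ler_pdivrMr ?normr_gt0.
split; first by apply/cvg_ex; exists d.
exact: cvg_lim Q.
Unshelve. all: by end_near. Qed.

Lemma is_derive_lipschitz (R : realType) (f : R -> R) (s d : R) :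
  is_derive s 1 f d -> \forall t \near s, `|f t - f s| <= (`|d| + 1) * `|t - s|.
Proof.
move=> /is_derive_epsP /(_ 1 ltr01) [del [del0 H]].
apply/nbhs_normP; exists del => // t /=; rewrite distrC => /H.
rewrite mul1r => H1.
have -> : f t - f s = (f t - f s - (t - s) * d) + (t - s) * d by ring.
apply: le_trans (ler_normD _ _) _.
by rewrite normrM [X in _ <= X]mulrDl mul1r addrC lerD// mulrC.
Qed.

Lemma is_derive_quadratic (R : realType) (h : R -> R) (s K : R) :
  h s = 0 -> (\forall t \near s, `|h t| <= K * `|t - s| ^+ 2) ->
  is_derive s 1 h 0.
Proof.
move=> hs0 /nbhs_normP[del /= del0 H]; apply/is_derive_epsP => eps eps0.
have K1 : 0 < `|K| + 1 by rewrite ltr_wpDl.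
exists (Num.min del (eps / (`|K| + 1))); split.
  by rewrite lt_min del0 divr_gt0.
move=> t; rewrite lt_min => /andP[t1 t2].
rewrite hs0 subr0 mulr0 subr0.
have := H t; rewrite /= distrC => /(_ t1) /le_trans; apply.
rewrite expr2 mulrA ler_wpM2r//.
rewrite ltr_pdivlMr// in t2.
apply: le_trans (ltW t2); rewrite mulrC ler_wpM2l//.
by rewrite ler_wpDr// ler_norm.
Qed.

(** Along a curve of metrics [H t] the squared dual norm of the covector
    [eta t] is the supremum of [2 * eta t v - H t v v], attained at the dual
    vector [V t].  As in every envelope theorem, the variation of the
    maximizer does not contribute to the derivative. *)
Lemma dual_norm_is_derive (R : realType) (m : nat)
    (H : R -> 'rV[R]_m -> 'rV[R]_m -> R) (eta : R -> 'rV[R]_m -> R)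
    (V : R -> 'rV[R]_m) (s C : R) (deta : 'rV[R]_m -> R)
    (dH : 'rV[R]_m -> 'rV[R]_m -> R) :
  0 < C ->
  (\forall t \near s, [/\ inner_product (H t),
      forall v, H t (V t) v = eta t v & forall v, `|v| ^+ 2 <= C * H t v v]) ->
  (forall v, is_derive s 1 (eta^~ v) (deta v)) ->
  (forall u v, is_derive s 1 (fun t => H t u v) (dH u v)) ->
  is_derive s 1 (fun t => H t (V t) (V t)) (2 * deta (V s) - dH (V s) (V s)).
Proof.
move=> C0 good deta' dH'.
(* The supremum exceeds its value at [V s] by [h t], which is quadratic in
   [t - s]. *)
pose d t := V t - V s.
pose h t := H t (d t) (d t).
have [ips Vs _] := nbhs_singleton good.
have D1 : is_derive s 1 (fun t => 2 * eta t (V s) - H t (V s) (V s))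
    (2 * deta (V s) - dH (V s) (V s)).
  have D0 : is_derive s 1 (2 \*: (eta^~ (V s))) (2 *: deta (V s)).
    exact: is_deriveZ.
  exact: is_deriveB D0 (dH' _ _).
pose rho i t := eta t (delta_mx 0 i) - H t (V s) (delta_mx 0 i).
have rho_d i : is_derive s 1 (rho i)
    (deta (delta_mx 0 i) - dH (V s) (delta_mx 0 i)) by exact: is_deriveB.
pose K := \sum_i (`|deta (delta_mx 0 i) - dH (V s) (delta_mx 0 i)| + 1).
have K0 : 0 <= K by apply: sumr_ge0 => i _; rewrite addr_ge0.
have rho_le : \forall t \near s, forall i, `|rho i t| <= K * `|t - s|.
  apply: (@filter_forall R 'I_m (fun i t => `|rho i t| <= K * `|t - s|)
    (nbhs s)) => i.
  have := is_derive_lipschitz (rho_d i); apply: filterS => t.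
  rewrite [rho i s]/rho Vs subrr subr0 => /le_trans; apply.
  rewrite ler_wpM2r// /K [leRHS](bigD1 i)//= lerDl.
  by apply: sumr_ge0 => j _; rewrite addr_ge0.
have D2 : is_derive s 1 h 0.
  apply: (@is_derive_quadratic _ _ _ (C * (m%:R * K) ^+ 2)).
    rewrite /h /d subrr.
    by rewrite (scalar_linear0 ((inner_product_bilinear ips).1 0)).
  near=> t.
  have [ip Vt coer] : [/\ inner_product (H t),
      forall v, H t (V t) v = eta t v & forall v, `|v| ^+ 2 <= C * H t v v].
    by near: t.
  have rt : forall i, `|rho i t| <= K * `|t - s| by near: t.
  have [b1 b2] := inner_product_bilinear ip.
  have Hd v : H t (d t) v = eta t v - H t (V s) v.
    by rewrite /d (scalar_linearB (b2 v)) Vt.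
  have Hdv := scalar_linear_le (b1 (d t)) (B := K * `|t - s|).
  have {}Hdv : forall v, `|H t (d t) v| <= m%:R * (K * `|t - s|) * `|v|.
    by apply: Hdv => i; rewrite Hd; exact: rt.
  have hh := Hdv (d t); rewrite -/(h t) in hh.
  have h0 : 0 <= h t by exact: inner_product_ge0.
  set M := m%:R * (K * `|t - s|) in hh *.
  have M0 : 0 <= M by rewrite /M !mulr_ge0.
  have cd := coer (d t); rewrite -/(h t) in cd.
  have dM : `|d t| <= C * M.
    have [->|dn0] := eqVneq (`|d t|) 0; first by rewrite mulr_ge0// ltW.
    have dp : 0 < `|d t| by rewrite lt_neqAle eq_sym dn0 normr_ge0.
    rewrite -(ler_pM2r dp) -expr2; apply: (le_trans cd).
    by rewrite -mulrA ler_pM2l// (le_trans _ hh)// ler_norm.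
  apply: (le_trans hh); apply: (le_trans (y := M * (C * M))).
    by rewrite ler_wpM2l.
  by rewrite le_eqVlt; apply/orP; left; apply/eqP; rewrite /M; ring.
have D3 := is_deriveD D1 D2; rewrite addr0 in D3.
apply: near_eq_is_derive D3; near=> t.
have [ip Vt _] : [/\ inner_product (H t),
    forall v, H t (V t) v = eta t v & forall v, `|v| ^+ 2 <= C * H t v v].
  by near: t.
have [b1 b2] := inner_product_bilinear ip; have [sC _ _] := ip.
rewrite /= fctE /h /d (scalar_linearB (b1 _)) !(scalar_linearB (b2 _)).
by rewrite (sC (V s) (V t)) !Vt; ring.
Unshelve. all: by end_near. Qed.

(** * Tangent vectors in charts *)

Lemma near_eq_differentiable (R : realType) (V W : normedModType R)
    (f g : V -> W) (x : V) :
  (\forall y \near x, f y = g y) -> differentiable f x -> differentiable g x.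
Proof.
move=> fg df; have fgx := nbhs_singleton fg.
have cont := diff_continuous df.
suff H : g \o shift x = cst (g x) + 'd f x +o_ 0 id.
  by apply/diff_locallyP; rewrite (diff_unique cont H).
have /eqaddoP dfo := diff_locally df.
apply/eqaddoP => eps eps0; have := dfo _ eps0.
have : \forall h \near (0 : V), f (h + x) = g (h + x).
  move/nbhs_normP : fg => [d /= d0 fg]; apply/nbhs_normP; exists d => // h /=.
  rewrite sub0r normrN => hd; apply: fg => /=.
  by rewrite opprD addrCA subrr addr0 normrN.
apply: filterS2 => h E; apply: le_trans.
by rewrite !fctE /= /shift /= -E fgx.
Qed.

Section atlas.
Context (R : realType) (m : nat) (Y : topologicalType) (A : atlas R m Y).

Let transition (c c' : chart A) := cmap c' \o cinv c.

Lemma near_overlap (c c' : chart A) y : dom c y -> dom c' y ->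
  \forall x \near cmap c y, (cmap c @` (dom c `&` dom c')) x.
Proof.
move=> cy c'y.
have : \forall x \near cmap c y, (cmap c @` dom c) x.
  by apply: open_nbhs_nbhs; split; [exact: img_open|exists y].
have : \forall x \near cmap c y, dom c' (cinv c x).
  apply: (cinv_continuous cy); rewrite cmapK//.
  by apply: open_nbhs_nbhs; split => //; exact: dom_open.
apply: filterS2 => x + [y' cy' E]; rewrite -E cmapK// => c'y'.
by exists y'.
Qed.

Lemma transition_differentiable (c c' : chart A) y : dom c y -> dom c' y ->
  differentiable (transition c c') (cmap c y).
Proof.
move=> cy c'y.
have [|U [F [oU Ux CF E]]] := @transition_smooth _ _ _ A c c' (cmap c y).
  by exists y.
have dF := Cn1_differentiable_row (finite_dimensional_row R m) oU Ux (CF 1).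
apply: near_eq_differentiable dF; near=> x; apply: E.
  by near: x; exact: open_nbhs_nbhs.
by near: x; exact: near_overlap.
Unshelve. all: by end_near. Qed.

(** The chain rule for two mutually inverse transition maps; it makes [tvec]
    bijective in its last argument. *)
Lemma diff_transitionK (c c' : chart A) y v : dom c y -> dom c' y ->
  'd (transition c' c) (cmap c' y) ('d (transition c c') (cmap c y) v) = v.
Proof.
move=> cy c'y.
have d1 := transition_differentiable cy c'y.
have d2 := transition_differentiable c'y cy.
have E : transition c c' (cmap c y) = cmap c' y by rewrite /transition/= cmapK.
have d2' : differentiable (transition c' c) (transition c c' (cmap c y)).
  by rewrite E.
have /(congr1 (fun g => g v)) /= := @diff_comp _ _ _ _ _ _ _ d1 d2'.
rewrite E => <-.
rewrite -deriveE; last exact: differentiable_comp.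
have : \forall x \near cmap c y, id x = (transition c' c \o transition c c') x.
  apply: filterS (near_overlap cy c'y) => x [y' [cy' c'y'] <-] /=.
  by rewrite /transition/= (cmapK cy') cmapK.
by move=> /near_eq_derive <-; rewrite derive_id.
Qed.

Lemma tvecE (c : chart A) y v : dom c y ->
  tvec c (cmap c y) v = 'd (transition c (chart_at A y)) (cmap c y) v.
Proof.
move=> cy; rewrite /tvec cmapK// deriveE//.
by apply: transition_differentiable => //; exact: dom_chart_at.
Qed.

Lemma tvec_linear (c : chart A) y (a : R) u v : dom c y ->
  tvec c (cmap c y) (a *: u + v) =
  a *: tvec c (cmap c y) u + tvec c (cmap c y) v.
Proof. by move=> cy; rewrite !tvecE// linearP. Qed.

Lemma tvec_eq0 (c : chart A) y v : dom c y -> tvec c (cmap c y) v = 0 -> v = 0.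
Proof.
move=> cy; rewrite tvecE// => v0.
have K := diff_transitionK v cy (dom_chart_at A y).
pose D := 'd (transition (chart_at A y) c) (cmap (chart_at A y) y).
exact: etrans (esym K) (etrans (congr1 D v0) (linear0 D)).
Qed.

Lemma tvec_surj (c : chart A) y p : dom c y ->
  exists v, tvec c (cmap c y) v = p.
Proof.
move=> cy; exists ('d (transition (chart_at A y) c) (cmap (chart_at A y) y) p).
by rewrite tvecE// diff_transitionK//; exact: dom_chart_at.
Qed.

Lemma velocity_tvec (c : chart A) (y : R -> Y) t :
  {for t, continuous y} -> dom c (y t) -> derivable (cmap c \o y) t 1 ->
  velocity A y t = tvec c (cmap c (y t)) (derive1 (cmap c \o y) t).
Proof.
move=> yt cy /derivable1_diffP dy.
have d1 := transition_differentiable cy (dom_chart_at A (y t)).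
rewrite tvecE// /velocity derive1E.
have : \forall s \near t, (transition c (chart_at A (y t)) \o (cmap c \o y)) s =
    (cmap (chart_at A (y t)) \o y) s.
  have : \forall s \near t, dom c (y s).
    by apply: yt; apply: open_nbhs_nbhs; split => //; exact: dom_open.
  by apply: filterS => s cys; rewrite /transition/= cmapK.
move=> /near_eq_derive <-.
rewrite deriveE; last exact: differentiable_comp.
have := @diff_comp _ _ _ _ _ _ _ dy d1 => ->.
by rewrite /= derive1E' .
Qed.

End atlas.

(** * Functions which are smooth on the blow-up *)

Definition polar_radius (R : realType) (e z : R) : R :=
  Num.sqrt (e ^+ 2 + z ^+ 2).

Definition polar_angle (R : realType) (e z : R) : R := atan (z / e).

Section polar.
Context (R : realType) (e z : R) (e0 : 0 < e).

Lemma polar_radius_gt0 : 0 < polar_radius e z.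
Proof. by rewrite sqrtr_gt0 ltr_wpDr ?sqr_ge0// exprn_gt0. Qed.

Let radiusE : polar_radius e z = e * Num.sqrt (1 + (z / e) ^+ 2).
Proof.
rewrite /polar_radius -{2}(gtr0_norm e0) -sqrtr_sqr -sqrtrM ?sqr_ge0//.
by congr Num.sqrt; field; rewrite gt_eqF.
Qed.

Let sqrt_gt0 : 0 < Num.sqrt (1 + (z / e) ^+ 2).
Proof. by rewrite sqrtr_gt0 ltr_wpDr ?sqr_ge0. Qed.

Lemma polar_cos : polar_radius e z * cos (polar_angle e z) = e.
Proof.
by rewrite radiusE /polar_angle cos_atan mulfK// gt_eqF.
Qed.

Lemma polar_sin : polar_radius e z * sin (polar_angle e z) = z.
Proof.
have c0 : cos (polar_angle e z) != 0.
  by rewrite /polar_angle cos_atan invr_neq0// gt_eqF.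
have -> : sin (polar_angle e z) = z / e * cos (polar_angle e z).
  by rewrite -[in X in _ = X * _](atanK (z / e)) /tan mulrVK// unitfE.
by rewrite mulrCA polar_cos mulfVK// gt_eqF.
Qed.

Lemma polar_angle_bounds : - (pi / 2) <= polar_angle e z <= pi / 2.
Proof. by rewrite /polar_angle !ltW ?atan_gtNpi2 ?atan_ltpi2. Qed.

Lemma polar_radius_differentiable : differentiable (polar_radius e) z.
Proof.
apply/derivable1_diffP.
have p : 0 < e ^+ 2 + z ^+ 2 by rewrite ltr_wpDr ?sqr_ge0// exprn_gt0.
have D1 : is_derive z 1 (fun t : R => e ^+ 2 + t ^+ 2) (z *+ 2).
  by apply: is_derive_eq; rewrite /GRing.scale/=; ring.
have D2 := is_derive1_sqrt p.
by have [] := @is_derive1_comp R Num.sqrt (fun t : R => e ^+ 2 + t ^+ 2)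
   z _ _ D2 D1.
Qed.

Lemma polar_angle_differentiable : differentiable (polar_angle e) z.
Proof.
apply/derivable1_diffP.
have D1 : is_derive z 1 (fun t : R => e^-1 * t) (e^-1).
  by apply: is_derive_eq; rewrite /GRing.scale/=; ring.
have D2 := is_derive1_atan (e^-1 * z).
rewrite (_ : polar_angle e = atan \o (fun t => e^-1 * t)); last first.
  by apply/funext => t; rewrite /polar_angle /= mulrC.
by have [] := @is_derive1_comp R atan (fun t : R => e^-1 * t) z _ _ D2 D1.
Qed.

Lemma polar_blowup (eps0 : R) (J : set R) : e < eps0 -> J z ->
  blowup eps0 J (polar_radius e z, polar_angle e z).
Proof.
move=> ee0 Jz; split => /=.
- exact/ltW/polar_radius_gt0.
- exact: polar_angle_bounds.
- by rewrite polar_cos.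
- by rewrite polar_sin.
Qed.

End polar.

Lemma derive_slice (R : realType) (U V W : normedModType R) (G : U * V -> W)
    (z : U) (x v : V) :
  'D_(0, v) G (z, x) = 'D_v (fun x' => G (z, x')) x.
Proof.
rewrite /derive; set d := (fun _ : R => _); set d' := (fun _ : R => _).
suff -> : d = d' by [].
apply/funext => t; rewrite /d /d' /= /shift/=; congr (_ *: (G _ - _)).
by apply: injective_projections => //=; rewrite scaler0 add0r.
Qed.

Lemma derive_slice1 (R : realType) (V W : normedModType R) (G : R * V -> W)
    (z : R) (x : V) :
  'D_(1, 0) G (z, x) = derive1 (fun z' => G (z', x)) z.
Proof.
rewrite derive1E /derive; set d := (fun _ : R => _); set d' := (fun _ : R => _).
suff -> : d = d' by [].
apply/funext => t; rewrite /d /d' /= /shift/=; congr (_ *: (G _ - _)).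
by apply: injective_projections => //=; rewrite scaler0 add0r.
Qed.

Section smooth_on_blowup.
Context (R : realType) (m : nat) (Y : topologicalType) (A : atlas R m Y).
Context (eps0 : R) (J : set R) (c : chart A).
Implicit Type F : R * R * 'rV[R]_m -> R.

Let D := blowup_chart eps0 J c.

Lemma smooth_continuous F : smooth_on D F -> forall q0, D q0 ->
  forall d : R, 0 < d -> \forall q \near q0, D q -> `|F q - F q0| <= d.
Proof.
move=> sF q0 Dq0 d d0; have [U [G [oU Uq0 CG E]]] := sF q0 Dq0.
have cG := (CG 0).1 _ Uq0.
have nU : \forall q \near q0, U q by exact: open_nbhs_nbhs.
have nG : \forall q \near q0, `|G q0 - G q| <= d.
  by move/cvgr_dist_le : cG; apply.
apply: filterS2 nU nG => q Uq Gq Dq.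
by rewrite -!E// distrC.
Qed.

Let slice_eq F G (U : set (R * R * 'rV[R]_m)) q : open U -> U q -> D q ->
  (forall p, U p -> D p -> G p = F p) ->
  \forall x \near q.2, G (q.1, x) = F (q.1, x).
Proof.
move=> oU Uq Dq E.
have H1 : \forall x \near q.2, (cmap c @` dom c) x.
  by apply: open_nbhs_nbhs; split; [exact: img_open|exact: Dq.2].
have H2 : \forall x \near q.2, U (q.1, x).
  have cq : {for q.2, continuous (fun x : 'rV[R]_m => (q.1, x))}.
    by apply: differentiable_continuous; apply: differentiable_pair.
  have nU : nbhs (q.1, q.2) U.
    by apply: open_nbhs_nbhs; split => //; rewrite -surjective_pairing.
  exact: (cq _ nU).
apply: filterS2 H1 H2 => x cx Ux; apply: E => //.
by split; [exact: Dq.1|].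
Qed.

Lemma smooth_bounded F (v : 'rV[R]_m) : smooth_on D F -> forall q0, D q0 ->
  exists B : R, \forall q \near q0, D q ->
    `|F q| <= B /\ `|'D_v (fun x => F (q.1, x)) q.2| <= B.
Proof.
move=> sF q0 Dq0; have [U [G [oU Uq0 CG E]]] := sF q0 Dq0.
have cG := (CG 0).1 _ Uq0.
have [_ /(_ ((0, 0), v)) [dG [cdG _]]] := CG 1.
have {}cdG := cdG _ Uq0.
exists (`|G q0| + 1 + (`|'D_(0, 0, v) G q0| + 1)).
have nU : \forall q \near q0, U q by exact: open_nbhs_nbhs.
have nG : \forall q \near q0, `|G q0 - G q| <= 1.
  by move/cvgr_dist_le : cG; apply.
have nG' : \forall q \near q0, `|'D_(0, 0, v) G q0 - 'D_(0, 0, v) G q| <= 1.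
  by move/cvgr_dist_le : cdG; apply.
have bound (a b : R) : `|a - b| <= 1 -> `|b| <= `|a| + 1.
  by move=> ab; rewrite -lerBlDl (le_trans _ ab)// distrC lerB_dist.
have sl p : 'D_(0, 0, v) G p = 'D_v (fun x => G (p.1, x)) p.2.
  by case: p => p1 p2; rewrite -derive_slice.
near=> q => Dq.
have Uq : U q by near: q.
have h1 : `|F q| <= `|G q0| + 1 by rewrite -E//; apply: bound; near: q.
have h2 : `|'D_v (fun x => F (q.1, x)) q.2| <= `|'D_(0, 0, v) G q0| + 1.
  have := near_eq_derive v (slice_eq oU Uq Dq E) => <-.
  rewrite -sl.
  by apply: bound; near: q.
split; first by apply: (le_trans h1); rewrite lerDl addr_ge0.
by apply: (le_trans h2); rewrite lerDr addr_ge0.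
Unshelve. all: by end_near. Qed.

(** Away from the corner [r = 0] the polar coordinates are diffeomorphic to
    [(e, z)], so a lift which is smooth on the blow-up gives a function which
    is differentiable in [(z, x)]. *)
Lemma lift_differentiable F (g : R -> R -> 'rV[R]_m -> R) (e z : R)
    (x : 'rV[R]_m) : open J -> smooth_on D F ->
  (forall q, D q -> 0 < q.1.1 ->
     F q = g (q.1.1 * cos q.1.2) (q.1.1 * sin q.1.2) q.2) ->
  0 < e < eps0 -> J z -> (cmap c @` dom c) x ->
  differentiable (fun p : R * 'rV[R]_m => g e p.1 p.2) (z, x).
Proof.
move=> oJ sF Fg /andP[e0 ee0] Jz cx.
pose pol (p : R * 'rV[R]_m) := ((polar_radius e p.1, polar_angle e p.1), p.2).
have Dpol p : J p.1 -> (cmap c @` dom c) p.2 -> D (pol p).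
  by move=> Jp cp; split => //; exact: polar_blowup.
have [U [G [oU Uq CG E]]] := sF (pol (z, x)) (Dpol (z, x) Jz cx).
have dpol : differentiable pol (z, x).
  have d1 : differentiable (fst : R * 'rV[R]_m -> R) (z, x).
    by apply: linear_differentiable => p; exact: cvg_fst.
  have d2 : differentiable (snd : R * 'rV[R]_m -> 'rV[R]_m) (z, x).
    by apply: linear_differentiable => p; exact: cvg_snd.
  apply: differentiable_pair => //; apply: differentiable_pair.
    apply: (@differentiable_comp _ _ _ _ fst (polar_radius e)) => //.
    exact: polar_radius_differentiable.
  apply: (@differentiable_comp _ _ _ _ fst (polar_angle e)) => //.
  exact: polar_angle_differentiable.
have fd : finite_dimensional (R * R * 'rV[R]_m)%type.
  apply: finite_dimensional_prod; last exact: finite_dimensional_row.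
  by apply: finite_dimensional_prod; exact: finite_dimensional_real.
have dG := Cn1_differentiable fd oU Uq (CG 1).
apply: (near_eq_differentiable (f := G \o pol)); last first.
  exact: differentiable_comp.
have n1 : \forall p \near (z, x), U (pol p).
  by apply: (differentiable_continuous dpol); exact: open_nbhs_nbhs.
have n2 : \forall p \near (z, x), J p.1.
  have : {for (z, x), continuous (fst : R * 'rV[R]_m -> R)} by exact: cvg_fst.
  by apply; exact: open_nbhs_nbhs.
have n3 : \forall p \near (z, x), (cmap c @` dom c) p.2.
  have : {for (z, x), continuous (snd : R * 'rV[R]_m -> 'rV[R]_m)}.
    exact: cvg_snd.
  by apply; apply: open_nbhs_nbhs; split => //; exact: img_open.
near=> p.
have Jp : J p.1 by near: p.
have cp : (cmap c @` dom c) p.2 by near: p.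
have Up : U (pol p) by near: p.
rewrite /= E//; last exact: Dpol.
rewrite Fg /=; [|exact: Dpol|exact: polar_radius_gt0].
by rewrite polar_cos// polar_sin.
Unshelve. all: by end_near. Qed.

Lemma lift_slice_derive F (g : R -> R -> 'rV[R]_m -> R) q v :
  (forall q, D q -> 0 < q.1.1 ->
     F q = g (q.1.1 * cos q.1.2) (q.1.1 * sin q.1.2) q.2) ->
  D q -> 0 < q.1.1 ->
  'D_v (g (q.1.1 * cos q.1.2) (q.1.1 * sin q.1.2)) q.2 =
  'D_v (fun x => F (q.1, x)) q.2.
Proof.
move=> Fg Dq q0; apply/esym/near_eq_derive.
have : \forall x \near q.2, (cmap c @` dom c) x.
  by apply: open_nbhs_nbhs; split; [exact: img_open|exact: Dq.2].
apply: filterS => x cx; rewrite Fg//.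
by split => //; exact: Dq.1.
Qed.

End smooth_on_blowup.

(** * Uniform bounds near the waist *)

Lemma exists_bound_forall (R : realType) (I : finType) (T : Type)
    (F : set_system T) (P : I -> R -> T -> Prop) : Filter F ->
  (forall i B B' q, B <= B' -> P i B q -> P i B' q) ->
  (forall i, exists B, \forall q \near F, P i B q) ->
  exists B, \forall q \near F, forall i, P i B q.
Proof.
move=> FF mono /choice[B HB].
exists (\sum_i `|B i|).
apply: (@filter_forall T I (fun i => P i (\sum_i `|B i|)) F) => i.
apply: filterS (HB i) => q; apply: mono.
rewrite (bigD1 i)//= (le_trans (ler_norm _))// lerDl.
by apply: sumr_ge0.
Qed.

Section chart_components.
Context (R : realType) (m : nat) (Y : topologicalType) (A : atlas R m Y).
Implicit Type c : chart A.

Definition chart_form (b : R -> R -> Y -> 'rV[R]_m -> R) c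
    (e z : R) (x v : 'rV[R]_m) : R := b e z (cinv c x) (tvec c x v).

Definition chart_tensor (h : R -> R -> Y -> 'rV[R]_m -> 'rV[R]_m -> R) c
    (e z : R) (x u v : 'rV[R]_m) : R :=
  h e z (cinv c x) (tvec c x u) (tvec c x v).

Lemma chart_inner_product (s : 'rV[R]_m -> 'rV[R]_m -> R) c y : dom c y ->
  inner_product s ->
  inner_product (fun u v => s (tvec c (cmap c y) u) (tvec c (cmap c y) v)).
Proof.
move=> cy [sC sl sp]; split => [u v|a u v v'|u u0] /=.
- exact: sC.
- by rewrite tvec_linear// sl.
- apply: sp; apply: contra_neq u0; exact: tvec_eq0.
Qed.

Lemma chart_scalar_linear (l : 'rV[R]_m -> R) c y : dom c y ->
  scalar_linear l -> scalar_linear (fun v => l (tvec c (cmap c y) v)).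
Proof. by move=> cy ll a u v; rewrite tvec_linear// ll. Qed.

End chart_components.

(** Bounds at one point, in one chart, for all the quantities which enter the
    variation of the angular momentum of a geodesic.  Only the derivative of
    [h] in [z] occurs: those of [S] and [b] are unbounded in general. *)
Record tame_at (R : realType) (m : nat) (Y : topologicalType)
    (A : atlas R m Y) (S : R -> R -> Y -> R)
    (b : R -> R -> Y -> 'rV[R]_m -> R)
    (h : R -> R -> Y -> 'rV[R]_m -> 'rV[R]_m -> R)
    (C e z : R) (y : Y) (c : chart A) : Prop := TameAt {
  tame_dom : dom c y;
  tame_S : `|S e z y| <= C;
  tame_b : forall i, `|chart_form b c e z (cmap c y) (delta_mx 0 i)| <= C;
  tame_coercive : forall v,
    `|v| ^+ 2 <= C * chart_tensor h c e z (cmap c y) v v;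
  tame_dS : forall i,
    `|'D_(delta_mx 0 i) (fun x => S e z (cinv c x)) (cmap c y)| <= C;
  tame_db : forall i j, `|'D_(delta_mx 0 i)
    (fun x => chart_form b c e z x (delta_mx 0 j)) (cmap c y)| <= C;
  tame_dh : forall i j k, `|'D_(delta_mx 0 i) (fun x =>
    chart_tensor h c e z x (delta_mx 0 j) (delta_mx 0 k)) (cmap c y)| <= C;
  tame_dzh : forall j k, `|derive1 (fun z' =>
    chart_tensor h c e z' (cmap c y) (delta_mx 0 j) (delta_mx 0 k)) z| <= C
}.

Lemma interval_ball (R : realType) (J : set R) (eps0 : R) :
  open J -> J 0 -> 0 < eps0 ->
  exists r : R, [/\ 0 < r, r < eps0 & forall z, `|z| <= r -> J z].
Proof.
move=> oJ J0 e0.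
have /nbhs_normP[d /= d0 H] : nbhs (0 : R) J by exact: open_nbhs_nbhs.
exists (Num.min d eps0 / 2); have m0 : 0 < Num.min d eps0 by rewrite lt_min d0.
have m1 : Num.min d eps0 / 2 < Num.min d eps0.
  by rewrite ltr_pdivrMr// ltr_pMr// ltr1n.
split; first by rewrite divr_gt0.
- by rewrite (lt_le_trans m1)// ge_min lexx orbT.
- move=> z zr; apply: H => /=; rewrite sub0r normrN (le_lt_trans zr)//.
  by rewrite (lt_le_trans m1)// ge_min lexx.
Qed.

Section uniform_bounds.
Context (R : realType) (m : nat) (Y : topologicalType) (A : atlas R m Y).
Context (HY : closed_manifold A).
Context (J : set R) (hJo : open J) (hJ0 : J 0).
Context (eps0 : R) (heps0 : 0 < eps0).
Context (S : R -> R -> Y -> R) (hS : admissible_function A eps0 J S).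
Context (b : R -> R -> Y -> 'rV[R]_m -> R) (hb : admissible_form A eps0 J b).
Context (h : R -> R -> Y -> 'rV[R]_m -> 'rV[R]_m -> R).
Context (hh : admissible_metric A eps0 J h).

Let nbhs_chart (c : chart A) (p0 : R * R) (y0 : Y)
    (P : R * R * 'rV[R]_m -> Prop) : dom c y0 ->
  (\forall q \near (p0, cmap c y0), P q) ->
  \forall q \near (p0, y0), dom c q.2 /\ P (q.1, cmap c q.2).
Proof.
move=> cy0 H.
have H1 : \forall q \near (p0, y0), dom c q.2.
  have cs : {for (p0, y0), continuous (snd : R * R * Y -> Y)} by exact: cvg_snd.
  have nd : nbhs y0 (dom c) by apply: open_nbhs_nbhs; split => //; exact: dom_open.
  exact: (cs _ nd).
have [[U V] /= [nU nV] UV] := H.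
have H2 : \forall q \near (p0, y0), V (cmap c q.2).
  have cs : {for (p0, y0), continuous (cmap c \o (snd : R * R * Y -> Y))}.
    by apply: continuous_comp; [exact: cvg_snd|exact: cmap_continuous].
  exact: (cs _ nV).
have H3 : \forall q \near (p0, y0), U q.1.
  have cs : {for (p0, y0), continuous (fst : R * R * Y -> R * R)}.
    exact: cvg_fst.
  exact: (cs _ nU).
by apply: filterS3 H1 H2 H3 => q cq Vq Uq; split => //; exact: UV.
Qed.

(** Every quantity in [tame_at] is a component of the lift to the blow-up, or of
   a derivative of the lift along [Y], and is therefore bounded near each point
   of the blow-up, the boundary [r = 0] included; the derivative of [h] in [z]
   is bounded by assumption. *)
Let near_tame (r0 phi0 : R) (y0 : Y) : blowup eps0 J (r0, phi0) ->
  exists B, \forall q \near ((r0, phi0), y0),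
    blowup eps0 J q.1 -> 0 < q.1.1 -> 0 < q.1.1 * cos q.1.2 ->
    exists c : chart A, forall C, B <= C ->
    tame_at S b h C (q.1.1 * cos q.1.2) (q.1.1 * sin q.1.2) q.2 c.
Proof.
move=> Bq0; pose c := chart_at A y0.
have cy0 : dom c y0 by exact: dom_chart_at.
have [SB [liftS smoothS _]] := hS.
have [bB [liftb _ smoothb]] := hb.
have [[hB [lifth iph smoothh]] dzh] := hh.
pose D := blowup_chart eps0 J c.
pose q0 : R * R * 'rV[R]_m := ((r0, phi0), cmap c y0).
have Dq0 : D q0 by split => //; exists y0.
pose d i : 'rV[R]_m := delta_mx 0 i.
pose FS (q : R * R * 'rV[R]_m) := SB q.1.1 q.1.2 (cinv c q.2).
pose Fb v (q : R * R * 'rV[R]_m) := bB q.1.1 q.1.2 (cinv c q.2) (tvec c q.2 v).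
pose Fh u v (q : R * R * 'rV[R]_m) :=
  hB q.1.1 q.1.2 (cinv c q.2) (tvec c q.2 u) (tvec c q.2 v).
have [B0 H0] := smooth_bounded 0 (smoothS c) Dq0.
have [B1 H1] : exists B, \forall q \near q0, forall i, D q ->
    `|'D_(d i) (fun x => FS (q.1, x)) q.2| <= B.
  apply: (@exists_bound_forall R 'I_m _ (nbhs q0) (fun i B q => D q ->
    `|'D_(d i) (fun x => FS (q.1, x)) q.2| <= B)) => [i B B' q BB' H /H|i].
    by move/le_trans; apply.
  have [B HB] := smooth_bounded (d i) (smoothS c) Dq0.
  by exists B; apply: filterS HB => q H /H[].
have [B2 H2] : exists B, \forall q \near q0, forall ij : 'I_m * 'I_m, D q ->
    `|Fb (d ij.2) q| <= B /\
    `|'D_(d ij.1) (fun x => Fb (d ij.2) (q.1, x)) q.2| <= B.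
  apply: (@exists_bound_forall R _ _ (nbhs q0)
    (fun (ij : 'I_m * 'I_m) B q => D q -> `|Fb (d ij.2) q| <= B /\
    `|'D_(d ij.1) (fun x => Fb (d ij.2) (q.1, x)) q.2| <= B)) => [i B B' q BB' H /H[P1 P2]|[i j]].
    by split; apply: le_trans BB'.
  exact: smooth_bounded (smoothb c (d j)) _ Dq0.
have [B3 H3] : exists B, \forall q \near q0, forall ij : 'I_m * ('I_m * 'I_m),
    D q ->
    `|'D_(d ij.1) (fun x => Fh (d ij.2.1) (d ij.2.2) (q.1, x)) q.2| <= B.
  apply: (@exists_bound_forall R _ _ (nbhs q0)
    (fun (ij : 'I_m * ('I_m * 'I_m)) B q => D q ->
    `|'D_(d ij.1) (fun x => Fh (d ij.2.1) (d ij.2.2) (q.1, x)) q.2| <= B)) => [i B B' q BB' H /H|[i [j k]]].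
    by move/le_trans; apply.
  have [B HB] := smooth_bounded (d i) (smoothh c (d j) (d k)) Dq0.
  by exists B; apply: filterS HB => q H /H[].
(* The hypothesis on the derivative of [h] in [z] speaks of compact sets. *)
have [K [cK KI nK]] : exists K : set 'rV[R]_m,
    [/\ compact K, K `<=` cmap c @` dom c & nbhs (cmap c y0) K].
  have : nbhs (cmap c y0) (cmap c @` dom c).
    by apply: open_nbhs_nbhs; split; [exact: img_open|exists y0].
  move=> /nbhs_closedballP[r Kr].
  exists (closed_ball (cmap c y0) r%:num); split => //.
    apply: bounded_closed_compact; last exact: closed_ball_closed.
    rewrite closed_ballE//; exists (r%:num + `|cmap c y0|).
    split; first exact: num_real.
    move=> M HM x /= xr; apply: le_trans (ltW HM).
    rewrite -(subrK (cmap c y0) x) (le_trans (ler_normD _ _))//.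
    by rewrite lerD2r distrC.
  by apply/nbhs_closedballP; exists r.
have [B4 H4] : exists B, \forall q \near q0, forall jk : 'I_m * 'I_m,
    forall e z, 0 < e < eps0 -> J z ->
    `|derive1 (fun z' => chart_tensor h c e z' q.2 (d jk.1) (d jk.2)) z| <= B.
  apply: (@exists_bound_forall R _ _ (nbhs q0) (fun (jk : 'I_m * 'I_m) B q =>
    forall e z, 0 < e < eps0 -> J z -> `|derive1 (fun z' =>
      chart_tensor h c e z' q.2 (d jk.1) (d jk.2)) z| <= B)) => [i B B' q BB' H e z ee Jz|[j k]].
    by apply: le_trans BB'; exact: H.
  have [B HB] := dzh c K (d j) (d k) cK KI; exists B.
  have cs : {for q0, continuous (snd : R * R * 'rV[R]_m -> 'rV[R]_m)}.
    exact: cvg_snd.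
  have nq : \forall q \near q0, K q.2 by exact: (cs _ nK).
  by apply: filterS nq => q Kq e z ee Jz; exact: HB.
have ipD q y : D (q, cmap c y) -> dom c y ->
    inner_product (fun u v => Fh u v (q, cmap c y)).
  case: q => r phi [/= bq _] cy; rewrite /Fh/= (cmapK cy).
  exact: (chart_inner_product cy (iph _ _ y bq)).
have ip0 := ipD _ _ Dq0 cy0.
have [C0 [C00 HC0]] := inner_product_coercive ip0.
(* How far the components may move before coercivity is lost. *)
pose del := ((m%:R ^+ 2 + 1) * (2 * C0))^-1.
have m0 : 0 < m%:R ^+ 2 + 1 :> R by rewrite ltr_wpDl// sqr_ge0.
have del0 : 0 < del by rewrite invr_gt0 !mulr_gt0.
have del1 : m%:R ^+ 2 * del * C0 <= 1 / 2.
  have -> : m%:R ^+ 2 * del * C0 = m%:R ^+ 2 / (m%:R ^+ 2 + 1) / 2.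
    by rewrite /del; field; rewrite !gt_eqF//= gt_eqF.
  by rewrite ler_pM2r// ler_pdivrMr// mul1r lerDl.
have H5 : \forall q \near q0, forall jk : 'I_m * 'I_m, D q ->
    `|Fh (d jk.1) (d jk.2) q - Fh (d jk.1) (d jk.2) q0| <= del.
  apply: (@filter_forall _ _ (fun (jk : 'I_m * 'I_m) q => D q ->
    `|Fh (d jk.1) (d jk.2) q - Fh (d jk.1) (d jk.2) q0| <= del) (nbhs q0)).
  move=> [j k]; exact: smooth_continuous (smoothh c (d j) (d k)) _ Dq0 _ del0.
exists (`|B0| + `|B1| + `|B2| + `|B3| + `|B4| + 2 * C0).
have both (P Q : R * R * 'rV[R]_m -> Prop) :
    (\forall q \near q0, P q) -> (\forall q \near q0, Q q) ->
    \forall q \near q0, P q /\ Q q.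
  exact: (@filterI _ _ (nbhs_filter q0)).
have N := nbhs_chart cy0 (both _ _ H0 (both _ _ H1 (both _ _ H2 (both _ _ H3
  (both _ _ H4 H5))))).
have [[U V] nUV UV] := N; exists (U, V) => // -[[r phi] y] /= ry.
move: (UV ((r, phi), y) ry) => /= [cy [K0 [K1 [K2 [K3 [K4 K5]]]]]] bq rp ep; exists c => C BC.
have nB (B : R) := conj (ler_norm B) (normr_ge0 B).
have := nB B0; have := nB B1; have := nB B2; have := nB B3; have := nB B4.
move=> [b4 b4'] [b3 b3'] [b2 b2'] [b1 b1'] [b0 b0'].
have BC0 : B0 <= C by lra.
have BC1 : B1 <= C by lra.
have BC2 : B2 <= C by lra.
have BC3 : B3 <= C by lra.
have BC4 : B4 <= C by lra.
have BC5 : 2 * C0 <= C by lra.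
have Dq : D ((r, phi), cmap c y) by split => //; exists y.
set e := r * cos phi; set z := r * sin phi.
have ee : 0 < e < eps0 by rewrite ep /=; case: bq.
have Jz : J z by case: bq.
have lS q : D q -> 0 < q.1.1 -> FS q =
    S (q.1.1 * cos q.1.2) (q.1.1 * sin q.1.2) (cinv c q.2).
  by move: q => [[r' phi'] x] [/= Db _] r'0; rewrite /FS liftS.
have lb v q : D q -> 0 < q.1.1 -> Fb v q =
    chart_form b c (q.1.1 * cos q.1.2) (q.1.1 * sin q.1.2) q.2 v.
  by move: q => [[r' phi'] x] [/= Db _] r'0; rewrite /Fb liftb.
have lh u v q : D q -> 0 < q.1.1 -> Fh u v q =
    chart_tensor h c (q.1.1 * cos q.1.2) (q.1.1 * sin q.1.2) q.2 u v.
  by move: q => [[r' phi'] x] [/= Db _] r'0; rewrite /Fh lifth.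
split => //.
- apply: le_trans BC0; have := (K0 Dq).1.
  by have := lS _ Dq rp; rewrite /FS/= cmapK// => ->.
- move=> i; apply: le_trans BC2; have := (K2 (i, i) Dq).1.
  by have := lb (d i) _ Dq rp; rewrite /Fb/= => ->.
- move=> v; have ip := ipD _ _ Dq cy.
  have := coercive_perturbation (inner_product_bilinear ip0)
    (inner_product_bilinear ip) C00 HC0 (fun j k => K5 (j, k) Dq) del1 v.
  move=> /le_trans; apply; have := lh v v _ Dq rp => /= <-.
  by apply: ler_wpM2r => //; exact: (inner_product_ge0 ip).
- move=> i; apply: le_trans BC1; have := K1 i Dq.
  have := @lift_slice_derive _ _ _ A eps0 J c FS
    (fun e z x => S e z (cinv c x)) _ (d i) lS Dq rp.
  by move=> /= ->.
- move=> i j; apply: le_trans BC2; have := (K2 (i, j) Dq).2.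
  have := @lift_slice_derive _ _ _ A eps0 J c (Fb (d j))
    (fun e z x => chart_form b c e z x (d j)) _ (d i) (lb (d j)) Dq rp.
  by move=> /= ->.
- move=> i j k; apply: le_trans BC3; have := K3 (i, (j, k)) Dq.
  have := @lift_slice_derive _ _ _ A eps0 J c (Fh (d j) (d k))
    (fun e z x => chart_tensor h c e z x (d j) (d k)) _ (d i)
    (lh (d j) (d k)) Dq rp.
  by move=> /= ->.
- move=> j k; apply: le_trans BC4; exact: (K4 (j, k)).
Qed.

(** The local bounds extend to a neighbourhood of the waist because the set
    [0 <= r <= r1] of the blow-up, times [Y], is compact. *)
Lemma uniformly_tame : exists C r1 : R,
  [/\ 0 < C, 0 < r1, r1 < eps0, forall z, `|z| <= r1 -> J z &
      forall e z y, 0 < e < r1 -> `|z| < r1 ->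
        exists c : chart A, tame_at S b h C e z y c].
Proof.
have [r [r0 re rJ]] := interval_ball hJo hJ0 heps0.
have cosin (x : R) : `|cos x| <= 1 /\ `|sin x| <= 1.
  have := cos2Dsin2 x; rewrite -[cos x ^+ 2]real_normK ?num_real//.
  rewrite -[sin x ^+ 2]real_normK ?num_real// => H.
  have := normr_ge0 (cos x); have := normr_ge0 (sin x).
  by split; nra.
have blow r' phi : 0 <= r' <= r -> - (pi / 2) <= phi <= pi / 2 ->
    blowup eps0 J (r', phi).
  move=> /andP[r'0 r'r] hphi; split => //=.
    apply: le_lt_trans re; apply: le_trans r'r.
    rewrite -[leRHS]mulr1 ler_wpM2l// (le_trans (ler_norm _))//.
  apply: rJ; rewrite normrM ger0_norm// -[leRHS]mulr1.
  by apply: ler_pM => //; exact: (cosin phi).2.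
pose K := (`[0, r] `*` `[- (pi / 2), pi / 2]) `*` [set: Y] : set (R * R * Y).
have cK : compact K.
  apply: compact_setX; last exact: HY.1.
  by apply: compact_setX; exact: segment_compact.
have /compact_near_coveringP cov := cK.
pose P (C : R) (q : R * R * Y) := blowup eps0 J q.1 -> 0 < q.1.1 ->
  0 < q.1.1 * cos q.1.2 -> exists c : chart A,
    tame_at S b h C (q.1.1 * cos q.1.2) (q.1.1 * sin q.1.2) q.2 c.
have := cov R (pinfty_nbhs R) P _ _.
have loc q0 : K q0 -> \forall q \near q0 & C \near +oo, P C q.
  move=> [[/= h1 h2] _].
  case: q0 h1 h2 => -[r0' phi0] y0 /= h1 h2.
  have Bq : blowup eps0 J (r0', phi0).
    by apply: blow; move: h1 h2; rewrite !in_itv.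
  have [B HB] := near_tame y0 Bq.
  exists ([set q | blowup eps0 J q.1 -> 0 < q.1.1 -> 0 < q.1.1 * cos q.1.2 ->
    exists c : chart A, forall C, B <= C ->
    tame_at S b h C (q.1.1 * cos q.1.2) (q.1.1 * sin q.1.2) q.2 c],
    [set C | B <= C]) => /=.
    by split => //; apply: nbhs_pinfty_ge; exact: num_real.
  move=> [q C] /= [Hq BC] bq q0 q0'; have [c Hc] := Hq bq q0 q0'.
  by exists c; exact: Hc.
move=> /(_ _ loc) HC.
have [C [C0 HCC]] : exists C : R, 0 < C /\ K `<=` P C.
  near (pinfty_nbhs R) => C; exists C; split; near: C => //.
  by apply: nbhs_pinfty_gt; exact: num_real.
exists C, (r / 2); split => //; first by rewrite divr_gt0.
- by rewrite (lt_trans _ re)// ltr_pdivrMr// ltr_pMr// ltr1n.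
- by move=> z zr; apply: rJ; rewrite (le_trans zr)// ler_pdivrMr// ler_peMr ?ler1n// ltW.
move=> e z y /andP[e0 er] zr.
have rho : polar_radius e z <= r.
  rewrite /polar_radius -(ger0_norm (ltW r0)) -sqrtr_sqr ler_sqrt ?sqr_ge0//.
  have : z ^+ 2 <= (r / 2) ^+ 2.
    by rewrite -real_normK ?num_real// ler_sqr ?nnegrE// ?ltW// divr_gt0.
  have : e ^+ 2 <= (r / 2) ^+ 2 by rewrite ler_sqr ?nnegrE// ?ltW// divr_gt0.
  by rewrite expr_div_n; nra.
have Kq : K (polar_radius e z, polar_angle e z, y).
  split => //; split => /=; rewrite in_itv/=.
    by rewrite rho ltW// polar_radius_gt0.
  exact: polar_angle_bounds.
have := HCC _ Kq; rewrite /P /= polar_cos// polar_sin//; apply => //.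
  apply: blow; last exact: polar_angle_bounds.
  by rewrite rho ltW// polar_radius_gt0.
exact: polar_radius_gt0.
Unshelve. all: by end_near. Qed.

End uniform_bounds.

(** * The variation of the angular momentum at a point *)

Lemma scalar_trilinear_le (R : realType) (m : nat)
    (s : 'rV[R]_m -> 'rV[R]_m -> 'rV[R]_m -> R) (B : R) :
  (forall u, scalar_bilinear (s u)) ->
  (forall v w, scalar_linear (fun u => s u v w)) ->
  (forall i j k, `|s (delta_mx 0 i) (delta_mx 0 j) (delta_mx 0 k)| <= B) ->
  forall u v w, `|s u v w| <= m%:R ^+ 3 * B * `|u| * `|v| * `|w|.
Proof.
move=> s1 s2 sB u v w.
apply: (le_trans (scalar_linear_le (s2 v w)
  (B := m%:R ^+ 2 * B * `|v| * `|w|) _ u)).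
  move=> i; exact: (scalar_bilinear_le (s1 (delta_mx 0 i))).
by rewrite le_eqVlt; apply/orP; left; apply/eqP; ring.
Qed.

Section inner_product_norm.
Context (R : realType) (m : nat) (s : 'rV[R]_m -> 'rV[R]_m -> R).
Context (hs : inner_product s).

Let nrm u := Num.sqrt (s u u).

Let nrmD u v : nrm (u + v) <= nrm u + nrm v.
Proof.
have [s1 s2] := inner_product_bilinear hs; have [sC _ _] := hs.
have uu := inner_product_ge0 hs u; have vv := inner_product_ge0 hs v.
have u0 : 0 <= nrm u by exact: sqrtr_ge0.
have v0 : 0 <= nrm v by exact: sqrtr_ge0.
rewrite -[leRHS]ger0_norm ?addr_ge0// -sqrtr_sqr ler_sqrt ?sqr_ge0//.
rewrite (scalar_linearD (s1 _)) !(scalar_linearD (s2 _)) (sC v u) sqrrD.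
rewrite !sqr_sqrtr//.
have : s u v <= nrm u * nrm v.
  rewrite /nrm -sqrtrM// (le_trans (ler_norm _))// -sqrtr_sqr ler_sqrt.
    exact: cauchy_schwarz.
  exact: mulr_ge0.
by rewrite -mulr_natl => ?; lra.
Qed.

Lemma inner_product_norm_dist u v :
  `|Num.sqrt (s (u - v) (u - v)) - Num.sqrt (s u u)| <= Num.sqrt (s v v).
Proof.
have [s1 s2] := inner_product_bilinear hs.
have h1 := nrmD (u - v) v; rewrite subrK in h1.
have h2 := nrmD u (- v).
have nN : nrm (- v) = nrm v.
  rewrite /nrm -scaleN1r (scalar_linearZ (s1 _)) (scalar_linearZ (s2 _)).
  by rewrite !mulN1r opprK.
rewrite nN in h2; rewrite ler_norml -/(nrm u) -/(nrm v) -/(nrm (u - v)).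
by apply/andP; split; lra.
Qed.

Lemma inner_product_normZ (a : R) u :
  Num.sqrt (s (a *: u) (a *: u)) = `|a| * Num.sqrt (s u u).
Proof.
have [s1 s2] := inner_product_bilinear hs.
rewrite (scalar_linearZ (s1 _)) (scalar_linearZ (s2 _)) mulrA -expr2.
by rewrite sqrtrM ?sqr_ge0// sqrtr_sqr.
Qed.

End inner_product_norm.

(** The part of the variation which is cubic in [V] cancels: it is the geodesic
    equation of the metric [h] alone, for which the length of the covector is
    conserved.  Each remaining term carries a factor [z1].  Here [V] is the
    vector dual to the momentum, [X] the velocity along [Y], [beta] the vector
    dual to [b], and [o], [wk] are the powers of [w] in front of [h] and [S]. *)
Lemma momentum_variation_le (R : realType) (m : nat) (M wk z1 o : R)
    (dS : 'rV[R]_m -> R) (db dz : 'rV[R]_m -> 'rV[R]_m -> R)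
    (dh : 'rV[R]_m -> 'rV[R]_m -> 'rV[R]_m -> R) (V X beta : 'rV[R]_m) :
  0 <= M -> 0 <= wk -> 0 < o ->
  (forall u, scalar_bilinear (dh u)) ->
  (forall v w, scalar_linear (fun u => dh u v w)) ->
  (forall u, scalar_linear (db u)) ->
  (forall v, `|dS v| <= M * `|v|) ->
  (forall u v, `|db u v| <= M * `|u| * `|v|) ->
  (forall u v, `|dz u v| <= M * `|u| * `|v|) ->
  (forall u v w, `|dh u v w| <= M * `|u| * `|v| * `|w|) ->
  `|beta| <= M -> X = o^-1 *: V - z1 *: beta ->
  `| 2 * ((- wk * z1 ^+ 2 * dS V + 2 * o * z1 * db V X + o * dh V X X) / 2)
     - (z1 * dz V V + dh X V V) | <=
  wk * z1 ^+ 2 * M * `|V| + `|z1| * `|V| ^+ 2 * (3 * M + 3 * M ^+ 2)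
  + o * z1 ^+ 2 * `|V| * (2 * M ^+ 2 + M ^+ 3).
Proof.
move=> M0 wk0 o0 dh2 dh1 db2 dSM dbM dzM dhM betaM XE.
have E : 2 * ((- wk * z1 ^+ 2 * dS V + 2 * o * z1 * db V X + o * dh V X X) / 2)
     - (z1 * dz V V + dh X V V) =
  - wk * z1 ^+ 2 * dS V + 2 * z1 * db V V - 2 * o * z1 ^+ 2 * db V beta
  - z1 * (dh V V beta + dh V beta V) + o * z1 ^+ 2 * dh V beta beta
  - z1 * dz V V + z1 * dh beta V V.
  rewrite XE (scalar_linearB (db2 V)) !(scalar_linearZ (db2 V)).
  rewrite (scalar_linearB (dh1 V V)) !(scalar_linearZ (dh1 V V)).
  have [d1 d2] := dh2 V.
  rewrite (scalar_linearB (d1 _)) !(scalar_linearB (d2 _)).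
  rewrite !(scalar_linearZ (d1 _)) !(scalar_linearZ (d2 _)).
  by field; rewrite gt_eqF.
have z20 := sqr_ge0 z1; have o0' := ltW o0.
have V0 := normr_ge0 V; have az0 := normr_ge0 z1; have b0 := normr_ge0 beta.
have t1 : `|- wk * z1 ^+ 2 * dS V| <= wk * z1 ^+ 2 * M * `|V|.
  rewrite 2!normrM normrN (ger0_norm wk0) (ger0_norm z20) -[leRHS]mulrA.
  by rewrite ler_wpM2l// mulr_ge0.
have t2 : `|2 * z1 * db V V| <= 2 * `|z1| * (M * `|V| * `|V|).
  by rewrite !normrM (ger0_norm (ler0n R 2)) ler_wpM2l// mulr_ge0.
have t3 : `|2 * o * z1 ^+ 2 * db V beta| <= 2 * o * z1 ^+ 2 * (M * `|V| * M).
  rewrite 3!normrM (ger0_norm (ler0n R 2)) (ger0_norm o0') (ger0_norm z20).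
  rewrite ler_wpM2l// ?(mulr_ge0 (mulr_ge0 _ _))//; apply: (le_trans (dbM _ _)).
  by rewrite ler_wpM2l// mulr_ge0.
have t4 : `|z1 * (dh V V beta + dh V beta V)| <=
    `|z1| * (2 * (M * `|V| * `|V| * M)).
  rewrite normrM ler_wpM2l//; apply: (le_trans (ler_normD _ _)).
  rewrite mulr2n mulrDl mul1r; apply: lerD; apply: (le_trans (dhM _ _ _)).
    by rewrite ler_wpM2l// !mulr_ge0.
  rewrite -!mulrA ler_wpM2l// ler_wpM2l// [leRHS]mulrC.
  by rewrite ler_wpM2r.
have t5 : `|o * z1 ^+ 2 * dh V beta beta| <= o * z1 ^+ 2 * (M * `|V| * M * M).
  rewrite 2!normrM (ger0_norm o0') (ger0_norm z20).
  apply: ler_wpM2l; first exact: mulr_ge0.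
  apply: (le_trans (dhM _ _ _)).
  by apply: ler_pM => //; rewrite ?mulr_ge0// ler_wpM2l// mulr_ge0.
have t6 : `|z1 * dz V V| <= `|z1| * (M * `|V| * `|V|).
  by rewrite normrM ler_wpM2l.
have t7 : `|z1 * dh beta V V| <= `|z1| * (M * M * `|V| * `|V|).
  rewrite normrM ler_wpM2l//; apply: (le_trans (dhM _ _ _)).
  by rewrite !ler_wpM2r// ler_wpM2l.
rewrite E.
set a1 := - wk * _ * _ in t1 *; set a2 := 2 * z1 * _ in t2 *.
set a3 := 2 * o * _ * _ in t3 *; set a4 := z1 * (_ + _) in t4 *.
set a5 := o * _ * _ in t5 *; set a6 := z1 * dz _ _ in t6 *.
set a7 := z1 * dh _ _ _ in t7 *.
have nD := @ler_normD R R; have nB := @ler_normB R R.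
apply: (le_trans (nD _ _)); apply: (le_trans (lerD (nB _ _) t7)).
apply: (le_trans (lerD (lerD (nD _ _) t6) (lexx _))).
apply: (le_trans (lerD (lerD (lerD (nB _ _) t5) (lexx _)) (lexx _))).
apply: (le_trans (lerD (lerD (lerD (lerD (nB _ _) t4) (lexx _)) (lexx _))
  (lexx _))).
apply: (le_trans (lerD (lerD (lerD (lerD (lerD (nD _ _) t3) (lexx _)) (lexx _))
  (lexx _)) (lexx _))).
apply: (le_trans (lerD (lerD (lerD (lerD (lerD (lerD t1 t2) (lexx _)) (lexx _))
  (lexx _)) (lexx _)) (lexx _))).
by rewrite le_eqVlt; apply/orP; left; apply/eqP; ring.
Qed.

(** * Derivatives along curves *)

Lemma is_derive_curve (R : realType) (V : normedModType R) (F : V -> R)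
    (x : R -> V) (s : R) : derivable x s 1 -> differentiable F (x s) ->
  is_derive s 1 (F \o x) ('D_(derive1 x s) F (x s)).
Proof.
move=> /derivable1_diffP dx dF.
have dFx : differentiable (F \o x) s by exact: differentiable_comp.
split; first exact: diff_derivable.
rewrite deriveE// (diff_comp dx dF) /= [RHS]deriveE//.
by rewrite derive1E'.
Qed.

Lemma derivable_slice (R : realType) (U V W : normedModType R) (G : U * V -> W)
    (z : U) (x v : V) :
  differentiable G (z, x) -> derivable (fun x' => G (z, x')) x v.
Proof.
move=> dG; apply: diff_derivable.
by apply: (@differentiable_comp _ _ _ _ (fun x' => (z, x')) G).
Qed.

Lemma derivable_fst_snd (R : realType) (V W : normedModType R)
    (x : R -> V * W) (s : R) : derivable x s 1 ->
  [/\ is_derive s 1 (fst \o x) (derive1 x s).1 &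
      is_derive s 1 (snd \o x) (derive1 x s).2].
Proof.
move=> /derivable1_diffP dx.
have d1 : differentiable (fst : V * W -> V) (x s).
  by apply: linear_differentiable => p; exact: cvg_fst.
have d2 : differentiable (snd : V * W -> W) (x s).
  by apply: linear_differentiable => p; exact: cvg_snd.
have e1 : 'd (fst : V * W -> V) (x s) = fst :> (V * W -> V).
  by apply: diff_lin => p; exact: cvg_fst.
have e2 : 'd (snd : V * W -> W) (x s) = snd :> (V * W -> W).
  by apply: diff_lin => p; exact: cvg_snd.
split; split; try by apply: diff_derivable; exact: differentiable_comp.
- rewrite deriveE; last exact: differentiable_comp.
  by rewrite (diff_comp dx d1) /= e1 derive1E'.
- rewrite deriveE; last exact: differentiable_comp.
  by rewrite (diff_comp dx d2) /= e2 derive1E'.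
Qed.

Lemma is_derive_coord (R : realType) (n : nat) (x : R -> 'rV[R]_n) (s : R)
    (d : 'rV[R]_n) (i : 'I_n) :
  is_derive s 1 x d -> is_derive s 1 (fun t => x t 0 i) (d 0 i).
Proof.
move=> [dx <-]; split; first exact: (derivable_mxP _ _ _).1.
by rewrite (derive_mx dx) mxE.
Qed.

Lemma is_derive_big (R : realType) (V : normedModType R) (I : Type) (r : seq I)
    (f : I -> V -> R) (df : I -> R) (x v : V) :
  (forall i, is_derive x v (f i) (df i)) ->
  is_derive x v (fun q => \sum_(i <- r) f i q) (\sum_(i <- r) df i).
Proof.
move=> H; elim: r => [|i r IH].
  rewrite big_nil (_ : (fun _ => _) = cst 0); first exact: is_derive_cst.
  by apply/funext => q; rewrite big_nil.
rewrite big_cons (_ : (fun _ => _) = f i + fun q => \sum_(j <- r) f j q).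
  exact: is_deriveD.
by apply/funext => q; rewrite big_cons.
Qed.

(** The product rule, split into the part where the coordinates [p] vary and the
    part where they are frozen.  In the geodesic equation these are the
    acceleration and the first Christoffel term. *)
Lemma is_derive_frozen (R : realType) (V : normedModType R) (I : finType)
    (f : I -> V -> R) (p : R -> I -> R) (p' : I -> R) (x : R -> V) (s : R) :
  derivable x s 1 -> (forall i, differentiable (f i) (x s)) ->
  (forall i, is_derive s 1 (fun t => p t i) (p' i)) ->
  is_derive s 1 (fun t => \sum_i p t i * f i (x t))
    (\sum_i p' i * f i (x s) +
     'D_(derive1 x s) (fun q => \sum_i p s i * f i q) (x s)).
Proof.
move=> dx df dp.
have -> : 'D_(derive1 x s) (fun q => \sum_i p s i * f i q) (x s) =
    \sum_i p s i * 'D_(derive1 x s) (f i) (x s).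
  have H i : is_derive (x s) (derive1 x s) (fun q => p s i * f i q)
      (p s i * 'D_(derive1 x s) (f i) (x s)).
    have dfi : is_derive (x s) (derive1 x s) (f i) ('D_(derive1 x s) (f i) (x s)).
      by apply: derivableP; exact: diff_derivable.
    exact: (@is_deriveZ _ _ _ (f i) (p s i) _ _ _ dfi).
  by have [_ <-] := is_derive_big (index_enum I) H.
have H i : is_derive s 1 (fun t => p t i * f i (x t))
    (p' i * f i (x s) + p s i * 'D_(derive1 x s) (f i) (x s)).
  have := is_deriveM (dp i) (is_derive_curve dx (df i)).
  by rewrite addrC /= -![_ *: _]/(_ * _) [_ * p' i]mulrC.
by rewrite -big_split/=; exact: is_derive_big.
Qed.

(** * The angular momentum of a geodesic *)

Lemma scalar_linear_slice (R : realType) (U V : normedModType R)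
    (F : U * V -> R) (z : U) (x : V) : differentiable F (z, x) ->
  scalar_linear (fun v => 'D_v (fun x' => F (z, x')) x).
Proof.
move=> dF a u v; rewrite -!derive_slice !deriveE//.
have -> : (0 : U, a *: u + v) = a *: (0, u) + (0, v).
  by apply: injective_projections; rewrite /= ?scaler0 ?addr0.
by rewrite linearP.
Qed.

Lemma scalar_linear_derive (R : realType) (X : normedModType R) (V : lmodType R)
    (F : X -> V -> R) (x v : X) :
  (\forall x' \near x, scalar_linear (F x')) ->
  (forall u, derivable (F^~ u) x v) ->
  scalar_linear (fun u => 'D_v (F^~ u) x).
Proof.
move=> lF dF a u u'.
have -> : 'D_v (F^~ (a *: u + u')) x = 'D_v (a \*: F^~ u + F^~ u') x.
  by apply: near_eq_derive; apply: filterS lF => x' ->.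
by rewrite deriveD ?deriveZ//; exact: derivableZ.
Qed.

Lemma add_half (R : realType) (a b c : R) : a + (b + b - c) / 2 = 0 ->
  a + b = c / 2.
Proof. by move=> ?; lra. Qed.

Lemma scalar_bilinear_row (R : realType) (m : nat)
    (s : 'rV[R]_m -> 'rV[R]_m -> R) (u v : 'rV[R]_m) : scalar_bilinear s ->
  s u v = \sum_(jl : 'I_m * 'I_m)
    u 0 jl.1 * (v 0 jl.2 * s (delta_mx 0 jl.1) (delta_mx 0 jl.2)).
Proof.
move=> [s1 s2]; rewrite (scalar_linear_row (s2 v) u).
rewrite -(pair_bigA _ (fun j l =>
  u 0 j * (v 0 l * s (delta_mx 0 j) (delta_mx 0 l)))) /=.
by apply: eq_bigr => j _; rewrite (scalar_linear_row (s1 _) v) mulr_sumr.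
Qed.

Lemma derivable_mul3 (R : realType) (f g h : R -> R) (s df dg dh : R) :
  is_derive s 1 f df -> is_derive s 1 g dg -> is_derive s 1 h dh ->
  derivable (fun t => f t * (g t * h t)) s 1.
Proof.
move=> [df' _] [dg' _] [dh' _].
exact: (derivableM df' (derivableM dg' dh')).
Qed.

(** Dominates [m ^ j * C ^ i] for [i, j <= 3]: the forms in a chart have at most
    three arguments, and the vector dual to [b] is bounded by [m * C ^ 2]. *)
Definition chart_bound (R : realType) (m : nat) (C : R) : R :=
  1 + (m%:R + 1) ^+ 3 * (C + 1) ^+ 3.

Section geodesic_momentum.
Context (R : realType) (m : nat) (Y : topologicalType) (A : atlas R m Y).
Context (J : set R) (hJo : open J) (w : R -> R -> R) (k kappa : nat).
Context (eps0 : R) (S : R -> R -> Y -> R) (b : R -> R -> Y -> 'rV[R]_m -> R)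
  (h : R -> R -> Y -> 'rV[R]_m -> 'rV[R]_m -> R).
Context (hS : admissible_function A eps0 J S) (hb : admissible_form A eps0 J b)
  (hh : admissible_metric A eps0 J h).
Context (e : R) (he : 0 < e < eps0).
Context (dw : forall z, differentiable (w e) z) (w_gt0 : forall z, 0 < w e z).

Let g := pmetric w k kappa S b h e.
Let om z := w e z ^+ (2 * k).

Let e0 : 0 < e. Proof. by case/andP: he. Qed.

Lemma form_linear z y : J z -> scalar_linear (b e z y).
Proof.
have [bB [lb lin _]] := hb => Jz.
have := lin _ _ y (polar_blowup e0 (proj2 (andP he)) Jz).
have := lb _ _ (polar_blowup e0 (proj2 (andP he)) Jz) (polar_radius_gt0 z e0).
by rewrite polar_cos// polar_sin// => -> H a u v; rewrite H.
Qed.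

Lemma metric_inner_product z y : J z -> inner_product (h e z y).
Proof.
have [[hB [lh ip _]] _] := hh => Jz.
have := ip _ _ y (polar_blowup e0 (proj2 (andP he)) Jz).
have := lh _ _ (polar_blowup e0 (proj2 (andP he)) Jz) (polar_radius_gt0 z e0).
by rewrite polar_cos// polar_sin// => ->.
Qed.

Lemma chart_form_linear c z y : J z -> dom c y ->
  scalar_linear (@chart_form R m Y A b c e z (cmap c y)).
Proof.
move=> Jz cy; rewrite /chart_form (cmapK cy).
exact: (chart_scalar_linear cy (form_linear y Jz)).
Qed.

Lemma chart_tensor_inner_product c z y : J z -> dom c y ->
  inner_product (@chart_tensor R m Y A h c e z (cmap c y)).
Proof.
move=> Jz cy; rewrite /chart_tensor (cmapK cy).
exact: (chart_inner_product cy (metric_inner_product y Jz)).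
Qed.

Lemma diff_function (c : chart A) z y : J z -> dom c y ->
  differentiable (fun p : R * 'rV[R]_m => S e p.1 (cinv c p.2)) (z, cmap c y).
Proof.
have [SB [lS sS _]] := hS => Jz cy.
apply: (@lift_differentiable _ _ _ A eps0 J c _ (fun e z x => S e z (cinv c x))
  e z (cmap c y) hJo (sS c)) => //.
by move=> [[r phi] x] [/= bq _] r0; rewrite lS.
Qed.

Lemma diff_form (c : chart A) v z y : J z -> dom c y ->
  differentiable (fun p => chart_form b c e p.1 p.2 v) (z, cmap c y).
Proof.
have [bB [lb _ sb]] := hb => Jz cy.
apply: (@lift_differentiable _ _ _ A eps0 J c _
  (fun e z x => chart_form b c e z x v) e z (cmap c y) hJo (sb c v)) => //.
by move=> [[r phi] x] [/= bq _] r0; rewrite lb.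
Qed.

Lemma diff_tensor (c : chart A) u v z y : J z -> dom c y ->
  differentiable (fun p => chart_tensor h c e p.1 p.2 u v) (z, cmap c y).
Proof.
have [[hB [lh _ sh]] _] := hh => Jz cy.
apply: (@lift_differentiable _ _ _ A eps0 J c _
  (fun e z x => chart_tensor h c e z x u v) e z (cmap c y) hJo (sh c u v)) => //.
by move=> [[r phi] x] [/= bq _] r0; rewrite lh.
Qed.

Lemma om_gt0 z : 0 < om z. Proof. exact: exprn_gt0. Qed.

Let diff_om (q : R * 'rV[R]_m) :
  differentiable (fun p : R * 'rV[R]_m => om p.1) q.
Proof.
have d1 : differentiable (fst : R * 'rV[R]_m -> R) q.
  by apply: linear_differentiable => p; exact: cvg_fst.
apply: (@differentiable_comp _ _ _ _ fst om) => //.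
apply/derivable1_diffP.
have -> : om = w e ^+ (2 * k) by apply/funext => t; rewrite exprfctE.
by apply: derivableX; exact: diff_derivable.
Qed.

Lemma chart_metricE (c : chart A) (q p r : R * 'rV[R]_m) :
  chart_metric g c q p r =
  (1 - w e q.1 ^+ kappa * S e q.1 (cinv c q.2)) * (p.1 * r.1)
  + om q.1 * (p.1 * chart_form b c e q.1 q.2 r.2
              + r.1 * chart_form b c e q.1 q.2 p.2)
  + om q.1 * chart_tensor h c e q.1 q.2 p.2 r.2.
Proof. by []. Qed.

Definition momentum (c : chart A) (q p : R * 'rV[R]_m) (v : 'rV[R]_m) : R :=
  chart_metric g c q p (0, v).

Lemma momentumE (c : chart A) (q p : R * 'rV[R]_m) (v : 'rV[R]_m) :
  momentum c q p v = om q.1 * (p.1 * chart_form b c e q.1 q.2 v +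
                               chart_tensor h c e q.1 q.2 p.2 v).
Proof.
by rewrite /momentum chart_metricE /= mulr0 mulr0 mul0r addr0 add0r mulrDr.
Qed.

(** The momentum is a sum of products of a component of the velocity, [mp], and a
   function of the position, [mf]; in this form [is_derive_frozen] applies. *)
Let mf (c : chart A) v (i : unit + 'I_m) (q : R * 'rV[R]_m) : R :=
  match i with
  | inl _ => om q.1 * chart_form b c e q.1 q.2 v
  | inr i => om q.1 * chart_tensor h c e q.1 q.2 (delta_mx 0 i) v
  end.

Let mp (p : R * 'rV[R]_m) (i : unit + 'I_m) : R :=
  match i with inl _ => p.1 | inr i => p.2 0 i end.

Let momentum_sum c z y p v : J z -> dom c y ->
  momentum c (z, cmap c y) p v = \sum_i mp p i * mf c v i (z, cmap c y).
Proof.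
move=> Jz cy; rewrite momentumE big_sumType/= big_const card_unit /= addr0.
have [_ l2] := inner_product_bilinear (chart_tensor_inner_product Jz cy).
rewrite (scalar_linear_row (l2 v) p.2) mulrDr mulr_sumr; congr (_ + _).
  by ring.
by apply: eq_bigr => i _; ring.
Qed.

Context (a a' : R) (z : R -> R) (y : R -> Y).
Context (geo : geodesic A J g a a' z y) (us : unit_speed A g a a' z y).

(** The momentum of the geodesic in the direction of [Y] varies only through
    the explicit dependence of the metric on the point of [Y]: this is the
    geodesic equation paired with [(0, v)], in Lagrangian form. *)
Lemma momentum_is_derive (c : chart A) (s : R) (v : 'rV[R]_m) :
  a < s < a' -> dom c (y s) ->
  let x t := (z t, cmap c (y t)) in
  is_derive s 1 (fun t => momentum c (x t) (derive1 x t) v)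
    ('D_(0, v) (fun q => chart_metric g c q (derive1 x s) (derive1 x s)) (x s)
      / 2).
Proof.
move=> sab cys x; have [Jzs cy /(_ c cys) [dx dx' eq]] := geo sab.
have nJ : \forall q \near x s, J q.1 /\ (cmap c @` dom c) q.2.
  have n2 : \forall p \near x s, J p.1.
    have : {for x s, continuous (fst : R * 'rV[R]_m -> R)} by exact: cvg_fst.
    by apply; exact: open_nbhs_nbhs.
  have n3 : \forall p \near x s, (cmap c @` dom c) p.2.
    have : {for x s, continuous (snd : R * 'rV[R]_m -> 'rV[R]_m)}.
      exact: cvg_snd.
    apply; apply: open_nbhs_nbhs; split => //; first exact: img_open.
    by exists (y s).
  by near=> q; split; near: q.
have sumq p : \forall q \near x s, momentum c q p v = \sum_i mp p i * mf c v i q.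
  apply: filterS nJ => -[z' x'] /= [Jz' [y' cy' <-]].
  exact: momentum_sum.
have dmf i : differentiable (mf c v i) (x s).
  case: i => [u|i].
    apply: (@differentiableM _ _ (fun q : R * 'rV[R]_m => om q.1)) => //.
    exact: diff_form.
  apply: (@differentiableM _ _ (fun q : R * 'rV[R]_m => om q.1)) => //.
  exact: diff_tensor.
have dmp i : is_derive s 1 (fun t => mp (derive1 x t) i)
    (mp (derive1 (derive1 x) s) i).
  have [D1 D2] := derivable_fst_snd dx'.
  case: i => [u|i]; first exact: D1.
  exact: is_derive_coord D2.
have E1 : momentum c (x s) (derive1 (derive1 x) s) v =
    \sum_i mp (derive1 (derive1 x) s) i * mf c v i (x s).
  exact: (nbhs_singleton (sumq _)).
have E2 := near_eq_derive (derive1 x s) (sumq (derive1 x s)).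
have E3 := add_half (eq (0, v)).
have D := is_derive_eq (is_derive_frozen dx dmf dmp)
  (etrans (congr2 +%R (esym E1) (esym E2)) E3).
apply: near_eq_is_derive D.
have nx : \forall t \near s, J (x t).1 /\ (cmap c @` dom c) (x t).2.
  have cx : {for s, continuous x}.
    exact: (differentiable_continuous ((derivable1_diffP _ _).1 dx)).
  exact: (cx _ nJ).
apply: filterS nx => t [Jt [y' cy' yt]].
have := momentum_sum (derive1 x t) v Jt cy'.
by rewrite yt => E; exact: esym E.
Unshelve. all: by end_near. Qed.

(** [om *: P] is dual to the momentum with respect to [h]; [P] is the velocity
    along [Y] corrected by the mixed term [b] of the metric. *)
Definition angular_vector (P : R -> 'rV[R]_m) : Prop :=
  forall t, a < t < a' -> forall u, h e (z t) (y t) (P t) u =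
    h e (z t) (y t) (velocity A y t) u + derive1 z t * b e (z t) (y t) u.

Lemma exists_angular_vector : exists P, angular_vector P.
Proof.
suff : forall t, exists P, a < t < a' -> forall u, h e (z t) (y t) P u =
    h e (z t) (y t) (velocity A y t) u + derive1 z t * b e (z t) (y t) u.
  by move=> /choice[P HP]; exists P.
move=> t; have [tab|ntab] := pselect (a < t < a'); last by exists 0.
have [Jz _ _] := geo tab.
have ip := metric_inner_product (y t) Jz.
have [l1 _] := inner_product_bilinear ip.
have lb := form_linear (y t) Jz.
have [|P HP] := @riesz _ _ _ ip (fun u =>
  h e (z t) (y t) (velocity A y t) u + derive1 z t * b e (z t) (y t) u).
  by move=> c u v; rewrite (l1 _ c) lb; ring.
by exists P.
Qed.

Lemma geodesic_chart (c : chart A) t : a < t < a' -> dom c (y t) ->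
  let x t := (z t, cmap c (y t)) in
  [/\ derivable x t 1, derive1 x t = (derive1 z t, derive1 (cmap c \o y) t),
      is_derive t 1 z (derive1 z t) &
      velocity A y t = tvec c (cmap c (y t)) (derive1 (cmap c \o y) t)].
Proof.
move=> tab cy x; have [Jz cty /(_ c cy) [dx _ _]] := geo tab.
have [D1 D2] := derivable_fst_snd dx.
have E1 : derive1 z t = (derive1 x t).1.
  by rewrite derive1E; have [_ <-] := D1.
have E2 : derive1 (cmap c \o y) t = (derive1 x t).2.
  by rewrite derive1E; have [_ <-] := D2.
split; [exact: dx|by rewrite E1 E2; case: (derive1 x t)|by rewrite E1|].
by apply: velocity_tvec => //; have [+ _] := D2.
Qed.

Lemma angular_vector_chart P (c : chart A) t : angular_vector P ->
  a < t < a' -> dom c (y t) -> let x t := (z t, cmap c (y t)) in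
  exists V, [/\ tvec c (cmap c (y t)) V = om (z t) *: P t,
    forall v, chart_tensor h c e (z t) (cmap c (y t)) V v =
      momentum c (x t) (derive1 x t) v &
    chart_tensor h c e (z t) (cmap c (y t)) V V =
      om (z t) ^+ 2 * h e (z t) (y t) (P t) (P t)].
Proof.
move=> HP tab cy x; have [V HV] := tvec_surj (om (z t) *: P t) cy.
have [Jz _ _] := geo tab.
have [l1 l2] := inner_product_bilinear (metric_inner_product (y t) Jz).
have [_ dxE _ vE] := geodesic_chart tab cy.
exists V; split; first exact: HV.
  move=> v; rewrite /chart_tensor HV (cmapK cy) (scalar_linearZ (l2 _)) HP//.
  rewrite dxE momentumE /= /chart_tensor /chart_form (cmapK cy) -vE.
  by congr (_ * _); rewrite addrC.
rewrite /chart_tensor HV (cmapK cy) (scalar_linearZ (l1 _)) (scalar_linearZ (l2 _)).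
by rewrite expr2 mulrA.
Qed.

Section at_time.
Context (P : R -> 'rV[R]_m) (HP : angular_vector P).
Context (C s : R) (c : chart A) (sab : a < s < a').
Context (hC : tame_at S b h C e (z s) (y s) c) (C0 : 0 < C).

Let cy := tame_dom hC.
Let x t := (z t, cmap c (y t)).
Let Jz : J (z s). Proof. by have [] := geo sab. Qed.
Let xs := cmap c (y s).
Let z1 := derive1 z s.
Let X := derive1 (cmap c \o y) s.
Let o := om (z s).
Let M := chart_bound m C.
Let o0 : 0 < o. Proof. exact: om_gt0. Qed.

Let ip := chart_tensor_inner_product Jz cy.

Let near_xs : \forall x' \near xs, (cmap c @` dom c) x'.
Proof. by apply: open_nbhs_nbhs; split; [exact: img_open|exists (y s)]. Qed.

Let dS v := 'D_v (fun x => S e (z s) (cinv c x)) xs.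
Let db v q := 'D_v (fun x => chart_form b c e (z s) x q) xs.
Let dh v q r := 'D_v (fun x => chart_tensor h c e (z s) x q r) xs.
Let dz q r := 'D_1 (fun z' => chart_tensor h c e z' xs q r) (z s).

Let dS_linear : scalar_linear dS.
Proof. exact: (scalar_linear_slice (diff_function Jz cy)). Qed.

Let db_linear1 q : scalar_linear (fun v => db v q).
Proof. exact: (scalar_linear_slice (diff_form q Jz cy)). Qed.

Let db_linear2 v : scalar_linear (db v).
Proof.
apply: (@scalar_linear_derive _ _ _ (fun x q => chart_form b c e (z s) x q)).
  apply: filterS near_xs => _ [y' cy' <-]; exact: chart_form_linear.
by move=> q; exact: (derivable_slice (diff_form q Jz cy)).
Qed.

Let dh_linear q r : scalar_linear (fun v => dh v q r).
Proof. exact: (scalar_linear_slice (diff_tensor q r Jz cy)). Qed.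

Let dh_bilinear v : scalar_bilinear (dh v).
Proof.
have near_bil : \forall x' \near xs,
    scalar_bilinear (chart_tensor h c e (z s) x').
  apply: filterS near_xs => _ [y' cy' <-].
  exact/inner_product_bilinear/chart_tensor_inner_product.
split=> [q|r].
  apply: (@scalar_linear_derive _ _ _ (fun x r => chart_tensor h c e (z s) x q r)).
    by apply: filterS near_bil => x' [+ _]; apply.
  by move=> r; exact: (derivable_slice (diff_tensor q r Jz cy)).
apply: (@scalar_linear_derive _ _ _ (fun x q => chart_tensor h c e (z s) x q r)).
  by apply: filterS near_bil => x' [_]; apply.
by move=> q; exact: (derivable_slice (diff_tensor q r Jz cy)).
Qed.

Let near_zs : \forall z' \near z s, J z'.
Proof. exact: open_nbhs_nbhs. Qed.

Let derivable_dz q r : derivable (fun z' => chart_tensor h c e z' xs q r) (z s) 1.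
Proof.
apply: diff_derivable.
apply: (@differentiable_comp _ _ _ _ (fun z' => (z', xs))
  (fun p => chart_tensor h c e p.1 p.2 q r)); first exact: differentiable_pair.
exact: diff_tensor.
Qed.

Let dz_bilinear : scalar_bilinear dz.
Proof.
have near_bil : \forall z' \near z s,
    scalar_bilinear (chart_tensor h c e z' xs).
  apply: filterS near_zs => z' Jz'.
  exact/inner_product_bilinear/chart_tensor_inner_product.
split=> [q|r].
  apply: (@scalar_linear_derive R R _ (fun z' r => chart_tensor h c e z' xs q r)).
    by apply: filterS near_bil => z' [+ _]; apply.
  by move=> r; exact: derivable_dz.
apply: (@scalar_linear_derive R R _ (fun z' q => chart_tensor h c e z' xs q r)).
  by apply: filterS near_bil => z' [_]; apply.
by move=> q; exact: derivable_dz.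
Qed.

Let M_ge j i : (j <= 3)%N -> (i <= 3)%N -> m%:R ^+ j * C ^+ i <= M.
Proof.
move=> j3 i3; rewrite /M /chart_bound -[leLHS]add0r lerD//.
have C0' := ltW C0.
apply: ler_pM; rewrite ?exprn_ge0//.
  apply: (le_trans (y := (m%:R + 1) ^+ j)).
    by apply: lerXn2r; rewrite ?nnegrE ?addr_ge0// lerDl.
  by apply: ler_weXn2l => //; rewrite lerDr.
apply: (le_trans (y := (C + 1) ^+ i)).
  by apply: lerXn2r; rewrite ?nnegrE ?addr_ge0// lerDl.
by apply: ler_weXn2l => //; rewrite lerDr.
Qed.

Let M_ge0 : 0 <= M.
Proof. by apply: le_trans (@M_ge 0 0 isT isT); rewrite !expr0 mulr1. Qed.

Let dS_le v : `|dS v| <= M * `|v|.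
Proof.
apply: (le_trans (scalar_linear_le dS_linear (tame_dS hC) v)).
by rewrite ler_wpM2r//; have := @M_ge 1 1; apply.
Qed.

Let db_le u v : `|db u v| <= M * `|u| * `|v|.
Proof.
have bil : scalar_bilinear db by split => [q|q]; [exact: db_linear2|exact: db_linear1].
apply: (le_trans (scalar_bilinear_le bil (tame_db hC) u v)).
by rewrite !ler_wpM2r//; have := @M_ge 2 1; apply.
Qed.

Let dz_le u v : `|dz u v| <= M * `|u| * `|v|.
Proof.
have dzC j l : `|dz (delta_mx 0 j) (delta_mx 0 l)| <= C.
  by have := tame_dzh hC j l; rewrite derive1E.
apply: (le_trans (scalar_bilinear_le dz_bilinear dzC u v)).
by rewrite !ler_wpM2r//; have := @M_ge 2 1; apply.
Qed.

Let dh_le u v q : `|dh u v q| <= M * `|u| * `|v| * `|q|.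
Proof.
apply: (le_trans (scalar_trilinear_le dh_bilinear (fun v q => @dh_linear v q)
  (tame_dh hC) u v q)).
by rewrite !ler_wpM2r//; have := @M_ge 3 1; apply.
Qed.

Let metric_slice_derive v :
  'D_(0, v) (fun q => chart_metric g c q (derive1 x s) (derive1 x s)) (x s) =
  - w e (z s) ^+ kappa * z1 ^+ 2 * dS v + 2 * o * z1 * db v X + o * dh v X X.
Proof.
have [_ -> _ _] := geodesic_chart sab cy.
rewrite -/z1 -/X /x derive_slice.
pose f1 x := S e (z s) (cinv c x).
pose f2 x := chart_form b c e (z s) x X.
pose f3 x := chart_tensor h c e (z s) x X X.
have d1 : is_derive xs v f1 (dS v).
  by apply: derivableP; exact: (derivable_slice (diff_function Jz cy)).
have d2 : is_derive xs v f2 (db v X).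
  by apply: derivableP; exact: (derivable_slice (diff_form X Jz cy)).
have d3 : is_derive xs v f3 (dh v X X).
  by apply: derivableP; exact: (derivable_slice (diff_tensor X X Jz cy)).
have [_ DE] := is_deriveD (is_deriveD (is_deriveD
  (is_derive_cst (z1 ^+ 2) xs v)
  (is_deriveZ (- w e (z s) ^+ kappa * z1 ^+ 2) d1))
  (is_deriveZ (2 * o * z1) d2)) (is_deriveZ o d3).
have FE : (fun x' => chart_metric g c (z s, x') (z1, X) (z1, X)) =
    cst (z1 ^+ 2) + (- w e (z s) ^+ kappa * z1 ^+ 2) \*: f1
    + (2 * o * z1) \*: f2 + o \*: f3.
  apply/funext => x'; rewrite chart_metricE !fctE /= /GRing.scale /=.
  by rewrite -/o -/(f1 x') -/(f2 x') -/(f3 x'); ring.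
apply: (etrans (congr1 (fun F => 'D_v F xs) FE)); apply: (etrans DE).
by rewrite add0r.
Qed.

Let N t := om (z t) ^+ 2 * h e (z t) (y t) (P t) (P t).

Let near_s : \forall t \near s, a < t < a' /\ dom c (y t).
Proof.
have [_ cty _] := geo sab.
have n1 : \forall t \near s, dom c (y t).
  have nd : nbhs (y s) (dom c) by apply: open_nbhs_nbhs; split; [exact: dom_open|].
  exact: (cty _ nd).
have n2 : \forall t \near s, a < t < a'.
  have [as' sa'] := andP sab.
  near=> t; apply/andP; split; near: t.
    exact: lt_nbhsr.
  exact: lt_nbhsl.
by apply: filterS2 n1 n2.
Unshelve. all: by end_near. Qed.

Let tensor_curve u v : is_derive s 1
  (fun t => chart_tensor h c e (z t) (cmap c (y t)) u v) (z1 * dz u v + dh X u v).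
Proof.
have [dx dxE _ _] := geodesic_chart sab cy.
have dT := diff_tensor u v Jz cy.
apply: is_derive_eq; first exact: (is_derive_curve dx dT).
rewrite dxE deriveE//.
have -> : (derive1 z s, derive1 (cmap c \o y) s) =
    z1 *: (1, 0) + (0, X) :> R * 'rV[R]_m.
  apply: injective_projections; rewrite /= ?addr0 ?scaler0 ?add0r//.
  by rewrite -[RHS]/(z1 * 1) mulr1.
by rewrite linearP -!deriveE// derive_slice derive_slice1 derive1E.
Qed.

(** The components of [h] in the chart are continuous along the curve. *)
Let near_coercive : exists C2 : R, 0 < C2 /\ \forall t \near s,
  forall v, `|v| ^+ 2 <= C2 * chart_tensor h c e (z t) (cmap c (y t)) v v.
Proof.
exists (2 * C); split; first exact: mulr_gt0.
pose del := ((m%:R ^+ 2 + 1) * (2 * C))^-1.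
have m0 : 0 < m%:R ^+ 2 + 1 :> R by rewrite ltr_wpDl// sqr_ge0.
have del0 : 0 < del by rewrite invr_gt0 !mulr_gt0.
have del1 : m%:R ^+ 2 * del * C <= 1 / 2.
  have -> : m%:R ^+ 2 * del * C = m%:R ^+ 2 / (m%:R ^+ 2 + 1) / 2.
    by rewrite /del; field; rewrite !gt_eqF//= gt_eqF.
  by rewrite ler_pM2r// ler_pdivrMr// mul1r lerDl.
have nd : \forall t \near s, forall jk : 'I_m * 'I_m,
    `|chart_tensor h c e (z t) (cmap c (y t)) (delta_mx 0 jk.1) (delta_mx 0 jk.2)
      - chart_tensor h c e (z s) xs (delta_mx 0 jk.1) (delta_mx 0 jk.2)| <= del.
  apply: (@filter_forall _ _ (fun (jk : 'I_m * 'I_m) t =>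
    `|chart_tensor h c e (z t) (cmap c (y t)) (delta_mx 0 jk.1) (delta_mx 0 jk.2)
      - chart_tensor h c e (z s) xs (delta_mx 0 jk.1) (delta_mx 0 jk.2)| <= del)
    (nbhs s)) => -[j l] /=.
  have [dT _] := tensor_curve (delta_mx 0 j) (delta_mx 0 l).
  have := differentiable_continuous ((derivable1_diffP _ _).1 dT).
  move=> /cvgr_dist_le /(_ _ del0); apply: filterS => t.
  by rewrite distrC.
apply: filterS2 near_s nd => t [tab cyt] Ht v.
have [Jzt _ _] := geo tab.
have ipt := chart_tensor_inner_product Jzt cyt.
exact: (coercive_perturbation (inner_product_bilinear ip)
  (inner_product_bilinear ipt) C0 (tame_coercive hC)
  (fun j k => Ht (j, k)) del1).
Qed.

Let momentum_norm_is_derive V :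
  tvec c (cmap c (y s)) V = om (z s) *: P s ->
  is_derive s 1 N (2 * ((- w e (z s) ^+ kappa * z1 ^+ 2 * dS V +
    2 * o * z1 * db V X + o * dh V X X) / 2) - (z1 * dz V V + dh X V V)).
Proof.
move=> HV.
(* [W t] represents [om *: P t] in the fixed chart [c]. *)
have [W HW] : exists W : R -> 'rV[R]_m, forall t, a < t < a' -> dom c (y t) ->
    [/\ tvec c (cmap c (y t)) (W t) = om (z t) *: P t,
    forall v, chart_tensor h c e (z t) (cmap c (y t)) (W t) v =
      momentum c (x t) (derive1 x t) v &
    chart_tensor h c e (z t) (cmap c (y t)) (W t) (W t) = N t].
  suff /choice[W HW] : forall t, exists V, a < t < a' -> dom c (y t) ->
    [/\ tvec c (cmap c (y t)) V = om (z t) *: P t,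
    forall v, chart_tensor h c e (z t) (cmap c (y t)) V v =
      momentum c (x t) (derive1 x t) v &
    chart_tensor h c e (z t) (cmap c (y t)) V V = N t].
    by exists W => t tab cyt; exact: HW.
  move=> t; have [[tab cyt]|nt] := pselect (a < t < a' /\ dom c (y t)).
    by have [V' HV'] := angular_vector_chart HP tab cyt; exists V'.
  by exists 0 => tab cyt; exfalso; apply: nt.
have WV : W s = V.
  have [+ _ _] := HW s sab cy; rewrite -HV => E.
  apply/eqP; rewrite -subr_eq0; apply/eqP/(@tvec_eq0 _ _ _ A c (y s)) => //.
  have -> : W s - V = - 1 *: V + W s by rewrite scaleN1r addrC.
  by rewrite tvec_linear// E scaleN1r addNr.
have [C2 [C20 HC2]] := near_coercive.
have := @dual_norm_is_derive R m
  (fun t => chart_tensor h c e (z t) (cmap c (y t)))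
  (fun t => momentum c (x t) (derive1 x t)) W s C2
  (fun v => 'D_(0, v) (fun q => chart_metric g c q (derive1 x s) (derive1 x s))
     (x s) / 2)
  (fun u v => z1 * dz u v + dh X u v) C20.
rewrite WV metric_slice_derive => H.
have {}H := H _ (fun v => momentum_is_derive v sab cy) tensor_curve.
apply: (near_eq_is_derive (f := fun t =>
  chart_tensor h c e (z t) (cmap c (y t)) (W t) (W t))).
  by apply: filterS near_s => t [tab cyt]; have [] := HW t tab cyt.
apply: H; apply: filterS2 near_s HC2 => t [tab cyt] coer.
have [Jzt _ _] := geo tab; have [_ HWt _] := HW t tab cyt.
by split; [exact: chart_tensor_inner_product|exact: HWt|exact: coer].
Qed.

Let beta_exists : exists beta,
  [/\ forall v, chart_tensor h c e (z s) xs beta v =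
        chart_form b c e (z s) xs v,
      `|beta| <= M &
      0 <= chart_tensor h c e (z s) xs beta beta <= M].
Proof.
have lb := chart_form_linear Jz cy.
have [beta Hb] := riesz ip lb; exists beta.
have b1 : `|chart_form b c e (z s) xs beta| <= m%:R * C * `|beta|.
  exact: (scalar_linear_le lb (tame_b hC)).
have B0 : 0 <= chart_tensor h c e (z s) xs beta beta.
  exact: inner_product_ge0 ip beta.
have Ble : chart_tensor h c e (z s) xs beta beta <= m%:R * C * `|beta|.
  by rewrite Hb (le_trans (ler_norm _)).
have bM : `|beta| <= m%:R * C ^+ 2.
  have H := tame_coercive hC beta.
  have [->|bn] := eqVneq (`|beta|) 0; first by rewrite mulr_ge0// sqr_ge0.
  have bp : 0 < `|beta| by rewrite lt_neqAle eq_sym bn normr_ge0.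
  rewrite -(ler_pM2r bp) -expr2 (le_trans H)//.
  apply: (le_trans (y := C * (m%:R * C * `|beta|))).
    by rewrite ler_pM2l.
  by rewrite le_eqVlt; apply/orP; left; apply/eqP; ring.
split => //.
  by apply: (le_trans bM); have := @M_ge 1 2; apply.
rewrite B0 /= (le_trans Ble)//.
apply: (le_trans (y := m%:R * C * (m%:R * C ^+ 2))).
  by rewrite ler_wpM2l// mulr_ge0// ltW.
by have := @M_ge 2 3 isT isT; congr (_ <= _); ring.
Qed.

(** The velocity along [Y] is [o^-1 *: V - z1 *: beta] with [V] dual to the
    momentum and [beta] dual to [b].  Inserted into the variation of the
    momentum, into the equation of unit speed and into the angular speed, this
    gives the second, third and fourth conclusion. *)
Lemma reduced_at_time : let u := Num.sqrt (N s) in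
  [/\ 0 <= N s,
      exists N', is_derive s 1 N N' /\
        `|N'| <= w e (z s) ^+ kappa * z1 ^+ 2 * M ^+ 2 * u
          + `|z1| * (M * u) ^+ 2 * (3 * M + 3 * M ^+ 2)
          + o * z1 ^+ 2 * (M * u) * (2 * M ^+ 2 + M ^+ 3),
      exists rho, z1 ^+ 2 * (1 - rho) = 1 - N s / o /\
        `|rho| <= w e (z s) ^+ kappa * M + o * M,
      `|Num.sqrt (h e (z s) (y s) (velocity A y s) (velocity A y s)) - u / o|
        <= M * `|z1| &
      {for s, continuous (fun t =>
        Num.sqrt (h e (z t) (y t) (velocity A y t) (velocity A y t)))}].
Proof.
move=> u.
have [V [HV HVv HVN]] := angular_vector_chart HP sab cy.
have [dx dxE dz1 vE] := geodesic_chart sab cy.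
have [beta [Hbeta betaM /andP[B0 BM]]] := beta_exists.
have [t1 t2] := inner_product_bilinear ip.
have lb := chart_form_linear Jz cy.
have N0 : 0 <= N s by rewrite -/(N s) in HVN; rewrite -HVN; exact: inner_product_ge0.
have XE : X = o^-1 *: V - z1 *: beta.
  apply: (riesz_unique ip) => v.
  rewrite (scalar_linearB (t2 v)) !(scalar_linearZ (t2 v)) Hbeta HVv dxE.
  by rewrite momentumE /= -/o -/X -/z1 -/xs; field; rewrite gt_eqF.
have C0' := ltW C0.
have CM : C <= M by have := @M_ge 0 1 isT isT; rewrite expr0 mul1r.
have M1 : 1 <= M by have := @M_ge 0 0 isT isT; rewrite !expr0 mul1r.
have u0 : 0 <= u by exact: sqrtr_ge0.
have uN : u ^+ 2 = N s by rewrite sqr_sqrtr.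
have VM : `|V| <= M * u.
  have : `|V| ^+ 2 <= (M * u) ^+ 2.
    apply: (le_trans (tame_coercive hC V)); rewrite HVN -/(N s) exprMn uN.
    by rewrite ler_wpM2r//; nra.
  by rewrite ler_sqr ?nnegrE// mulr_ge0.
have w0 : 0 <= w e (z s) ^+ kappa by rewrite exprn_ge0// ltW.
split; first exact: N0.
- exists (2 * ((- w e (z s) ^+ kappa * z1 ^+ 2 * dS V +
    2 * o * z1 * db V X + o * dh V X X) / 2) - (z1 * dz V V + dh X V V)).
  split; first exact: momentum_norm_is_derive.
  have H := momentum_variation_le M_ge0 w0 o0 dh_bilinear
    (fun v q => @dh_linear v q) db_linear2 dS_le db_le dz_le dh_le betaM XE.
  apply: (le_trans H); apply: lerD; first apply: lerD.
  + apply: (le_trans (y := w e (z s) ^+ kappa * z1 ^+ 2 * M * (M * u))).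
      apply: ler_wpM2l => //.
      by apply: mulr_ge0 => //; apply: mulr_ge0 => //; exact: sqr_ge0.
    by rewrite le_eqVlt; apply/orP; left; apply/eqP; ring.
  + apply: ler_wpM2r.
      by apply: addr_ge0; apply: mulr_ge0 => //; exact: sqr_ge0.
    apply: ler_wpM2l => //.
    by rewrite ler_sqr ?nnegrE//; exact: mulr_ge0.
  + apply: ler_wpM2r.
      apply: addr_ge0; last exact: exprn_ge0.
      by apply: mulr_ge0 => //; exact: sqr_ge0.
    apply: ler_wpM2l => //.
    by apply: mulr_ge0; [exact: ltW|exact: sqr_ge0].
- exists (w e (z s) ^+ kappa * S e (z s) (y s) +
    o * chart_tensor h c e (z s) xs beta beta); split; last first.
    apply: (le_trans (ler_normD _ _)); apply: lerD.
      rewrite normrM (ger0_norm w0); apply: ler_wpM2l => //.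
      exact: (le_trans (tame_S hC)).
    by rewrite normrM (gtr0_norm o0) (ger0_norm B0) ler_pM2l.
  have := us sab; rewrite /= vE -/z1 -/X => E.
  have {}E : chart_metric g c (x s) (z1, X) (z1, X) = 1.
    by rewrite -[RHS]E /chart_metric /= cmapK.
  rewrite chart_metricE /= -/xs -/o in E.
  have HX : chart_tensor h c e (z s) xs X X = N s / o ^+ 2
     - 2 * z1 / o * chart_form b c e (z s) xs V
     + z1 ^+ 2 * chart_tensor h c e (z s) xs beta beta.
    have [sC _ _] := ip.
    rewrite XE (scalar_linearB (t1 _)) !(scalar_linearB (t2 _)).
    rewrite !(scalar_linearZ (t1 _)) !(scalar_linearZ (t2 _)) HVN -/(N s).
    rewrite (sC V beta) (Hbeta V).
    by field; rewrite gt_eqF.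
  have HbX : chart_form b c e (z s) xs X =
      o^-1 * chart_form b c e (z s) xs V
      - z1 * chart_tensor h c e (z s) xs beta beta.
    by rewrite XE (scalar_linearB lb) !(scalar_linearZ lb) Hbeta.
  rewrite HX HbX /xs cmapK// -/xs in E.
  rewrite -[X in _ = X - _]E.
  by field; rewrite gt_eqF.
- have -> : h e (z s) (y s) (velocity A y s) (velocity A y s) =
      chart_tensor h c e (z s) xs X X by rewrite /chart_tensor cmapK// vE.
  have Vo : Num.sqrt (chart_tensor h c e (z s) xs (o^-1 *: V) (o^-1 *: V)) =
      u / o.
    rewrite (inner_product_normZ ip) HVN -/(N s) -/u ger0_norm ?invr_ge0 ?ltW//.
    by rewrite mulrC.
  rewrite -Vo XE; apply: (le_trans (inner_product_norm_dist ip _ _)).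
  rewrite (inner_product_normZ ip) mulrC ler_wpM2r//.
  have -> : M = Num.sqrt (M ^+ 2) by rewrite sqrtr_sqr ger0_norm.
  by rewrite ler_sqrt ?sqr_ge0//; nra.
- have [_ _ /(_ c cy) [_ dx' _]] := geo sab.
  have [_ D2] := derivable_fst_snd dx'.
  (* In a chart the squared speed is a polynomial in differentiable components. *)
  pose T := fun t => \sum_(jk : 'I_m * 'I_m)
    (derive1 x t).2 0 jk.1 * ((derive1 x t).2 0 jk.2 *
      chart_tensor h c e (z t) (cmap c (y t)) (delta_mx 0 jk.1) (delta_mx 0 jk.2)).
  have cT : {for s, continuous T}.
    apply: differentiable_continuous; apply/derivable1_diffP.
    have D (jk : 'I_m * 'I_m) := derivableP (derivable_mul3
      (is_derive_coord jk.1 D2) (is_derive_coord jk.2 D2)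
      (tensor_curve (delta_mx 0 jk.1) (delta_mx 0 jk.2))).
    by have [] := is_derive_big (index_enum ('I_m * 'I_m)%type) D.
  have nT : \forall t \near s, T t =
      h e (z t) (y t) (velocity A y t) (velocity A y t).
    apply: filterS near_s => t [tab cyt]; have [Jzt _ _] := geo tab.
    have [_ dxt _ vt] := geodesic_chart tab cyt.
    have bil := inner_product_bilinear (chart_tensor_inner_product Jzt cyt).
    rewrite /T dxt /= vt.
    have -> : h e (z t) (y t) (tvec c (cmap c (y t)) (derive1 (cmap c \o y) t))
      (tvec c (cmap c (y t)) (derive1 (cmap c \o y) t)) =
      chart_tensor h c e (z t) (cmap c (y t)) (derive1 (cmap c \o y) t)
        (derive1 (cmap c \o y) t) by rewrite /chart_tensor (cmapK cyt).
    by rewrite (scalar_bilinear_row _ _ bil).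
  have cT2 : {for s, continuous (Num.sqrt \o T)}.
    by apply: continuous_comp => //; exact: sqrt_continuous.
  have Es := nbhs_singleton nT.
  suff : (fun t => Num.sqrt (h e (z t) (y t) (velocity A y t) (velocity A y t)))
    t @[t --> s] --> Num.sqrt (T s) by rewrite Es.
  apply: cvg_trans cT2; apply: near_eq_cvg.
  by apply: filterS nT => t /= ->.
Qed.

End at_time.

End geodesic_momentum.

(** * The scaling function *)

Section scaling_function.
Context (R : realType) (w : R -> R -> R) (hw : scaling_function w).

Lemma scaling_differentiable2 (e z : R) : 0 < e ->
  differentiable (fun p : R * R => w p.1 p.2) (e, z).
Proof.
move=> e0; have [_ [sw _] _ _ _] := hw.
have [|U [F [oU Uq CF E]]] := sw (e, z).
  by split => /=; [exact: ltW|case=> /eqP; rewrite gt_eqF].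
have fd : @finite_dimensional R (R * R)%type.
  by apply: finite_dimensional_prod; exact: finite_dimensional_real.
apply: near_eq_differentiable (Cn1_differentiable fd oU Uq (CF 1)).
have n1 : \forall p \near (e, z), U p by exact: open_nbhs_nbhs.
have n2 : \forall p \near (e, z), 0 < p.1.
  have cs : {for (e, z), continuous (fst : R * R -> R)} by exact: cvg_fst.
  have np : nbhs e [set x | 0 < x] by exact: lt_nbhsr.
  exact: (cs _ np).
apply: filterS2 n1 n2 => p Up p0; apply: E => //; split; first exact: ltW.
by case: p p0 {Up} => p1 p2 /= + [p10 _]; rewrite p10 ltxx.
Qed.

Lemma scaling_differentiable (e z : R) : 0 < e -> differentiable (w e) z.
Proof.
move=> e0; apply: (@differentiable_comp _ _ _ _ (fun t : R => (e, t))
  (fun p : R * R => w p.1 p.2)); last exact: scaling_differentiable2.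
exact: differentiable_pair.
Qed.

Lemma scaling_gt0 (e z : R) : 0 < e -> 0 < w e z.
Proof.
move=> e0; have [_ [_ pw] _ _ _] := hw; apply: pw; first exact: ltW.
by case=> /eqP; rewrite gt_eqF.
Qed.

Lemma scalingE (e z : R) : 0 < e -> w e z = e * w 1 (z / e).
Proof.
move=> e0; have [_ _ _ _ [_ _ hom]] := hw.
rewrite -hom ?ler01// mulr1; congr (w _ _).
by field; rewrite gt_eqF.
Qed.

Lemma scaling_continuous (e : R) : 0 < e -> continuous (w e).
Proof.
by move=> e0 z; apply: differentiable_continuous; exact: scaling_differentiable.
Qed.

Let f := w 1.

Lemma profile0 : f 0 = 1.
Proof. by have [_ _ _ _ [H _ _]] := hw; rewrite /f H. Qed.

Let derive_sg (z : R) : Num.sg (derive1 f z) = Num.sg z.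
Proof.
have [_ _ _ H _] := hw; apply: H => //.
by case=> /eqP; rewrite oner_eq0.
Qed.

Let df (z : R) : is_derive z 1 f (derive1 f z).
Proof.
rewrite derive1E; apply: derivableP; apply: diff_derivable.
exact: scaling_differentiable.
Qed.

Lemma profile_le (x y : R) : 0 <= x -> x <= y -> f x <= f y.
Proof.
move=> x0 xy; have [||c cxy E] := @MVT_segment R f (derive1 f) x y xy.
- by move=> ? _; exact: df.
- by apply: continuous_subspaceT; exact: scaling_continuous.
- rewrite -subr_ge0 E mulr_ge0 ?subr_ge0//.
  rewrite -sgr_ge0 derive_sg sgr_ge0.
  by move: cxy; rewrite in_itv/= => /andP[/(le_trans x0)].
Qed.

Lemma profile_ge1 (x : R) : 1 <= f x.
Proof.
rewrite -profile0; have [x0|x0] := leP 0 x; first exact: profile_le.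
have [||c cxy E] := @MVT_segment R f (derive1 f) x 0 (ltW x0).
- by move=> ? _; exact: df.
- by apply: continuous_subspaceT; exact: scaling_continuous.
- rewrite -subr_le0 E sub0r mulr_le0_ge0 ?oppr_ge0 ?(ltW x0)//.
  rewrite -sgr_le0 derive_sg sgr_le0.
  by move: cxy; rewrite in_itv/= => /andP[].
Qed.

(** By homogeneity [f Z / Z] is the value of [w] at [(1/Z, 1)], which tends to
    [w 0 1 = 1]. *)
Lemma profile_linear : exists c0 c1 : R, [/\ 0 < c0, 0 < c1 &
  forall Z, 0 <= Z -> c0 * (1 + Z) <= f Z <= c1 * (1 + Z)].
Proof.
have [cw _ _ _ [_ w0 hom]] := hw.
have [d [d0 Hd]] : exists d : R, 0 < d /\ forall t, 0 < t < d ->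
    1 / 2 <= w t 1 <= 2.
  have /subspace_continuousP/(_ (0, 1)) := cw; rewrite /= lexx => /(_ isT).
  move=> /cvgr_dist_le /(_ (1 / 2)).
  have h0 : 0 < 1 / 2 :> R by lra.
  move=> /(_ h0) [[A B] [/= nA nB] AB].
  have /nbhs_normP[d /= d0 Ad] := nA; exists d; split => // t /andP[t0 td].
  have At : A t by apply: Ad => /=; rewrite sub0r normrN gtr0_norm.
  have B1 : B 1 by exact: nbhs_singleton.
  have := AB (t, 1) (conj At B1) (ltW t0); rewrite /from_subspace /= w0 normr1 ler_norml.
  by move=> /andP[H1 H2]; apply/andP; split; lra.
pose Z0 := d^-1 + 1.
have Z00 : 1 <= Z0 by rewrite lerDr invr_ge0 ltW.
have big Z : Z0 <= Z -> Z / 2 <= f Z <= 2 * Z.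
  move=> ZZ0; have Zp : 0 < Z by apply: lt_le_trans ZZ0; lra.
  have -> : f Z = Z * w Z^-1 1.
    by rewrite -hom ?invr_ge0 ?ltW// mulr1 divff// gt_eqF.
  have := Hd Z^-1; rewrite invr_gt0 Zp /=.
  have -> : Z^-1 < d.
    rewrite -[ltRHS]invrK ltf_pV2 ?posrE ?invr_gt0//.
    by apply: lt_le_trans ZZ0; rewrite /Z0 ltrDl.
  move=> /(_ isT) /andP[H1 H2]; rewrite mulrC [2 * _]mulrC.
  apply/andP; split; last by rewrite ler_pM2l.
  by rewrite mulrC ler_pM2l// -div1r.
have c00 : 0 < (4 * (1 + Z0))^-1 by rewrite invr_gt0; lra.
exists (4 * (1 + Z0))^-1, (2 * Z0); split => //; first by lra.
move=> Z Zp; have [ZZ0|ZZ0] := leP Z0 Z.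
  have /andP[H1 H2] := big Z ZZ0; apply/andP; split; last by nra.
  apply: le_trans H1; rewrite mulrC ler_pdivrMr; last by lra.
  by nra.
have /andP[_ H2] := big Z0 (lexx _).
have f1 := profile_ge1 Z; have f2 := profile_le Zp (ltW ZZ0).
apply/andP; split; last by nra.
apply: le_trans f1; rewrite mulrC ler_pdivrMr; last by lra.
by lra.
Qed.

End scaling_function.

(** * Reduction to the height and the angular momentum *)

(** What the proof uses of a rising geodesic: its height [z], the squared
    angular momentum [N] and the angular speed [l]. *)
Record reduced_motion (R : realType) (w : R -> R -> R) (k : nat)
    (C r1 e phi z0 T : R) (z N l : R -> R) : Prop := ReducedMotion {
  rm_T : 0 < T;
  rm_start : z 0 = 0;
  rm_end : z T = z0;
  rm_lt : forall t, 0 <= t < T -> z t < z0;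
  rm_is_derive : forall t, 0 <= t <= T -> is_derive t 1 z (derive1 z t);
  rm_continuous : forall t, 0 <= t <= T -> {for t, continuous (derive1 z)};
  rm_upwards : 0 <= derive1 z 0;
  rm_momentum0 : N 0 = e ^+ (2 * k) * cos phi ^+ 2;
  rm_ge0 : forall t, 0 <= t <= T -> 0 <= z t < r1 -> 0 <= N t;
  rm_momentum : forall t, 0 <= t <= T -> 0 <= z t < r1 -> exists N',
    is_derive t 1 N N' /\
    `|N'| <= C * `|derive1 z t| * Num.sqrt (N t) * w e (z t) ^+ k;
  rm_energy : forall t, 0 <= t <= T -> 0 <= z t < r1 -> exists rho,
    [/\ derive1 z t ^+ 2 * (1 - rho) = 1 - N t / w e (z t) ^+ (2 * k),
        `|rho| <= C * w e (z t) ^+ k & `|rho| <= 1 / 2];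
  rm_speed : forall t, 0 <= t <= T -> 0 <= z t < r1 ->
    `|l t - Num.sqrt (N t) / w e (z t) ^+ (2 * k)| <= C * `|derive1 z t|;
  rm_speed_continuous : forall t, 0 <= t <= T -> 0 <= z t < r1 ->
    {for t, continuous l}
}.

(** While [rho] is small, unit speed bounds both [N] and the slope [z1]. *)
Lemma energy_bounds (R : realType) (M wk o z1 rho N : R) :
  0 < wk -> wk <= 1 -> o = wk ^+ 2 -> 0 <= N -> 4 * M * wk <= 1 -> 0 <= M ->
  z1 ^+ 2 * (1 - rho) = 1 - N / o -> `|rho| <= 2 * M * wk ->
  [/\ `|rho| <= 1 / 2, Num.sqrt N <= wk & `|z1| <= 2].
Proof.
move=> wk0 wk1 oE N0 MW M0 en rM.
have r2 : `|rho| <= 1 / 2 by apply: (le_trans rM); lra.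
have [r3 r4] : - (1 / 2) <= rho /\ rho <= 1 / 2.
  by move: r2; rewrite ler_norml => /andP[].
have o0 : 0 < o by rewrite oE exprn_gt0.
have z20 := sqr_ge0 z1.
have No : N / o <= 1.
  have : 0 <= z1 ^+ 2 * (1 - rho) by rewrite mulr_ge0//; lra.
  by rewrite en; lra.
split => //.
- rewrite -(ger0_norm (ltW wk0)) -sqrtr_sqr ler_sqrt ?sqr_ge0// -oE.
  by move: No; rewrite ler_pdivrMr// mul1r.
- have Np : 0 <= N / o by rewrite divr_ge0// ltW.
  have : z1 ^+ 2 <= 2 ^+ 2 by nra.
  by rewrite -[z1 ^+ 2]real_normK ?num_real// ler_sqr ?nnegrE.
Qed.

Lemma momentum_bound (R : realType) (M wk wkap o z1 u N' : R) :
  0 < wk -> wk <= 1 -> 0 <= wkap -> wkap <= wk -> o = wk ^+ 2 -> 0 <= M ->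
  0 <= u -> u <= wk -> `|z1| <= 2 ->
  `|N'| <= wkap * z1 ^+ 2 * M ^+ 2 * u
          + `|z1| * (M * u) ^+ 2 * (3 * M + 3 * M ^+ 2)
          + o * z1 ^+ 2 * (M * u) * (2 * M ^+ 2 + M ^+ 3) ->
  `|N'| <= (2 * M ^+ 2 + M ^+ 2 * (3 * M + 3 * M ^+ 2) +
     2 * M * (2 * M ^+ 2 + M ^+ 3)) * `|z1| * u * wk.
Proof.
move=> wk0 wk1 wkap0 wkapk oE M0 u0 uw z2 /le_trans; apply.
have z0 := normr_ge0 z1.
rewrite -(real_normK (num_real z1)); set a := `|z1| in z0 z2 *.
have aa : a ^+ 2 <= 2 * a by nra.
have a20 : 0 <= a ^+ 2 by exact: sqr_ge0.
have ow : o <= wk by rewrite oE; nra.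
have o0 : 0 <= o by rewrite oE; nra.
have P1 : 0 <= M ^+ 2 * u by rewrite mulr_ge0// sqr_ge0.
have P2 : 0 <= 2 * M ^+ 2 + M ^+ 3.
  by rewrite addr_ge0 ?exprn_ge0// mulr_ge0// sqr_ge0.
have P3 : 0 <= 3 * M + 3 * M ^+ 2.
  by rewrite addr_ge0// mulr_ge0// sqr_ge0.
have t1 : wkap * a ^+ 2 * (M ^+ 2 * u) <= wk * (2 * a) * (M ^+ 2 * u).
  by apply: ler_wpM2r => //; apply: ler_pM.
have t2 : a * (M ^+ 2 * (u * u)) * (3 * M + 3 * M ^+ 2) <=
    a * (M ^+ 2 * (u * wk)) * (3 * M + 3 * M ^+ 2).
  apply: ler_wpM2r => //; apply: ler_wpM2l => //.
  apply: ler_wpM2l; first exact: sqr_ge0.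
  exact: ler_wpM2l.
have t3 : o * a ^+ 2 * (M * u) * (2 * M ^+ 2 + M ^+ 3) <=
    wk * (2 * a) * (M * u) * (2 * M ^+ 2 + M ^+ 3).
  apply: ler_wpM2r => //; apply: ler_wpM2r; first exact: mulr_ge0.
  exact: ler_pM.
have -> : wkap * a ^+ 2 * M ^+ 2 * u + a * (M * u) ^+ 2 * (3 * M + 3 * M ^+ 2) +
    o * a ^+ 2 * (M * u) * (2 * M ^+ 2 + M ^+ 3) =
  wkap * a ^+ 2 * (M ^+ 2 * u) + a * (M ^+ 2 * (u * u)) * (3 * M + 3 * M ^+ 2) +
    o * a ^+ 2 * (M * u) * (2 * M ^+ 2 + M ^+ 3) by ring.
apply: (le_trans (lerD (lerD t1 t2) t3)).
by rewrite le_eqVlt; apply/orP; left; apply/eqP; ring.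
Qed.

(** [(0, P)] is the orthogonal projection of the velocity to the level of [z],
    and its length is the cosine of the angle of impact. *)
Lemma angle_momentum (R : realType) (m : nat) (om : R)
    (hy : 'rV[R]_m -> 'rV[R]_m -> R) (by_ : 'rV[R]_m -> R) (c phi : R)
    (g : R * 'rV[R]_m -> R * 'rV[R]_m -> R) (v : R * 'rV[R]_m)
    (P : 'rV[R]_m) :
  inner_product hy -> 0 < om ->
  (forall p q : R * 'rV[R]_m, g p q = c * (p.1 * q.1) +
     om * (p.1 * by_ q.2 + q.1 * by_ p.2) + om * hy p.2 q.2) ->
  g v v = 1 -> angle_with_level g v phi ->
  (forall u, hy P u = hy v.2 u + v.1 * by_ u) ->
  om ^+ 2 * hy P P = om * cos phi ^+ 2.
Proof.
move=> ip om0 gE gv [/andP[phi0 phi1] [p [orth len]]] HP.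
have [s1 s2] := inner_product_bilinear ip.
have Pp : P = p.
  apply: (riesz_unique ip) => u; rewrite HP.
  have := orth u; rewrite gE /= subr0 mulr0 mulr0 add0r mul0r addr0 => H.
  have {}H : om * (v.1 * by_ u + hy (v.2 - p) u) = 0.
    by rewrite mulrDr.
  move/eqP: H; rewrite mulf_eq0 gt_eqF//= (scalar_linearB (s2 u)) => /eqP H.
  by lra.
have gp : g (0, p) (0, p) = om * hy p p.
  by rewrite gE /= !mul0r mulr0 add0r addr0 mulr0 add0r.
move: len; rewrite gv sqrtr1 mulr1 gp => len.
have H : 0 <= om * hy p p by rewrite mulr_ge0 ?(inner_product_ge0 ip)// ltW.
rewrite Pp -len sqr_sqrtr// expr2.
by rewrite mulrA.
Qed.

Section reduction.
Context (R : realType) (m : nat) (Y : topologicalType) (A : atlas R m Y)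
  (HY : closed_manifold A) (k kappa : nat) (hk : (2 <= k)%N)
  (hkappa : (k <= kappa)%N) (w : R -> R -> R) (hw : scaling_function w)
  (J : set R) (hJo : open J) (hJ0 : J 0) (eps0 : R) (heps0 : 0 < eps0)
  (S : R -> R -> Y -> R) (hS : admissible_function A eps0 J S)
  (b : R -> R -> Y -> 'rV[R]_m -> R) (hb : admissible_form A eps0 J b)
  (h : R -> R -> Y -> 'rV[R]_m -> 'rV[R]_m -> R)
  (hh : admissible_metric A eps0 J h).

Lemma geodesic_height_derivable (e : R) (a a' : R) (z : R -> R) (y : R -> Y) t :
  geodesic A J (pmetric w k kappa S b h e) a a' z y -> a < t < a' ->
  derivable (derive1 z) t 1.
Proof.
move=> geo tab; have [Jz cty geoc] := geo _ tab.
pose c := chart_at A (y t).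
have cy : dom c (y t) by exact: dom_chart_at.
have [dx dx' _] := geoc c cy.
have [[D1 _] _] := derivable_fst_snd dx'.
apply: near_eq_derivable D1.
have n1 : \forall s \near t, dom c (y s).
  have nd : nbhs (y t) (dom c) by apply: open_nbhs_nbhs; split; [exact: dom_open|].
  exact: (cty _ nd).
have n2 : \forall s \near t, a < s < a'.
  have [at' ta'] := andP tab.
  near=> s; apply/andP; split; near: s; [exact: lt_nbhsr|exact: lt_nbhsl].
apply: filterS2 n1 n2 => s cys sab.
have [_ xE _ _] := geodesic_chart geo sab cys.
exact: (congr1 fst xE).
Unshelve. all: by end_near. Qed.

Theorem geodesic_reduction : exists C r1 : R, [/\ 0 < C, 0 < r1, r1 <= eps0 &
  forall e phi z0 T z y, 0 < e < r1 -> 0 < z0 < r1 ->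
    rising_geodesic A J (pmetric w k kappa S b h e) phi z0 T z y ->
    exists N, reduced_motion w k C r1 e phi z0 T z N (fun t =>
      Num.sqrt (h e (z t) (y t) (velocity A y t) (velocity A y t)))].
Proof.
have [C0 [r0 [C00 r00 r0e r0J tame]]] := uniformly_tame HY hJo hJ0 heps0 hS hb hh.
have [c0 [c1 [c00 c10 prof]]] := profile_linear hw.
pose M := chart_bound m C0.
have M0 : 0 < M.
  by rewrite /M /chart_bound ltr_wpDr// mulr_ge0// exprn_ge0// addr_ge0// ltW.
have M0' := ltW M0.
pose K := 2 * M ^+ 2 + M ^+ 2 * (3 * M + 3 * M ^+ 2) +
     2 * M * (2 * M ^+ 2 + M ^+ 3).
have K0 : 0 <= K.
  have M2 : 0 <= M ^+ 2 by exact: sqr_ge0.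
  have M3 : 0 <= M ^+ 3 by exact: exprn_ge0.
  apply: addr_ge0; first apply: addr_ge0.
  - exact: mulr_ge0.
  - by apply: mulr_ge0 => //; apply: addr_ge0; exact: mulr_ge0.
  - apply: mulr_ge0; first exact: mulr_ge0.
    by apply: addr_ge0 => //; exact: mulr_ge0.
(* [r1] is so small that [w ^ k <= 1] and [4 * M * w ^ k <= 1] for [e, z < r1]:
   there [w <= 2 * c1 * r1]. *)
pose r1 := Num.min r0 (Num.min (2 * c1)^-1 (8 * M * c1)^-1).
have r10 : 0 < r1.
  by rewrite !lt_min r00 !invr_gt0 !mulr_gt0.
have r1r0 : r1 <= r0 by rewrite /r1 ge_min lexx.
have r1c : 2 * c1 * r1 <= 1.
  rewrite mulrC -ler_pdivlMr ?mulr_gt0// div1r /r1 !ge_min lexx.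
  by rewrite orbT.
have r1M : 8 * M * c1 * r1 <= 1.
  rewrite mulrC -ler_pdivlMr ?mulr_gt0// div1r /r1 !ge_min lexx.
  by rewrite !orbT.
exists (K + 2 * M), r1; split => //.
- by rewrite ltr_wpDl// mulr_gt0.
- by rewrite (le_trans r1r0)// ltW.
move=> e phi z0 T z y /andP[e0 er1] /andP[z00 z0r] [T0 [[a [a' [a0 Ta geo us]]]
  [zs zu ang zT zlt]]].
have ee : 0 < e < eps0 by rewrite e0 (lt_le_trans er1)// (le_trans r1r0)// ltW.
have dw := fun t => scaling_differentiable hw t e0.
have w0 := fun t => scaling_gt0 hw t e0.
have [P HP] := exists_angular_vector hb hh ee geo.
have tab t : 0 <= t <= T -> a < t < a'.
  by move=> /andP[t0 tT]; rewrite (lt_le_trans a0)// (le_lt_trans tT).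
have wsmall t : 0 <= z t < r1 -> [/\ 0 < w e (z t) ^+ k, w e (z t) ^+ k <= 1,
    4 * M * w e (z t) ^+ k <= 1 & w e (z t) ^+ kappa <= w e (z t) ^+ k].
  move=> /andP[zt0 ztr].
  have wle : w e (z t) <= c1 * (e + z t).
    rewrite (scalingE hw)//.
    have /andP[_ H] := prof (z t / e) (divr_ge0 zt0 (ltW e0)).
    apply: (le_trans (y := e * (c1 * (1 + z t / e)))); first by rewrite ler_pM2l.
    by rewrite le_eqVlt; apply/orP; left; apply/eqP; field; rewrite gt_eqF.
  have wle2 : w e (z t) <= 2 * c1 * r1.
    apply: (le_trans wle); rewrite -mulrA mulrCA ler_pM2l//; lra.
  have w1 : w e (z t) <= 1 by apply: le_trans r1c.
  have wk : w e (z t) ^+ k <= w e (z t).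
    rewrite -[leRHS]expr1; apply: ler_wiXn2l => //; first exact: ltW.
    exact: leq_trans hk.
  split; first exact: exprn_gt0.
  - exact: le_trans w1.
  - apply: (le_trans (y := 4 * M * (2 * c1 * r1))).
      by rewrite ler_wpM2l ?mulr_ge0// (le_trans wk).
    by apply: le_trans r1M; rewrite le_eqVlt; apply/orP; left; apply/eqP; ring.
  - by apply: ler_wiXn2l => //; exact: ltW.
pose N t := (w e (z t) ^+ (2 * k)) ^+ 2 * h e (z t) (y t) (P t) (P t).
have all t : 0 <= t <= T -> 0 <= z t < r1 ->
    [/\ 0 <= N t, exists N', is_derive t 1 N N' /\
      `|N'| <= (K + 2 * M) * `|derive1 z t| * Num.sqrt (N t) * w e (z t) ^+ k,
    exists rho,
    [/\ derive1 z t ^+ 2 * (1 - rho) = 1 - N t / w e (z t) ^+ (2 * k),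
        `|rho| <= (K + 2 * M) * w e (z t) ^+ k & `|rho| <= 1 / 2],
    `|Num.sqrt (h e (z t) (y t) (velocity A y t) (velocity A y t))
      - Num.sqrt (N t) / w e (z t) ^+ (2 * k)| <= (K + 2 * M) * `|derive1 z t| &
    {for t, continuous (fun t =>
      Num.sqrt (h e (z t) (y t) (velocity A y t) (velocity A y t)))}].
  move=> tT ztr; have [wk0 wk1 wkM wkap] := wsmall t ztr.
  have er0 : 0 < e < r0 by rewrite e0 (lt_le_trans er1).
  have zr0 : `|z t| < r0.
    by move: ztr => /andP[zt0 ztr]; rewrite ger0_norm// (lt_le_trans ztr).
  have [c hC] := tame e (z t) (y t) er0 zr0.
  have := reduced_at_time hJo hS hb hh ee dw w0 geo us HP (tab t tT) hC C00.
  cbv zeta beta; rewrite -/M -/(N t).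
  move=> [N0 [N' [dN N'le]] [rho [en rhole]] sp ct].
  have oE : w e (z t) ^+ (2 * k) = (w e (z t) ^+ k) ^+ 2.
    by rewrite -exprM mulnC.
  have rho2 : `|rho| <= 2 * M * w e (z t) ^+ k.
    apply: (le_trans rhole); rewrite oE.
    have -> : 2 * M * w e (z t) ^+ k = w e (z t) ^+ k * M + w e (z t) ^+ k * M.
      by ring.
    apply: lerD; apply: ler_wpM2r => //.
    by rewrite expr2 -[leRHS]mulr1 ler_pM2l.
  have [rhoh uw zz2] := energy_bounds wk0 wk1 oE N0 wkM M0' en rho2.
  split => //.
  - exists N'; split => //.
    have := momentum_bound wk0 wk1 (exprn_ge0 kappa (ltW (w0 (z t)))) wkap oE M0'
      (sqrtr_ge0 _) uw zz2 N'le.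
    move=> /le_trans; apply; rewrite -/K -!mulrA; apply: ler_wpM2r.
      by rewrite !mulr_ge0// ?sqrtr_ge0// ltW.
    by rewrite lerDl mulr_ge0.
  - exists rho; split => //; apply: (le_trans rho2); apply: ler_wpM2r.
      exact: ltW.
    by rewrite lerDr.
  - apply: (le_trans sp); apply: ler_wpM2r => //.
    by rewrite -[leLHS]add0r lerD//; lra.
exists N; split => //.
- move=> t tT; have cy := dom_chart_at A (y t).
  by have [_ _ dz _] := geodesic_chart geo (tab t tT) cy.
- move=> t tT; apply: differentiable_continuous; apply/derivable1_diffP.
  exact: geodesic_height_derivable geo (tab t tT).
- have t0 : 0 <= (0 : R) <= T by rewrite lexx ltW.
  have [Jz0 _ _] := geo _ (tab 0 t0).
  have ip0 := metric_inner_product hh ee (y 0) Jz0.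
  have om0 : 0 < w e (z 0) ^+ (2 * k) by rewrite exprn_gt0.
  have := @angle_momentum R m (w e (z 0) ^+ (2 * k)) (h e (z 0) (y 0))
    (b e (z 0) (y 0)) (1 - w e (z 0) ^+ kappa * S e (z 0) (y 0)) phi
    (pmetric w k kappa S b h e (z 0) (y 0)) (derive1 z 0, velocity A y 0) (P 0)
    ip0 om0 (fun p q => erefl) (us _ (tab 0 t0)).
  rewrite {1}zs => /(_ ang (HP 0 (tab 0 t0))) H.
  rewrite /N H zs; have [_ _ _ _ [w00 _ _]] := hw.
  by rewrite w00// ltW.
- by move=> t tT ztr; have [] := all t tT ztr.
- by move=> t tT ztr; have [] := all t tT ztr.
- by move=> t tT ztr; have [] := all t tT ztr.
- by move=> t tT ztr; have [] := all t tT ztr.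
- by move=> t tT ztr; have [] := all t tT ztr.
Qed.

End reduction.

(** * Comparison of functions through their derivatives *)

Lemma le_increment (R : realType) (F E F' E' : R -> R) (a b : R) : a <= b ->
  (forall t : R, a < t < b -> is_derive t 1 F (F' t)) ->
  (forall t : R, a < t < b -> is_derive t 1 E (E' t)) ->
  {within `[a, b], continuous F} -> {within `[a, b], continuous E} ->
  (forall t : R, a < t < b -> F' t <= E' t) -> F b - F a <= E b - E a.
Proof.
move=> ab dF dE cF cE le'.
have dEF t : t \in `]a, b[%R -> is_derive t 1 (E - F) (E' t - F' t).
  by rewrite in_itv/= => tab; exact: is_deriveB (dE t tab) (dF t tab).
have cEF : {within `[a, b], continuous (E - F)}.
  by move=> x; exact: cvgB (cE x) (cF x).
rewrite -subr_ge0.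
have -> : E b - E a - (F b - F a) = (E - F) b - (E - F) a by rewrite !fctE; ring.
have : forall x, x \in `]a, b[ -> derivable (E - F) x 1 by move=> x /dEF[].
move=> /ger0_derive1_ndecr H; rewrite subr_ge0; apply: H => //.
by move=> x xab; have [_ +] := dEF x xab; rewrite derive1E => ->;
  rewrite subr_ge0; apply: le'; move: xab; rewrite in_itv.
Qed.

Lemma within_continuous_of (R : realType) (F : R -> R) (a b : R) :
  (forall t : R, a <= t <= b -> {for t, continuous F}) ->
  {within `[a, b], continuous F}.
Proof.
move=> cF; apply: continuous_in_subspaceT => t.
by rewrite inE /= in_itv/= => tab; exact: cF.
Qed.

Lemma is_derive_continuous (R : realType) (F : R -> R) (t d : R) :
  is_derive t 1 F d -> {for t, continuous F}.
Proof. by move=> [dF _]; apply: differentiable_continuous; exact/derivable1_diffP. Qed.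

Lemma antiderivative (R : realType) (g : R -> R) : continuous g ->
  exists G : R -> R, G 0 = 0 /\ forall x : R, 0 <= x -> is_derive x 1 G (g x).
Proof.
move=> cg; pose I (x : R) := \int[lebesgue_measure]_(t in `[-1, x]) g t.
exists (fun x => I x - I 0); split; first by rewrite subrr.
move=> x x0.
have x1 : x < x + 1 by rewrite ltrDl.
have xm : -1 < x by lra.
have int : lebesgue_measure.-integrable `[-1, x + 1] (EFin \o g).
  apply: continuous_compact_integrable; first exact: segment_compact.
  exact: continuous_subspaceT.
have [dI IE] := continuous_FTC1_closed x1 int xm (cg x).
have D : is_derive x 1 I (g x).
  by split; [exact: dI|rewrite -derive1E; exact: IE].
by have := is_deriveB D (is_derive_cst (I 0) x 1); rewrite subr0.
Qed.

Lemma integral_compare (R : realType) (l F E F' E' : R -> R) (T : R) : 0 < T ->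
  (forall t : R, 0 <= t <= T -> {for t, continuous l}) ->
  (forall t : R, 0 <= t <= T -> is_derive t 1 F (F' t)) ->
  (forall t : R, 0 <= t <= T -> is_derive t 1 E (E' t)) ->
  (forall t : R, 0 <= t <= T -> `|l t - F' t| <= E' t) ->
  `|\int[lebesgue_measure]_(t in `[0, T]) l t - (F T - F 0)| <= E T - E 0.
Proof.
move=> T0 cl dF dE le'.
have wcl := within_continuous_of cl.
have int : lebesgue_measure.-integrable `[0, T] (EFin \o l).
  by apply: continuous_compact_integrable => //; exact: segment_compact.
pose I (x : R) := \int[lebesgue_measure]_(t in `[0, x]) l t.
have I0 : I 0 = 0 by rewrite /I set_itv1 Rintegral_set1.
have cI : {within `[0, T], continuous I}.
  exact: (parameterized_integral_continuous (ltW T0) int).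
have oc (t : R) : 0 < t < T -> 0 <= t <= T by move=> /andP[/ltW-> /ltW->].
have dI (t : R) : 0 < t < T -> is_derive t 1 I (l t).
  move=> tT; have /andP[t0 tT'] := tT.
  have [d1 d2] := continuous_FTC1_closed tT' int t0 (cl t (oc t tT)).
  by split; [exact: d1|rewrite -derive1E; exact: d2].
have cF : {within `[0, T], continuous F}.
  by apply: within_continuous_of => t tT; exact: is_derive_continuous (dF t tT).
have cE : {within `[0, T], continuous E}.
  by apply: within_continuous_of => t tT; exact: is_derive_continuous (dE t tT).
have H1 := @le_increment R I (F + E) l (fun t => F' t + E' t) 0 T (ltW T0) dI
  (fun t tT => is_deriveD (dF t (oc t tT)) (dE t (oc t tT))) cI.
have H2 := @le_increment R (F - E) I (fun t => F' t - E' t) l 0 T (ltW T0)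
  (fun t tT => is_deriveB (dF t (oc t tT)) (dE t (oc t tT))) dI.
have {}H1 : I T - I 0 <= (F + E) T - (F + E) 0.
  apply: H1; first by move=> x; exact: cvgD (cF x) (cE x).
  by move=> t /oc /le'; rewrite ler_norml => /andP[_]; rewrite lerBlDl.
have {}H2 : (F - E) T - (F - E) 0 <= I T - I 0.
  apply: H2 => //; first by move=> x; exact: cvgB (cF x) (cE x).
  by move=> t /oc /le'; rewrite ler_norml => /andP[+ _]; lra.
move: H1 H2; rewrite !fctE I0 subr0 -/(I T) => H1 H2.
by rewrite ler_norml; apply/andP; split; lra.
Qed.

(** By the fundamental theorem of calculus [L] is the limit at infinity of the
    nondecreasing function [G], that is, its supremum. *)
Lemma ray_integral (R : realType) (g G : R -> R) (B : R) :
  continuous g -> (forall x : R, 0 <= x -> 0 <= g x) -> G 0 = 0 ->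
  (forall x : R, 0 <= x -> is_derive x 1 G (g x)) ->
  (forall x : R, 0 <= x -> G x <= B) ->
  let L := \int[lebesgue_measure]_(x in `[0, +oo[) g x in
  (forall x : R, 0 <= x -> G x <= L) /\
  (forall b : R, (forall x : R, 0 <= x -> G x <= b) -> L <= b).
Proof.
move=> cg g0 G0 dG GB L.
have cG (x : R) : 0 <= x -> {for x, continuous G}.
  by move=> x0; exact: is_derive_continuous (dG x x0).
have Gle (x y : R) : 0 <= x -> x <= y -> G x <= G y.
  move=> x0 xy; rewrite -subr_ge0.
  have -> : 0 = cst 0 y - cst 0 x :> R by rewrite subrr.
  apply: (@le_increment R _ _ (fun=> 0) g) => //.
  - by move=> t /andP[xt _]; apply: dG; rewrite (le_trans x0)// ltW.
  - by move=> t; exact: cst_continuous.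
  - apply: within_continuous_of => t /andP[xt _]; apply: cG.
    exact: le_trans xt.
  - by move=> t /andP[xt _]; apply: g0; rewrite (le_trans x0)// ltW.
pose Gm (x : R) := G (Num.max x 0).
have Gm_nd : nondecreasing_fun Gm.
  move=> x y xy; apply: Gle; first by rewrite le_max lexx orbT.
  by rewrite ge_max !le_max xy lexx orbT.
have Gm_ub : has_ubound (range Gm).
  by exists B => _ [x _ <-]; apply: GB; rewrite le_max lexx orbT.
have cvgm := nondecreasing_cvgr Gm_nd Gm_ub.
have GGm (x : R) : 0 <= x -> Gm x = G x by move=> x0; rewrite /Gm max_l.
have cvgG : G x @[x --> +oo] --> sup (range Gm).
  apply: cvg_trans cvgm; apply: near_eq_cvg; near=> x; apply: GGm.
  by near: x; apply: nbhs_pinfty_ge; exact: num_real.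
have LE : L = sup (range Gm) - G 0.
  apply: Rintegral_ge0_continuous_FTC2y => //.
  - exact: continuous_subspaceT.
  - by move=> x x0; have [] := dG x (ltW x0).
  - by apply: cvg_at_right_filter; exact: cG.
  - move=> x; rewrite in_itv/= andbT => x0.
    by have [_ <-] := dG x (ltW x0); rewrite derive1E.
rewrite LE G0 subr0; split.
- by move=> x x0; rewrite -(GGm x x0); exact: ub_le_sup.
- move=> c Gc; apply: ge_sup; first by exists (Gm 0); exists 0.
  by move=> _ [x _ <-]; apply: Gc; rewrite le_max lexx orbT.
Unshelve. all: by end_near. Qed.

(** The square root of [N] is not differentiable where [N] vanishes, whence the
    detour through the square root of [N + eta ^+ 2]. *)
Lemma sqrt_growth (R : realType) (N z z' : R -> R) (K t1 : R) : 0 <= t1 -> 0 <= K ->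
  (forall t : R, 0 <= t <= t1 -> 0 <= N t) ->
  (forall t : R, 0 <= t <= t1 -> is_derive t 1 z (z' t)) ->
  (forall t : R, 0 < t < t1 -> 0 <= z' t) ->
  (forall t : R, 0 <= t <= t1 -> exists N', is_derive t 1 N N' /\
     (0 < t < t1 -> `|N'| <= 2 * K * z' t * Num.sqrt (N t))) ->
  `|Num.sqrt (N t1) - Num.sqrt (N 0)| <= K * (z t1 - z 0).
Proof.
move=> t10 K0 N0 dz z'0 dN.
have oc (t : R) : 0 < t < t1 -> 0 <= t <= t1 by move=> /andP[/ltW-> /ltW->].
have t0in : 0 <= (0 : R) <= t1 by rewrite lexx.
have t1in : 0 <= t1 <= t1 by rewrite lexx t10.
have key (eta : R) : 0 < eta ->
    `|Num.sqrt (N t1 + eta ^+ 2) - Num.sqrt (N 0 + eta ^+ 2)|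
      <= K * (z t1 - z 0).
  move=> eta0; pose q (t : R) := Num.sqrt (N t + eta ^+ 2).
  have e2 : 0 < eta ^+ 2 by exact: exprn_gt0.
  have pos (t : R) : 0 <= t <= t1 -> 0 < N t + eta ^+ 2.
    by move=> tt; rewrite ltr_wpDl// N0.
  have dq (t : R) : 0 <= t <= t1 -> is_derive t 1 q (derive1 N t / (2 * q t)).
    move=> tt; have [N' [DN _]] := dN t tt.
    have -> : derive1 N t = N' by rewrite derive1E; have [_ ->] := DN.
    have D1 : is_derive t 1 (fun s => N s + eta ^+ 2) N'.
      by have := is_deriveD DN (is_derive_cst (eta ^+ 2) t 1); rewrite addr0.
    have D2 := is_derive1_sqrt (pos t tt).
    have := @is_derive1_comp R Num.sqrt (fun s => N s + eta ^+ 2) t _ _ D2 D1.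
    by rewrite mulrC.
  have bq (t : R) : 0 < t < t1 -> `|derive1 N t / (2 * q t)| <= K * z' t.
    move=> tt; have [N' [DN /(_ tt) HN]] := dN t (oc t tt).
    have -> : derive1 N t = N' by rewrite derive1E; have [_ ->] := DN.
    have qp : 0 < q t by rewrite sqrtr_gt0 pos// oc.
    have Nq : Num.sqrt (N t) <= q t by apply: ler_wsqrtr; rewrite lerDl ltW.
    have p2 : 0 < 2 * q t by exact: mulr_gt0.
    rewrite normrM normfV (gtr0_norm p2) ler_pdivrMr//.
    apply: (le_trans HN).
    have -> : K * z' t * (2 * q t) = 2 * K * z' t * q t by ring.
    apply: ler_wpM2l => //; apply: mulr_ge0; last exact: z'0.
    exact: mulr_ge0.
  have dKz (t : R) : 0 <= t <= t1 -> is_derive t 1 (K \*: z) (K * z' t).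
    by move=> tt; exact: (is_deriveZ K (dz t tt)).
  have dKzN (t : R) : 0 <= t <= t1 -> is_derive t 1 (- (K \*: z)) (- (K * z' t)).
    by move=> tt; exact: is_deriveN (dKz t tt).
  have cont (F F' : R -> R) : (forall t : R, 0 <= t <= t1 -> is_derive t 1 F (F' t)) ->
      {within `[0, t1], continuous F}.
    by move=> dF; apply: within_continuous_of => t tt;
      exact: is_derive_continuous (dF t tt).
  have H1 := @le_increment R q (K \*: z) _ _ 0 t1 t10 (fun t tt => dq t (oc t tt))
    (fun t tt => dKz t (oc t tt)) (cont _ _ dq) (cont _ _ dKz).
  have H2 := @le_increment R (- (K \*: z)) q _ _ 0 t1 t10
    (fun t tt => dKzN t (oc t tt)) (fun t tt => dq t (oc t tt))
    (cont _ _ dKzN) (cont _ _ dq).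
  have {}H1 := H1 (fun t tt => le_trans (ler_norm _) (bq t tt)).
  have {}H2 : (- (K \*: z)) t1 - (- (K \*: z)) 0 <= q t1 - q 0.
    by apply: H2 => t tt; rewrite lerNl (le_trans _ (bq t tt))// -normrN ler_norm.
  have scaleE (x : R) : K *: x = K * x by [].
  move: H1 H2; rewrite !fctE /= !scaleE => H1 H2.
  by rewrite ler_norml -/(q t1) -/(q 0); apply/andP; split; lra.
have close (a eta : R) : 0 <= a -> 0 < eta ->
    Num.sqrt a <= Num.sqrt (a + eta ^+ 2) <= Num.sqrt a + eta.
  move=> a0 eta0; apply/andP; split.
    by apply: ler_wsqrtr; rewrite lerDl sqr_ge0.
  have s0 := sqrtr_ge0 a.
  have s1 : 0 <= Num.sqrt a + eta by rewrite addr_ge0// ltW.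
  rewrite -[leRHS]ger0_norm// -sqrtr_sqr; apply: ler_wsqrtr.
  rewrite sqrrD sqr_sqrtr// -addrA lerD2l lerDr mulrn_wge0//.
  by rewrite mulr_ge0// ltW.
apply/ler_addgt0Pr => eta eta0.
have := key _ eta0.
have /andP[a1 a2] := close _ _ (N0 _ t1in) eta0.
have /andP[b1 b2] := close _ _ (N0 _ t0in) eta0.
rewrite !ler_norml => /andP[c1 c2]; apply/andP; split; lra.
Qed.

(** Continuity argument: consider the first time at which [g] is not positive. *)
Lemma positivity_induction (R : realType) (g : R -> R) (T : R) :
  (forall t : R, 0 <= t <= T -> {for t, continuous g}) ->
  (forall t : R, 0 <= t <= T -> (forall s : R, 0 <= s < t -> 0 < g s) -> 0 < g t) ->
  forall t : R, 0 <= t <= T -> 0 < g t.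
Proof.
move=> cg step t tT; apply: contrapT => gt.
pose B := [set s : R | 0 <= s <= T /\ ~ 0 < g s].
have Bt : B t by [].
have hi : has_inf B by split; [exists t|exists 0 => s [/andP[]]].
set t0 := inf B.
have lb s : B s -> t0 <= s by move=> Bs; apply: ge_inf => //; exact: hi.2.
have t00 : 0 <= t0 by apply: lb_le_inf => [|s [/andP[]]//]; exists t.
have t0T : t0 <= T by apply: (le_trans (lb _ Bt)); case/andP: tT.
have t0in : 0 <= t0 <= T by rewrite t00.
have gt0 : 0 < g t0.
  apply: step => // s /andP[s0 st0]; apply: contrapT => gs.
  have : t0 <= s by apply: lb; split => //; rewrite s0 (le_trans (ltW st0)).
  by rewrite leNgt st0.
have [d /= d0 Hd] : \forall s \near t0, 0 < g s.
  exact: (cg t0 t0in _ (lt_nbhsr gt0)).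
have [s Bs std] := inf_adherent d0 hi.
have t0s := lb _ Bs.
have : 0 < g s.
  apply: Hd; rewrite /ball_ /= distrC ger0_norm ?subr_ge0//.
  by rewrite ltrBlDl.
by case: Bs.
Qed.

(** * The profile integral *)

Section profile_integral.
Context (R : realType) (w : R -> R -> R) (hw : scaling_function w) (k : nat)
  (hk : (2 <= k)%N).

Let f := w 1.

Definition profile_integrand (phi Z : R) : R :=
  (w 1 Z ^+ k * Num.sqrt (w 1 Z ^+ (2 * k) - cos phi ^+ 2))^-1.

Let f_ge1 Z : 1 <= f Z. Proof. exact: profile_ge1. Qed.
Let f_gt0 Z : 0 < f Z. Proof. exact: lt_le_trans ltr01 (f_ge1 Z). Qed.

Let gap_gt0 phi Z : cos phi ^+ 2 < 1 -> 0 < f Z ^+ (2 * k) - cos phi ^+ 2.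
Proof.
by move=> c1; rewrite subr_gt0 (lt_le_trans c1)// exprn_ege1.
Qed.

Lemma profile_integrand_gt0 phi Z : cos phi ^+ 2 < 1 ->
  0 < profile_integrand phi Z.
Proof.
move=> c1; rewrite invr_gt0 mulr_gt0//; first exact: exprn_gt0.
by rewrite sqrtr_gt0; exact: gap_gt0.
Qed.

Lemma profile_integrand_continuous phi : cos phi ^+ 2 < 1 ->
  continuous (profile_integrand phi).
Proof.
move=> c1 Z; have df : derivable f Z 1.
  by apply: diff_derivable; exact: scaling_differentiable.
have d1 n : derivable (fun t => f t ^+ n) Z 1.
  have -> : (fun t => f t ^+ n) = f ^+ n by apply/funext => t; rewrite exprfctE.
  exact: derivableX.
have c' n : {for Z, continuous (fun t => f t ^+ n)}.
  exact: (differentiable_continuous ((derivable1_diffP _ _).1 (d1 n))).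
have c2 : {for Z, continuous (fun t => f t ^+ (2 * k) - cos phi ^+ 2)}.
  by apply: cvgB; [exact: c'|exact: cvg_cst].
have c3 : {for Z, continuous
    (fun t => Num.sqrt (f t ^+ (2 * k) - cos phi ^+ 2))}.
  by apply: (continuous_comp c2); exact: sqrt_continuous.
have c4 : {for Z, continuous
    (fun t => f t ^+ k * Num.sqrt (f t ^+ (2 * k) - cos phi ^+ 2))}.
  by apply: cvgM; [exact: c'|exact: c3].
have nz : f Z ^+ k * Num.sqrt (f Z ^+ (2 * k) - cos phi ^+ 2) != 0.
  by rewrite -invr_eq0 gt_eqF//; exact: profile_integrand_gt0.
exact: (cvgV nz c4).
Qed.

Lemma profile_primitive phi : cos phi ^+ 2 < 1 -> exists G : R -> R,
  G 0 = 0 /\ forall Z : R, 0 <= Z -> is_derive Z 1 G (profile_integrand phi Z).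
Proof. by move=> c1; apply: antiderivative; exact: profile_integrand_continuous. Qed.

Lemma is_derive_inv_shift (a x : R) : 0 < a + x ->
  is_derive x 1 (fun t : R => - (a + t)^-1) ((a + x) ^- 2).
Proof.
move=> ax.
have d1 : is_derive x 1 (fun t : R => a + t) 1.
  by have := is_deriveD (is_derive_cst a x 1) (is_derive_id x 1); rewrite add0r.
have nz : a + x != 0 by rewrite gt_eqF.
have [d1' e1] := d1.
have dV := derivableV nz d1'.
have eV := deriveV nz d1'.
have d2 : is_derive x 1 (fun t : R => (a + t)^-1) (- (a + x) ^- 2).
  by split; [exact: dV|rewrite eV e1 -[LHS]/(_ * _) mulr1].
by have := is_deriveN d2; rewrite opprK.
Qed.

(** The integrand is positive, which gives the lower bound; beyond [X] it is
    below the derivative of [- D / (1 + Z)], which gives the upper one. *)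
Lemma Cphi_bounds phi (G : R -> R) (D X : R) : cos phi ^+ 2 < 1 -> 0 <= X ->
  G 0 = 0 ->
  (forall Z : R, 0 <= Z -> is_derive Z 1 G (profile_integrand phi Z)) ->
  (forall Z : R, X <= Z -> profile_integrand phi Z <= D * (1 + Z) ^- 2) ->
  0 <= D -> G X <= Cphi w k phi <= G X + D / (1 + X).
Proof.
move=> c1 X0 G0 dG bG D0.
have cG (x : R) : 0 <= x -> {for x, continuous G}.
  by move=> x0; exact: is_derive_continuous (dG x x0).
have Gle (x y : R) : 0 <= x -> x <= y -> G x <= G y.
  move=> x0 xy; rewrite -subr_ge0.
  have -> : 0 = cst 0 y - cst 0 x :> R by rewrite subrr.
  apply: (@le_increment R _ _ (fun=> 0) (profile_integrand phi)) => //.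
  - by move=> t /andP[xt _]; apply: dG; rewrite (le_trans x0)// ltW.
  - by move=> t; exact: cst_continuous.
  - apply: within_continuous_of => t /andP[xt _]; apply: cG.
    exact: le_trans xt.
  - by move=> t _; exact/ltW/profile_integrand_gt0.
have B Y : 0 <= Y -> G Y <= G X + D / (1 + X).
  move=> Y0; have [YX|XY] := leP Y X.
    by rewrite (le_trans (Gle _ _ Y0 YX))// lerDl divr_ge0// addr_ge0.
  pose E (t : R) := D * - (1 + t)^-1.
  have pos t : X <= t -> 0 < 1 + t by move=> Xt; lra.
  have dE t : X <= t -> is_derive t 1 E (D * (1 + t) ^- 2).
    by move=> Xt; exact: (is_deriveZ D (is_derive_inv_shift (pos t Xt))).
  have : G Y - G X <= E Y - E X.
    apply: (@le_increment R _ _ (profile_integrand phi)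
      (fun t => D * (1 + t) ^- 2)); first exact: ltW.
    - by move=> t /andP[/ltW Xt _]; apply: dG; exact: le_trans Xt.
    - by move=> t /andP[/ltW Xt _]; exact: dE.
    - apply: within_continuous_of => t /andP[Xt _]; apply: cG.
      exact: le_trans Xt.
    - apply: within_continuous_of => t /andP[Xt _].
      exact: is_derive_continuous (dE t Xt).
    - by move=> t /andP[/ltW Xt _]; exact: bG.
  rewrite /E lerBlDl => /le_trans; apply; rewrite lerD2l mulrN mulrN opprK.
  by rewrite addrC lerBlDr lerDl divr_ge0// addr_ge0.
have := @ray_integral R (profile_integrand phi) G (G X + D / (1 + X))
  (profile_integrand_continuous c1) _ G0 dG B.
have g0 (x : R) : 0 <= x -> 0 <= profile_integrand phi x.
  by move=> _; exact/ltW/profile_integrand_gt0.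
by move=> /(_ g0) [L1 L2]; rewrite L1//=; exact: L2.
Qed.

(** The root is at least [f Z ^ k * sqrt (1 - q)], and [f] grows linearly.  The
    bound does not degenerate as [phi] tends to zero if [q] is fixed. *)
Lemma profile_integrand_decay (c0 : R) : 0 < c0 ->
  (forall Z, 0 <= Z -> c0 * (1 + Z) <= f Z) ->
  forall phi q Z : R, 0 <= Z -> 0 <= q < 1 ->
    cos phi ^+ 2 <= q * f Z ^+ (2 * k) ->
  profile_integrand phi Z <= (c0 ^+ 2 * Num.sqrt (1 - q))^-1 * (1 + Z) ^- 2.
Proof.
move=> c00 fc phi q Z Z0 /andP[q0 q1] cq.
have sq : 0 < Num.sqrt (1 - q) by rewrite sqrtr_gt0 subr_gt0.
have Zp : 0 < 1 + Z by lra.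
rewrite -invfM /profile_integrand lef_pV2 ?posrE; last 2 first.
- have fk : 0 < f Z ^+ (2 * k) by exact: exprn_gt0.
  apply: mulr_gt0; first exact: exprn_gt0.
  rewrite sqrtr_gt0 subr_gt0; apply: le_lt_trans cq _.
  by rewrite gtr_pMl.
- by apply: mulr_gt0; [apply: mulr_gt0 => //|]; exact: exprn_gt0.
have fk0 : 0 <= f Z ^+ k by exact/exprn_ge0/ltW.
have s1 : f Z ^+ k * Num.sqrt (1 - q) <=
    Num.sqrt (f Z ^+ (2 * k) - cos phi ^+ 2).
  rewrite -[X in X * _]ger0_norm// -sqrtr_sqr -sqrtrM ?sqr_ge0//.
  apply: ler_wsqrtr; rewrite -exprM mulnC mulrBr mulr1 lerD2l lerN2.
  by rewrite mulrC.
have f2 : (c0 * (1 + Z)) ^+ 2 <= f Z ^+ k * f Z ^+ k.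
  rewrite -exprD; apply: (le_trans (y := f Z ^+ 2)).
    rewrite ler_sqr ?nnegrE ?fc//; first exact/mulr_ge0/ltW/Zp/ltW.
    exact: ltW.
  apply: ler_weXn2l; first exact: f_ge1.
  by rewrite (leq_trans hk)// leq_addr.
apply: (le_trans (y := f Z ^+ k * (f Z ^+ k * Num.sqrt (1 - q)))).
  rewrite mulrA; apply: (le_trans (y := (c0 * (1 + Z)) ^+ 2 * Num.sqrt (1 - q))).
    by rewrite le_eqVlt; apply/orP; left; apply/eqP; ring.
  by apply: ler_wpM2r => //; exact: ltW.
exact: ler_wpM2l.
Qed.

End profile_integral.

(** * Comparison with the model of constant momentum *)

(** [a / zd] and [a0 / sigma] are the slopes of the geodesic and of its model
    for which the angular momentum is constant. *)
Lemma slope_dist (R : realType) (a a0 zd sigma rho s0 : R) :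
  0 <= a <= 1 -> 0 <= a0 <= 1 -> 0 < s0 -> s0 <= zd -> s0 <= sigma ->
  `|rho| <= 1 / 2 -> zd ^+ 2 * (1 - rho) = 1 - a ^+ 2 ->
  sigma ^+ 2 = 1 - a0 ^+ 2 ->
  `|a / zd - a0 / sigma| <=
    `|a - a0| / s0 + (2 * `|a - a0| + 2 * `|rho|) / s0 ^+ 3.
Proof.
move=> /andP[a_0 a1] /andP[a00 a01] s00 szd ssg rho2 en sg.
have zd0 : 0 < zd by exact: lt_le_trans szd.
have sg0 : 0 < sigma by exact: lt_le_trans ssg.
have [r1 r2] : - (1 / 2) <= rho /\ rho <= 1 / 2.
  by move: rho2; rewrite ler_norml => /andP[].
have zd2 : zd ^+ 2 <= 2 by have := sqr_ge0 zd; have := sqr_ge0 a; nra.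
have E1 : a / zd - a0 / sigma =
    (a - a0) / zd + a0 * ((sigma ^+ 2 - zd ^+ 2) / (sigma + zd)) / (zd * sigma).
  by field; rewrite !gt_eqF ?addr_gt0.
have E2 : sigma ^+ 2 - zd ^+ 2 = (a - a0) * (a + a0) - rho * zd ^+ 2.
  by rewrite sg; lra.
rewrite E1; apply: (le_trans (ler_normD _ _)); apply: lerD.
  rewrite normrM normfV (gtr0_norm zd0); apply: ler_wpM2l => //.
  by rewrite lef_pV2.
have B : `|sigma ^+ 2 - zd ^+ 2| <= 2 * `|a - a0| + 2 * `|rho|.
  rewrite E2; apply: (le_trans (ler_normB _ _)); apply: lerD.
    rewrite normrM mulrC; apply: ler_wpM2r => //.
    by rewrite ger0_norm ?addr_ge0//; lra.
  rewrite normrM mulrC; apply: ler_wpM2r => //.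
  by rewrite ger0_norm// sqr_ge0.
have p1 : 0 < sigma + zd by exact: addr_gt0.
have p2 : 0 < zd * sigma by exact: mulr_gt0.
rewrite !normrM !normfV (gtr0_norm p1) (gtr0_norm p2) (ger0_norm a00).
set b := `|sigma ^+ 2 - zd ^+ 2| in B *.
set c := 2 * _ + _ in B *.
have b0 : 0 <= b by exact: normr_ge0.
have -> : a0 * (b / (sigma + zd)) / (zd * sigma) =
    a0 * b * ((sigma + zd) * (zd * sigma))^-1.
  by field; rewrite !gt_eqF.
apply: ler_pM.
- exact: mulr_ge0.
- by rewrite invr_ge0 ltW// mulr_gt0.
- by apply: le_trans B; rewrite ler_piMl.
- rewrite lef_pV2 ?posrE ?exprn_gt0 ?mulr_gt0//.
  have q1 : s0 <= sigma + zd by rewrite (le_trans szd)// lerDr ltW.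
  have q2 : s0 * s0 <= zd * sigma by apply: ler_pM => //; exact: ltW.
  rewrite (_ : s0 ^+ 3 = s0 * (s0 * s0)); last by ring.
  by apply: ler_pM => //; [exact: ltW|apply: mulr_ge0; exact: ltW].
Qed.

(** [s0] is a lower bound for the slope of a geodesic on which the ratio of
    the momentum to [w ^ k] is at most [(1 + kap) / 2]. *)
Definition length_constant (R : realType) (k : nat) (C c0 kap : R) : R :=
  let s0 := Num.sqrt ((1 - ((1 + kap) / 2) ^+ 2) / 2) in
  let D := C / s0 + 2 * C / s0 ^+ 3 in C + D + D * c0 ^- k.

Lemma length_constant_ge0 (R : realType) (k : nat) (C c0 kap : R) :
  0 <= C -> 0 <= c0 -> 0 <= length_constant k C c0 kap.
Proof.
move=> C0 c00; rewrite /length_constant; set s0 := Num.sqrt _.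
have s00 : 0 <= s0 by exact: sqrtr_ge0.
have D0 : 0 <= C / s0 + 2 * C / s0 ^+ 3.
  by rewrite addr_ge0// divr_ge0// ?exprn_ge0// mulr_ge0.
apply: addr_ge0; first exact: addr_ge0.
by apply: mulr_ge0 => //; rewrite invr_ge0 exprn_ge0.
Qed.

Section motion.
Context (R : realType) (w : R -> R -> R) (hw : scaling_function w) (k : nat)
  (hk : (2 <= k)%N) (C r1 c0 kap : R) (C0 : 0 < C) (c00 : 0 < c0)
  (prof : forall Z : R, 0 <= Z -> c0 * (1 + Z) <= w 1 Z) (kap01 : 0 <= kap < 1).
Context (e phi z0 T : R) (z N l : R -> R) (e0 : 0 < e)
  (z0r : z0 < r1) (z0C : 4 * C * z0 <= 1) (eC : 8 * C * e <= c0 * (1 - kap))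
  (phik : 0 <= cos phi <= kap)
  (mot : reduced_motion w k C r1 e phi z0 T z N l).

Let W t := w e (z t) ^+ k.
Let theta := (1 + kap) / 2.
Let s0 := Num.sqrt ((1 - theta ^+ 2) / 2).

Let k0 : 0 <= kap. Proof. by case/andP: kap01. Qed.
Let k1 : kap < 1. Proof. by case/andP: kap01. Qed.
Let cos0 : 0 <= cos phi. Proof. by case/andP: phik. Qed.
Let cosk : cos phi <= kap. Proof. by case/andP: phik. Qed.
Let theta1 : theta < 1. Proof. by rewrite /theta; have := k1; lra. Qed.
Let theta0 : 0 <= theta. Proof. by rewrite /theta; have := k0; lra. Qed.
Let theta2 : 0 < 1 - theta ^+ 2.
Proof. by rewrite subr_gt0 expr_lt1. Qed.
Let s00 : 0 < s0. Proof. by rewrite sqrtr_gt0 divr_gt0. Qed.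
Let s02 : s0 ^+ 2 = (1 - theta ^+ 2) / 2.
Proof. by rewrite sqr_sqrtr// divr_ge0// ltW. Qed.

Let w_gt0 x : 0 < w e x. Proof. exact: scaling_gt0. Qed.

Let w_ge (x : R) : 0 <= x -> e <= w e x.
Proof. by move=> x0; rewrite (scalingE hw)// ler_peMr ?profile_ge1// ltW. Qed.

Let w_lin (x : R) : 0 <= x -> c0 * (e + x) <= w e x.
Proof.
move=> x0; rewrite (scalingE hw)//.
have := prof (divr_ge0 x0 (ltW e0)); rewrite -(ler_pM2l e0); apply: le_trans.
by rewrite le_eqVlt; apply/orP; left; apply/eqP; field; rewrite gt_eqF.
Qed.

Let w_mono (x y : R) : 0 <= x -> x <= y -> w e x <= w e y.
Proof.
move=> x0 xy; rewrite !(scalingE hw _ e0) ler_pM2l//; apply: profile_le => //.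
  by rewrite divr_ge0// ltW.
by rewrite ler_pM2r// invr_gt0.
Qed.

Let W_gt0 t : 0 < W t. Proof. exact: exprn_gt0. Qed.

Let rising (t : R) : Prop :=
  0 <= t <= T /\ (forall s, 0 <= s < t -> 0 < derive1 z s).

Let rising_mono (t : R) : rising t -> forall s s', 0 <= s -> s <= s' -> s' <= t ->
  z s <= z s'.
Proof.
move=> [/andP[t0 tT] pos] s s' s_0 ss' s't; rewrite -subr_ge0.
have -> : 0 = cst 0 s' - cst 0 s :> R by rewrite subrr.
have dz x : s <= x <= s' -> is_derive x 1 z (derive1 z x).
  move=> /andP[sx xs']; apply: (rm_is_derive mot).
  by rewrite (le_trans s_0)// (le_trans xs')// (le_trans s't).
apply: (@le_increment R _ _ (fun=> 0) (derive1 z)) => //.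
- by move=> x /andP[/ltW sx /ltW xs']; apply: dz; rewrite sx.
- by move=> x; exact: cst_continuous.
- by apply: within_continuous_of => x xs; exact: is_derive_continuous (dz x xs).
- move=> x /andP[sx xs']; apply/ltW/pos.
  by rewrite (le_trans s_0 (ltW sx)) (lt_le_trans xs').
Qed.

Let rising_range t : rising t -> forall s, 0 <= s <= t -> 0 <= z s <= z0.
Proof.
move=> rt s /andP[s_0 st]; have [/andP[t0 tT] _] := rt.
rewrite -{1}(rm_start mot) (rising_mono rt)//=.
have := le_trans st tT; rewrite le_eqVlt => /predU1P[->|sT].
  by rewrite (rm_end mot).
by apply/ltW/(rm_lt mot); rewrite s_0.
Qed.

Let range_r1 (x : R) : 0 <= x <= z0 -> 0 <= x < r1.
Proof. by move=> /andP[-> /le_lt_trans]; apply. Qed.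

(** [sqrt N] grows by at most [C * w ^ k / 2] per unit of height, and [w]
   increases with the height. *)
Let momentum_dist t : rising t ->
  `|Num.sqrt (N t) - e ^+ k * cos phi| <= C * z t * W t.
Proof.
move=> rt; have [/andP[t0 tT] pos] := rt.
have sin s : 0 <= s <= t -> 0 <= s <= T.
  by move=> /andP[-> st]; exact: le_trans tT.
have N0E : Num.sqrt (N 0) = e ^+ k * cos phi.
  rewrite (rm_momentum0 mot) mulnC exprM -exprMn sqrtr_sqr ger0_norm//.
  by rewrite mulr_ge0// exprn_ge0// ltW.
have Wt := W_gt0 t.
have zt : 0 <= z t by have /andP[] := rising_range rt (introT andP (conj t0 (lexx t))).
have K0 : 0 <= C * W t / 2 by rewrite divr_ge0// mulr_ge0// ltW.
have H := @sqrt_growth R N z (derive1 z) (C * W t / 2) t t0 K0.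
rewrite -N0E; apply: (le_trans (y := C * W t / 2 * (z t - z 0))).
  apply: H.
  - by move=> s st; apply: (rm_ge0 mot); [exact: sin|exact/range_r1/(rising_range rt)].
  - by move=> s st; apply: (rm_is_derive mot); exact: sin.
  - by move=> s /andP[s_0 st]; apply/ltW/pos; rewrite ltW.
  - move=> s st; have [N' [dN N'le]] := rm_momentum mot (sin s st)
      (range_r1 (rising_range rt st)).
    exists N'; split => // /andP[s_0 st']; apply: (le_trans N'le).
    have zs : 0 < derive1 z s by apply: pos; rewrite ltW.
    rewrite gtr0_norm//.
    have WW : w e (z s) ^+ k <= W t.
      have /andP[zs0 _] := rising_range rt st.
      apply: lerXn2r; rewrite ?nnegrE; [exact/ltW|exact/ltW|].
      exact: (w_mono zs0 (rising_mono rt (ltW s_0) (ltW st') (lexx t))).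
    have -> : 2 * (C * W t / 2) * derive1 z s * Num.sqrt (N s) =
        C * derive1 z s * Num.sqrt (N s) * W t by field.
    apply: ler_wpM2l => //; rewrite mulr_ge0 ?sqrtr_ge0// mulr_ge0//; exact: ltW.
rewrite (rm_start mot) subr0.
have : 0 <= C * z t * W t by rewrite !mulr_ge0// ltW.
by lra.
Qed.

(** Up to [rho], the slope of the geodesic is [sqrt (1 - a ^ 2)]; that of the
   model is [sigma = sqrt (1 - a0 ^ 2)]. *)
Let a t := Num.sqrt (N t) / W t.
Let a0 t := e ^+ k * cos phi / W t.

Let a_dist t : rising t -> `|a t - a0 t| <= C * z t.
Proof.
move=> rt; rewrite /a /a0 -mulrBl normrM normfV (gtr0_norm (W_gt0 t)).
by rewrite (ler_pdivrMr _ _ (W_gt0 t)); exact: momentum_dist.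
Qed.

Let a0_le t : rising t -> 0 <= a0 t <= e / w e (z t) * cos phi.
Proof.
move=> rt; have [/andP[t0 tT] _] := rt.
have /andP[zt0 _] := rising_range rt (introT andP (conj t0 (lexx t))).
apply/andP; split.
  by rewrite divr_ge0 ?mulr_ge0 ?exprn_ge0// ltW.
rewrite /a0 mulrAC; apply: ler_wpM2r => //.
rewrite -expr_div_n -[leRHS]expr1; apply: ler_wiXn2l.
- by rewrite divr_ge0// ltW.
- by rewrite ler_pdivrMr// mul1r; exact: w_ge.
- exact: leq_trans hk.
Qed.

(** Near the waist the angle of impact keeps [a] away from [1]; further up
    [e / w] is small. *)
Let a_le t : rising t -> 0 <= a t <= theta /\ a0 t <= theta.
Proof.
move=> rt; have [/andP[t0 tT] _] := rt.
have /andP[zt0 ztz] := rising_range rt (introT andP (conj t0 (lexx t))).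
have a_ge : 0 <= a t by rewrite divr_ge0 ?sqrtr_ge0// ltW.
have /andP[b0 b1] := a0_le rt.
have ew0 : 0 <= e / w e (z t) by rewrite divr_ge0// ltW.
have ew1 : e / w e (z t) <= 1 by rewrite ler_pdivrMr// mul1r; exact: w_ge.
have a0k : a0 t <= kap.
  apply: (le_trans b1); rewrite -[leRHS]mul1r; exact: ler_pM.
have kt : kap <= theta by rewrite /theta; have := k1; lra.
split; last exact: le_trans kt.
rewrite a_ge /=; have /ler_normlP[_ d] := a_dist rt.
have [small|large] := leP (C * z t) ((1 - kap) / 2).
  by rewrite /theta; lra.
have Cz : C * z t <= 1 / 4.
  have : C * z t <= C * z0 by rewrite ler_pM2l.
  by have := z0C; lra.
have ew4 : e / w e (z t) <= 1 / 4.
  have wz := w_lin zt0.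
  have ce : c0 * e >= 0 by rewrite mulr_ge0// ltW.
  rewrite ler_pdivrMr//.
  have h1 : 8 * C * e <= c0 * (2 * (C * z t)).
    by apply: (le_trans eC); rewrite ler_pM2l//; lra.
  have h2 : C * (4 * e) <= C * (c0 * z t) by lra.
  have {}h2 : 4 * e <= c0 * z t by move: h2; rewrite ler_pM2l.
  by lra.
have a04 : a0 t <= 1 / 4.
  apply: (le_trans b1); rewrite -[leRHS]mulr1.
  by apply: (ler_pM ew0 cos0 ew4); exact: cos_le1.
by rewrite /theta; have := k0; lra.
Qed.

Let slope_ge t : rising t -> s0 ^+ 2 <= derive1 z t ^+ 2.
Proof.
move=> rt; have [tT _] := rt; have /andP[t0 _] := tT.
have zt := range_r1 (rising_range rt (introT andP (conj t0 (lexx t)))).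
have [rho [en _ rho2]] := rm_energy mot tT zt.
have [r1' r2'] : - (1 / 2) <= rho /\ rho <= 1 / 2.
  by move: rho2; rewrite ler_norml => /andP[].
have aE : N t / w e (z t) ^+ (2 * k) = a t ^+ 2.
  have N0 := rm_ge0 mot tT zt.
  by rewrite /a expr_div_n sqr_sqrtr// /W -exprM mulnC.
rewrite aE in en; have [/andP[a_0 at_] _] := a_le rt.
have : a t ^+ 2 <= theta ^+ 2 by rewrite ler_sqr ?nnegrE.
rewrite s02; have := theta2; have := sqr_ge0 (derive1 z t); nra.
Qed.

(** [slope_ge] excludes that the slope vanishes for the first time. *)
Let slope_gt0 t : 0 <= t <= T -> 0 < derive1 z t.
Proof.
apply: positivity_induction; first exact: (rm_continuous mot).
move=> {}t tT pos; have rt : rising t by [].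
have ge := slope_ge rt.
have zd0 : 0 <= derive1 z t.
  have /andP[] := tT; rewrite le_eqVlt => /predU1P[<- _|t0 _].
    exact: (rm_upwards mot).
  rewrite leNgt; apply/negP => neg.
  have [d /= d0 Hd] : \forall s \near t, derive1 z s < 0.
    have cz := rm_continuous mot tT.
    exact: (cz [set x : R | x < 0] (lt_nbhsl neg)).
  pose s := Num.max 0 (t - d / 2).
  have st : s < t by rewrite gt_max t0 /= ltrBlDr ltrDl divr_gt0.
  have s_0 : 0 <= s by rewrite le_max lexx.
  have : derive1 z s < 0.
    apply: Hd; rewrite /ball_ /= ger0_norm ?subr_ge0 ?(ltW st)//.
    have : t - d / 2 <= s by rewrite le_max lexx orbT.
    by lra.
  have : 0 < derive1 z s by apply: pos; rewrite s_0.
  by move=> /ltW /le_lt_trans H /H; rewrite ltxx.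
rewrite lt_neqAle zd0 andbT eq_sym; apply/eqP => zd.
move: ge; rewrite zd expr0n /= leNgt => /negP; apply.
exact: exprn_gt0.
Qed.

Let all_rising t : 0 <= t <= T -> rising t.
Proof.
move=> tT; split => // s /andP[s_0 st]; apply: slope_gt0.
by rewrite s_0 (le_trans (ltW st))//; case/andP: tT.
Qed.

Let phi1 : cos phi ^+ 2 < 1.
Proof. by rewrite expr_lt1//; apply: le_lt_trans k1. Qed.

Let sigma t := Num.sqrt (w 1 (z t / e) ^+ (2 * k) - cos phi ^+ 2)
  / w 1 (z t / e) ^+ k.

Let WE t : W t = e ^+ k * w 1 (z t / e) ^+ k.
Proof. by rewrite /W (scalingE hw)// exprMn. Qed.

Let f_gt0 t : 0 < w 1 (z t / e).
Proof. by apply: lt_le_trans (profile_ge1 hw _). Qed.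

Let sigma_sqr t : sigma t ^+ 2 = 1 - a0 t ^+ 2.
Proof.
have fk : w 1 (z t / e) ^+ k != 0 by rewrite gt_eqF// exprn_gt0.
have ek : e ^+ k != 0 by rewrite gt_eqF// exprn_gt0.
rewrite /sigma expr_div_n sqr_sqrtr; last first.
  by rewrite subr_ge0 (le_trans (ltW phi1))// exprn_ege1// profile_ge1.
rewrite /a0 WE mulnC exprM; field.
by rewrite ek fk.
Qed.

Let D := C / s0 + 2 * C / s0 ^+ 3.
Let D' := length_constant k C c0 kap.

Let D_ge0 : 0 <= D.
Proof.
by apply: addr_ge0; apply: divr_ge0; rewrite ?exprn_ge0 ?mulr_ge0// ltW.
Qed.

Let speed_dist t : 0 <= t <= T ->
  `|l t - e ^- k.-1 * (cos phi * (profile_integrand w k phi (z t / e)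
       * (derive1 z t / e)))|
  <= D' * (derive1 z t + (e + z t) ^- k.-1 * derive1 z t).
Proof.
move=> tT; have rt := all_rising tT; have /andP[t0 _] := tT.
have zr := rising_range rt (introT andP (conj t0 (lexx t))).
have zt := range_r1 zr; have /andP[zt0 _] := zr.
have zd := slope_gt0 tT; have zd0 := ltW zd; have Wt := W_gt0 t.
have [rho [en rhoC rho2]] := rm_energy mot tT zt.
have N0 := rm_ge0 mot tT zt.
have aE : N t / w e (z t) ^+ (2 * k) = a t ^+ 2.
  by rewrite /a expr_div_n sqr_sqrtr// /W -exprM mulnC.
rewrite aE in en; have [/andP[a_0 at_] a0t] := a_le rt.
have /andP[a0_0 _] := a0_le rt.
have szd : s0 <= derive1 z t.
  by rewrite -ler_sqr ?nnegrE ?slope_ge// ltW.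
have sg0 : 0 < sigma t.
  rewrite divr_gt0 ?exprn_gt0// sqrtr_gt0 subr_gt0 (lt_le_trans phi1)//.
  by rewrite exprn_ege1// profile_ge1.
have ssg : s0 <= sigma t.
  rewrite -ler_sqr ?nnegrE ?(ltW s00) ?(ltW sg0)// s02 sigma_sqr.
  have : a0 t ^+ 2 <= theta ^+ 2 by rewrite ler_sqr ?nnegrE.
  by have := theta2; lra.
have th1 := ltW theta1.
have SD := @slope_dist R (a t) (a0 t) (derive1 z t) (sigma t) rho s0.
rewrite a_0 a0_0 (le_trans at_ th1) (le_trans a0t th1) /= in SD.
have {}SD := SD isT isT s00 szd ssg rho2 en (sigma_sqr t).
have {}SD : `|a t / derive1 z t - a0 t / sigma t| <= D * (z t + W t).
  apply: (le_trans SD).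
  have ad := a_dist rt.
  have i1 : 0 <= s0^-1 by rewrite invr_ge0 ltW.
  have i3 : 0 <= s0 ^- 3 by rewrite invr_ge0 exprn_ge0// ltW.
  have t1 : `|a t - a0 t| / s0 <= C * z t / s0 by exact: ler_wpM2r.
  have t2 : (2 * `|a t - a0 t| + 2 * `|rho|) / s0 ^+ 3 <=
      (2 * (C * z t) + 2 * (C * W t)) / s0 ^+ 3.
    apply: ler_wpM2r => //.
    by apply: lerD; apply: ler_wpM2l.
  apply: (le_trans (lerD t1 t2)).
  have W0 : 0 <= C * W t / s0 by rewrite divr_ge0// ?mulr_ge0// ltW.
  rewrite /D; apply: (le_trans (y := C * z t / s0 +
    (2 * (C * z t) + 2 * (C * W t)) / s0 ^+ 3 + C * W t / s0)).
    by rewrite lerDl.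
  rewrite le_eqVlt; apply/orP; left; apply/eqP; ring.
have fk : w 1 (z t / e) ^+ k != 0 by rewrite gt_eqF// exprn_gt0.
have kS : k = k.-1.+1 by rewrite prednK// (leq_trans _ hk).
have ME : e ^- k.-1 * (cos phi * (profile_integrand w k phi (z t / e)
       * (derive1 z t / e))) = derive1 z t / W t * (a0 t / sigma t).
  have sn : Num.sqrt (w 1 (z t / e) ^+ (2 * k) - cos phi ^+ 2) != 0.
    rewrite gt_eqF// sqrtr_gt0 subr_gt0 (lt_le_trans phi1)//.
    by rewrite exprn_ege1// profile_ge1.
  rewrite /profile_integrand /sigma /a0 !WE.
  have -> : e ^+ k = e * e ^+ k.-1 by rewrite {1}kS exprS.
  have en0 : e != 0 by rewrite gt_eqF.
  have ek0 : e ^+ k.-1 != 0 by rewrite expf_neq0.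
  by field; rewrite ?sn ?fk ?en0 ?ek0.
have aW : Num.sqrt (N t) / w e (z t) ^+ (2 * k) =
    derive1 z t / W t * (a t / derive1 z t).
  rewrite /a mulnC exprM -/(W t); field.
  by rewrite gt_eqF// gt_eqF.
have zW0 : 0 <= derive1 z t / W t by rewrite divr_ge0// ltW.
have M2 : `|Num.sqrt (N t) / w e (z t) ^+ (2 * k)
    - derive1 z t / W t * (a0 t / sigma t)| <=
    derive1 z t / W t * (D * (z t + W t)).
  by rewrite aW -mulrBr normrM ger0_norm// ler_wpM2l.
have sp := rm_speed mot tT zt; rewrite (gtr0_norm zd) in sp.
rewrite ME.
apply: (le_trans (y := C * derive1 z t + derive1 z t / W t * (D * (z t + W t)))).
  have := ler_normD (l t - Num.sqrt (N t) / w e (z t) ^+ (2 * k))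
    (Num.sqrt (N t) / w e (z t) ^+ (2 * k) - derive1 z t / W t * (a0 t / sigma t)).
  rewrite addrA subrK => /le_trans; apply; exact: lerD.
have zW : z t / W t <= c0 ^- k * (e + z t) ^- k.-1.
  have ez : 0 < e + z t by rewrite ltr_pwDl.
  have cez : 0 < c0 * (e + z t) by exact: mulr_gt0.
  have Wge : (c0 * (e + z t)) ^+ k <= W t.
    by apply: lerXn2r; rewrite ?nnegrE; [exact/ltW|exact/ltW|exact: w_lin].
  rewrite ler_pdivrMr//.
  apply: (le_trans (y := c0 ^- k * (e + z t) ^- k.-1 * (c0 * (e + z t)) ^+ k)).
    have ezk : (e + z t) ^+ k = (e + z t) * (e + z t) ^+ k.-1.
      by rewrite {1}kS exprS.
    rewrite exprMn ezk.
    have -> : c0 ^- k * (e + z t) ^- k.-1 *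
      (c0 ^+ k * ((e + z t) * (e + z t) ^+ k.-1)) = e + z t.
      by field; rewrite !gt_eqF ?exprn_gt0.
    by rewrite lerDr ltW.
  apply: ler_wpM2l => //.
  by rewrite mulr_ge0// invr_ge0 exprn_ge0// ltW.
have -> : C * derive1 z t + derive1 z t / W t * (D * (z t + W t)) =
    derive1 z t * (C + D + D * (z t / W t)).
  by field; rewrite gt_eqF.
have -> : D' * (derive1 z t + (e + z t) ^- k.-1 * derive1 z t) =
    derive1 z t * (D' * (1 + (e + z t) ^- k.-1)) by ring.
apply: ler_wpM2l => //.
rewrite (_ : D' = C + D + D * c0 ^- k)//.
have ez0 : 0 <= (e + z t) ^- k.-1.
  by rewrite invr_ge0 exprn_ge0// addr_ge0// ltW.
have cz0 : 0 <= c0 ^- k by rewrite invr_ge0 exprn_ge0// ltW.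
have t1 : D * (z t / W t) <= D * (c0 ^- k * (e + z t) ^- k.-1).
  exact: ler_wpM2l.
apply: (le_trans (lerD (lexx _) t1)).
rewrite mulrDr mulr1.
have CD0 : 0 <= C + D by rewrite addr_ge0// ltW.
have Dc0 : 0 <= D * c0 ^- k by exact: mulr_ge0.
have q0 : 0 <= (C + D) * (e + z t) ^- k.-1 by exact: mulr_ge0.
rewrite [(C + D + D * c0 ^- k) * _]mulrDl.
have -> : D * (c0 ^- k * (e + z t) ^- k.-1) = D * c0 ^- k * (e + z t) ^- k.-1.
  by rewrite mulrA.
lra.
Qed.

(** [X] bounds the integral of the error [(e + x) ^- k.-1]; both it and the
    primitive [G] are composed with the height and compared with the length at
    each time. *)
Lemma length_dist (G X X' : R -> R) : G 0 = 0 ->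
  (forall Z : R, 0 <= Z -> is_derive Z 1 G (profile_integrand w k phi Z)) ->
  (forall x : R, 0 <= x -> is_derive x 1 X (X' x)) ->
  (forall x : R, 0 <= x -> (e + x) ^- k.-1 <= X' x) ->
  `|\int[lebesgue_measure]_(t in `[0, T]) l t
      - e ^- k.-1 * (cos phi * G (z0 / e))| <=
    length_constant k C c0 kap * (z0 + X z0 - X 0).
Proof.
rewrite -/D'.
move=> G0 dG dX X'le.
have cz t : 0 <= t <= T -> 0 <= z t.
  move=> tT; have /andP[t0 _] := tT.
  by have /andP[] := rising_range (all_rising tT) (introT andP (conj t0 (lexx t))).
pose F (t : R) := e ^- k.-1 * (cos phi * G (z t / e)).
pose E (t : R) := D' * (z t + X (z t)).
have dF (t : R) : 0 <= t <= T -> is_derive t 1 F (e ^- k.-1 * (cos phi *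
    (profile_integrand w k phi (z t / e) * (derive1 z t / e)))).
  move=> tT; have dz := rm_is_derive mot tT.
  have d1 : is_derive t 1 (fun s => e^-1 * z s) (e^-1 * derive1 z t).
    exact: (is_deriveZ e^-1 dz).
  have {}d1 : is_derive t 1 (fun s => z s / e) (derive1 z t / e).
    rewrite mulrC (_ : (fun s => z s / e) = (fun s => e^-1 * z s))//.
    by apply/funext => s; rewrite mulrC.
  have ze : 0 <= z t / e by rewrite divr_ge0 ?cz// ltW.
  have d2 := @is_derive1_comp R G (fun s => z s / e) t _ _ (dG _ ze) d1.
  exact: (is_deriveZ (e ^- k.-1) (is_deriveZ (cos phi) d2)).
have dE (t : R) : 0 <= t <= T -> is_derive t 1 E
    (D' * (derive1 z t + X' (z t) * derive1 z t)).
  move=> tT; have dz := rm_is_derive mot tT.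
  have d2 := @is_derive1_comp R X z t _ _ (dX _ (cz t tT)) dz.
  exact: (is_deriveZ D' (is_deriveD dz d2)).
have cl (t : R) : 0 <= t <= T -> {for t, continuous l}.
  move=> tT; have /andP[t0 _] := tT; apply: (rm_speed_continuous mot tT).
  exact: (range_r1 (rising_range (all_rising tT) (introT andP (conj t0 (lexx t))))).
have := integral_compare (rm_T mot) cl dF dE.
rewrite /F /E (rm_start mot) (rm_end mot) mul0r G0 !mulr0 subr0 add0r.
rewrite -mulrBr; apply => t tT.
apply: (le_trans (speed_dist tT)); apply: ler_wpM2l.
  by apply: length_constant_ge0; exact: ltW.
rewrite lerD2l; apply: ler_wpM2r; first exact/ltW/slope_gt0.
exact/X'le/cz.
Qed.

End motion.

Lemma compact_cos_bound (R : realType) (K : set R) : compact K ->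
  K `<=` `]0, pi / 2] ->
  exists kap : R, 0 <= kap < 1 /\ forall phi, K phi -> 0 <= cos phi <= kap.
Proof.
move=> Kc Ksub.
have range phi : K phi -> 0 < phi <= pi / 2.
  by move=> /Ksub /=; rewrite in_itv.
have pi0 := pi_gt0 R.
have cge0 phi : K phi -> 0 <= cos phi.
  move=> /range /andP[p0 p1]; apply: cos_ge0_pihalf; apply/andP; split => //.
  by lra.
have [Kn|K0] := pselect (K !=set0); last first.
  exists 0; split; first by rewrite lexx ltr01.
  by move=> phi Kphi; case: K0; exists phi.
have cc : {within K, continuous (@cos R)}.
  by apply: continuous_subspaceT => x; exact: continuous_cos.
have [c /set_mem Kcc cmax] := compact_EVT_max Kn Kc cc.
exists (cos c); split.
  rewrite cge0//= -[ltRHS]cos0 ltr_cos; first by case/andP: (range _ Kcc).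
  - by rewrite in_itv/=; have := range _ Kcc; lra.
  - by rewrite in_itv/=; have := range _ Kcc; lra.
by move=> phi Kphi; rewrite cge0//= cmax// inE.
Qed.

(** The error at height [x] is of the order of [(e + x) ^- k.-1], whose integral
    is a logarithm exactly when [k = 2]. *)
Lemma weight_primitive (R : realType) (k : nat) (e z0 : R) : (2 <= k)%N ->
  0 < e -> 0 < z0 -> e + z0 <= 1 -> exists X X' : R -> R,
  [/\ forall x : R, 0 <= x -> is_derive x 1 X (X' x),
      forall x : R, 0 <= x -> (e + x) ^- k.-1 <= X' x &
      e ^+ k.-1 * (X z0 - X 0) <= if (2 < k)%N then e else e * `|ln e|].
Proof.
move=> hk e0 z00 ez1.
have pos (x : R) : 0 <= x -> 0 < e + x by move=> x0; rewrite ltr_pwDl.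
case: ltnP => [k3|k2].
  have [n ->] : exists n, k = n.+3 by exists (k - 3)%N; rewrite -addn3 subnK.
  exists (fun x => e ^- n * - (e + x)^-1), (fun x => e ^- n * (e + x) ^- 2).
  have en : 0 < e ^+ n by exact: exprn_gt0.
  split => [x x0|x x0|].
  - exact: (is_deriveZ (e ^- n) (is_derive_inv_shift (pos x x0))).
  - rewrite /= exprS exprS -invfM lef_pV2 ?posrE ?mulr_gt0 ?exprn_gt0 ?pos//.
    have -> : (e + x) * ((e + x) * (e + x) ^+ n) = (e + x) ^+ n * (e + x) ^+ 2.
      by ring.
    apply: ler_wpM2r; first exact: sqr_ge0.
    by apply: lerXn2r; rewrite ?nnegrE ?lerDl ?(ltW e0)//; exact/ltW/pos.
  - rewrite /= addr0 exprS exprS.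
    have -> : e * (e * e ^+ n) * (e ^- n * - (e + z0)^-1 - e ^- n * - e^-1) =
        e - e ^+ 2 / (e + z0).
      by field; rewrite !gt_eqF// pos// ltW.
    by rewrite gerBl divr_ge0 ?sqr_ge0// ltW// pos// ltW.
have -> : k = 2%N by apply/eqP; rewrite eqn_leq k2.
exists (fun x => ln (e + x)), (fun x => (e + x)^-1); split => [x x0|x x0|].
- have d1 : is_derive x 1 (fun t : R => e + t) 1.
    by have := is_deriveD (is_derive_cst e x 1) (is_derive_id x 1); rewrite add0r.
  have := @is_derive1_comp R (@ln R) (fun t => e + t) x _ _
    (is_derive1_ln (pos x x0)) d1.
  by rewrite mulr1.
- by rewrite expr1.
- rewrite /= addr0 expr1 ler_pM2l//.
  have l1 : ln (e + z0) <= 0 by rewrite -ln1 ler_ln ?posrE// pos// ltW.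
  have := ler_norm (- ln e); rewrite normrN; lra.
Qed.

(** To [length_dist] one adds the tail of [Cphi] beyond [z0 / e], which is of
    order [e / z0]. *)
Lemma reduced_length (R : realType) (w : R -> R -> R) (hw : scaling_function w)
    (k : nat) (hk : (2 <= k)%N) (C r1 : R) : 0 < C -> 0 < r1 ->
  exists z1 : R, 0 < z1 <= r1 /\ forall z0 : R, 0 < z0 < z1 ->
  forall K : set R, compact K -> K `<=` `]0, pi / 2] ->
  exists B e1 : R, 0 < e1 <= r1 /\
    forall (e phi T : R) (z N l : R -> R), 0 < e < e1 -> K phi ->
      reduced_motion w k C r1 e phi z0 T z N l ->
      exists Rem : R,
        \int[lebesgue_measure]_(t in `[0, T]) l t
          = (e ^+ k.-1)^-1 * (Cphi w k phi * cos phi + Rem) /\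
        `|Rem| <= B * (if (2 < k)%N then e else e * `|ln e|).
Proof.
move=> C0 r10.
have [c0 [c1 [c00 _ prof]]] := profile_linear hw.
have {}prof (Z : R) : 0 <= Z -> c0 * (1 + Z) <= w 1 Z.
  by move=> /prof /andP[].
(* [z0 <= 1 / 2] makes [e + z0 <= 1] in [weight_primitive]. *)
exists (Num.min r1 (Num.min (4 * C)^-1 (1 / 2))); split.
  by rewrite !lt_min r10 invr_gt0 mulr_gt0//= ge_min lexx divr_gt0.
move=> z0; rewrite !lt_min => /and4P[z00 z0r z0C z02] K Kc Ksub.
have [kap [/andP[kap0 kap1] Kcos]] := compact_cos_bound Kc Ksub.
have kap2 : kap ^+ 2 < 1 by rewrite expr_lt1.
pose D1 := length_constant k C c0 kap.
pose D2 := (c0 ^+ 2 * Num.sqrt (1 - kap ^+ 2))^-1.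
have D10 : 0 <= D1 by apply: length_constant_ge0; exact: ltW.
have D20 : 0 <= D2 by rewrite invr_ge0 mulr_ge0 ?sqrtr_ge0// sqr_ge0.
(* [e <= expR (-1)] makes [|ln e| >= 1], so that [e] itself is a legitimate
   error when [k = 2]. *)
pose ea : R := Num.min (1 / 2) (expR (-1)).
have C8 : 0 < 8 * C by exact: mulr_gt0.
exists (2 * D1 + D2 / z0), (Num.min r1 (Num.min ea (c0 * (1 - kap) / (8 * C)))).
split.
  rewrite !lt_min r10 divr_gt0//= ?expR_gt0 ?ge_min ?lexx//.
  by rewrite divr_gt0// mulr_gt0// subr_gt0.
move=> e phi T z N l /andP[e0]; rewrite /ea !lt_min.
move=> /and3P[er /andP[e2 eexp] eC] Kphi mot.
have /andP[cphi0 cphi1] := Kcos _ Kphi.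
have c2 : cos phi ^+ 2 <= kap ^+ 2 by rewrite ler_sqr ?nnegrE.
have c21 := le_lt_trans c2 kap2.
have [G [G0 dG]] := profile_primitive hw k c21.
have ez1 : e + z0 <= 1 by lra.
have [X [X' [dX X'le Xle]]] := weight_primitive hk e0 z00 ez1.
have kap01 : 0 <= kap < 1 by rewrite kap0.
have z0C' : 4 * C * z0 <= 1.
  by rewrite mulrC -ler_pdivlMr ?mulr_gt0// mul1r ltW.
have eC' : 8 * C * e <= c0 * (1 - kap) by rewrite mulrC -ler_pdivlMr// ltW.
have LD := length_dist hw hk C0 c00 prof kap01 e0 z0r z0C' eC'
  (Kcos _ Kphi) mot G0 dG dX X'le.
rewrite -/D1 in LD.
set I := \int[_]_(_ in _) _ in LD *.
have ze0 : 0 <= z0 / e by rewrite divr_ge0// ltW.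
have decay (Z : R) : z0 / e <= Z ->
    profile_integrand w k phi Z <= D2 * (1 + Z) ^- 2.
  move=> Zge; apply: (profile_integrand_decay hw hk c00 prof).
  - exact: le_trans Zge.
  - by rewrite sqr_ge0.
  - apply: (le_trans c2); rewrite ler_peMr ?sqr_ge0//.
    by rewrite exprn_ege1// profile_ge1.
have /andP[Cge Cle] := Cphi_bounds hw c21 ze0 G0 dG decay D20.
have ek : 0 < e ^+ k.-1 by exact: exprn_gt0.
exists (e ^+ k.-1 * I - Cphi w k phi * cos phi); split.
  by rewrite addrC subrK mulrA mulVf ?gt_eqF// mul1r.
set wt := if _ then _ else _ in Xle *.
have ewt : e <= wt.
  rewrite /wt; case: ifP => // _; rewrite ler_peMr ?(ltW e0)//.
  have : ln e <= -1 by rewrite -[leRHS]expRK ler_ln ?posrE ?expR_gt0// ltW.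
  by have := ler_norm (- ln e); rewrite normrN; lra.
have eke : e ^+ k.-1 <= e.
  rewrite -[leRHS]expr1; apply: ler_wiXn2l; rewrite ?(ltW e0)//; first by lra.
  by rewrite -ltnS prednK// (leq_trans _ hk).
have E : e ^+ k.-1 * I - Cphi w k phi * cos phi =
    e ^+ k.-1 * (I - e ^- k.-1 * (cos phi * G (z0 / e)))
    - cos phi * (Cphi w k phi - G (z0 / e)).
  by field; rewrite gt_eqF.
rewrite E; apply: (le_trans (ler_normB _ _)); rewrite mulrDl; apply: lerD.
  rewrite normrM (gtr0_norm ek).
  apply: (le_trans (y := e ^+ k.-1 * (D1 * (z0 + X z0 - X 0)))).
    by apply: ler_wpM2l => //; exact: ltW.
  have -> : e ^+ k.-1 * (D1 * (z0 + X z0 - X 0)) =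
    D1 * (e ^+ k.-1 * z0 + e ^+ k.-1 * (X z0 - X 0)) by ring.
  rewrite [2 * D1]mulrC -mulrA; apply: ler_wpM2l => //.
  have : e ^+ k.-1 * z0 <= e * 1.
    by apply: (ler_pM (ltW ek) (ltW z00) eke); lra.
  by lra.
have G1 : 0 <= Cphi w k phi - G (z0 / e) by rewrite subr_ge0.
rewrite normrM (ger0_norm cphi0) (ger0_norm G1).
apply: (le_trans (y := 1 * (D2 / (1 + z0 / e)))).
  by apply: (ler_pM cphi0 G1 (cos_le1 phi)); rewrite lerBlDl.
rewrite mul1r -[leRHS]mulrA; apply: ler_wpM2l => //.
apply: (le_trans (y := z0^-1 * e)); last first.
  by apply: ler_wpM2l => //; rewrite invr_ge0 ltW.
have -> : z0^-1 * e = (z0 / e)^-1 by rewrite invfM invrK mulrC.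
by rewrite lef_pV2 ?posrE ?ltr_pwDl ?divr_gt0// lerDr.
Qed.

(** * Functions vanishing to finite order *)

Lemma derive1nSr (R : realType) (V : normedModType R) (n : nat) (g : R -> V) :
  derive1n n.+1 g = derive1n n (derive1 g).
Proof. exact: iterSr. Qed.

Lemma derivable_pair_slice (R : realType) (U V W : normedModType R)
    (G : U * V -> W) (z : U) (x v : V) :
  derivable G (z, x) (0, v) -> derivable (fun x' => G (z, x')) x v.
Proof.
rewrite /derivable; set d := (fun _ : R => _); set d' := (fun _ : R => _).
suff -> : d = d' by [].
apply/funext => t; rewrite /d /d' /= /shift/=; congr (_ *: (G _ - _)).
by apply: injective_projections => //=; rewrite scaler0 add0r.
Qed.

(** The iterated derivatives of a slice are slices of iterated directional
    derivatives. *)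
Lemma slice_Cn_derivable (R : realType) (U : normedModType R) (n : nat)
    (O : set (U * R)) (F : U * R -> R) (g : R -> R) (a : U) : open O -> Cn n O F ->
  (forall x, O (a, x) -> g x = F (a, x)) ->
  forall j x, (j < n)%N -> O (a, x) -> derivable (derive1n j g) x 1.
Proof.
move=> oO; elim: n F g => [//|n IH] F g CF gF j x jn Ox.
have near_g y : O (a, y) -> \forall t \near y, g t = F (a, t).
  move=> Oy.
  have nO : \forall p \near (a, y), O p by exact: open_nbhs_nbhs.
  have cp : {for y, continuous (fun t : R => (a, t))}.
    by apply: differentiable_continuous; exact: differentiable_pair.
  have nt : \forall t \near y, O (a, t) by exact: (cp _ nO).
  by apply: filterS nt => t Ot; exact: gF.
have [dF CF'] := CF.2 (0, 1).
have dg y : O (a, y) -> derivable g y 1.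
  move=> Oy; apply: (near_eq_derivable (f := fun t => F (a, t))).
  - by apply: filterS (near_g y Oy) => t ->.
  - exact: derivable_pair_slice (dF _ Oy).
case: j jn => [_|j jn]; first exact: dg.
rewrite derive1nSr; apply: (IH (fun p => 'D_(0, 1) F p)) => // y Oy.
rewrite derive1E derive_slice; apply: near_eq_derive.
exact: near_g.
Qed.

Lemma profile_derivable1n (R : realType) (w : R -> R -> R)
    (hw : scaling_function w) (j : nat) (z : R) :
  derivable (derive1n j (fun Z => w 1 Z - 1)) z 1.
Proof.
have [_ [sw _] _ _ _] := hw.
have [|U [F [oU Uq CF E]]] := sw (1, z).
  by split => //=; case=> /eqP; rewrite oner_eq0.
have d1 i y : U (1, y) -> derivable (derive1n i (w 1)) y 1.
  apply: (slice_Cn_derivable oU (CF i.+1)) => // x Ux; rewrite E//.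
  by split => //=; case=> /eqP; rewrite oner_eq0.
case: j => [|j].
  by apply: derivableB; [exact: (d1 0%N)|exact: derivable_cst].
rewrite derive1nSr.
have -> : derive1 (fun Z => w 1 Z - 1) = derive1 (w 1).
  apply/funext => x; rewrite !derive1E.
  have dw : derivable (w 1) x 1.
    by apply: diff_derivable; exact: scaling_differentiable.
  have dc : derivable (cst (1 : R)) x 1 by exact: derivable_cst.
  have := deriveB dw dc; rewrite derive_cst subr0; exact.
by rewrite -derive1nSr; exact: d1.
Qed.

(** Taylor's formula with the weakest remainder, by integrating [n] times. *)
Lemma vanishing_sandwich (R : realType) (n : nat) (g : R -> R) :
  (forall j (z : R), (j <= n)%N -> derivable (derive1n j g) z 1) ->
  (forall j, (j < n)%N -> derive1n j g 0 = 0) ->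
  forall eta : R, 0 < eta -> exists d : R, 0 < d /\ forall Z : R, 0 <= Z <= d ->
    (derive1n n g 0 - eta) * Z ^+ n <= n`!%:R * g Z
      <= (derive1n n g 0 + eta) * Z ^+ n.
Proof.
elim: n g => [|n IH] g dg g0 eta eta0.
  have cg : {for (0 : R), continuous g}.
    by apply: differentiable_continuous; apply/derivable1_diffP; exact: (dg 0%N).
  have /nbhs_normP[d /= d0 H] : \forall x \near (0 : R), `|g 0 - g x| <= eta.
    by move/cvgr_dist_le : cg; apply.
  exists (d / 2); split; first by rewrite divr_gt0.
  move=> Z /andP[Z0 Zd]; rewrite expr0 !mulr1 mul1r /=.
  have : `|g 0 - g Z| <= eta.
    by apply: H => /=; rewrite sub0r normrN ger0_norm//; lra.
  by rewrite ler_norml => /andP[H1 H2]; apply/andP; split; lra.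
have dg' : forall j (z : R), (j <= n)%N -> derivable (derive1n j (derive1 g)) z 1.
  by move=> j z jn; rewrite -derive1nSr; exact: dg.
have g0' : forall j, (j < n)%N -> derive1n j (derive1 g) 0 = 0.
  by move=> j jn; rewrite -derive1nSr; exact: g0.
have [d [d0 H]] := IH _ dg' g0' eta eta0.
rewrite -derive1nSr in H; set c := derive1n n.+1 g 0 in H *.
have G0 : g 0 = 0 by exact: (g0 0%N).
have D1 (x : R) : is_derive x 1 g (derive1 g x).
  by rewrite derive1E; apply: derivableP; exact: (dg 0%N).
have Dg (x : R) : is_derive x 1 (fun t => n.+1`!%:R * g t) (n.+1`!%:R * derive1 g x).
  exact: (is_deriveZ n.+1`!%:R (D1 x)).
have Dp (b x : R) : is_derive x 1 (fun t => b * t ^+ n.+1) (b * (n.+1%:R * x ^+ n)).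
  have := is_deriveZ b (is_deriveX n.+1 (is_derive_id x (1 : R))).
  rewrite /= [(_ * _)%:A]mulr1.
  suff -> : b \*: id ^+ n.+1 = (fun t => b * t ^+ n.+1) by [].
  by apply/funext => t; rewrite /= exprfctE.
exists d; split => // Z /andP[Z0 Zd].
have bound (b x : R) : n.+1`!%:R * derive1 g x - b * (n.+1%:R * x ^+ n) =
    n.+1%:R * (n`!%:R * derive1 g x - b * x ^+ n).
  by rewrite factS natrM; ring.
have pw : (0 : R) ^+ n.+1 = 0 by rewrite expr0n.
have cont (F F' : R -> R) : (forall t : R, is_derive t 1 F (F' t)) ->
    {within `[0, Z], continuous F}.
  by move=> dF; apply: within_continuous_of => t _; exact: is_derive_continuous (dF t).
apply/andP; split; rewrite -subr_ge0.
- have := @le_increment R _ _ _ _ 0 Z Z0 (fun t _ => Dp (c - eta) t)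
    (fun t _ => Dg t) (cont _ _ (Dp _)) (cont _ _ Dg).
  rewrite pw G0 !mulr0 !subr0 subr_ge0; apply => t /andP[t0 tZ].
  rewrite -subr_ge0 bound mulr_ge0// subr_ge0.
  by have /andP[] := H t (introT andP (conj (ltW t0) (le_trans (ltW tZ) Zd))).
- have := @le_increment R _ _ _ _ 0 Z Z0
    (fun t _ => Dg t) (fun t _ => Dp (c + eta) t) (cont _ _ Dg) (cont _ _ (Dp _)).
  rewrite pw G0 !mulr0 !subr0 subr_ge0; apply => t /andP[t0 tZ].
  rewrite -subr_le0 bound mulr_ge0_le0// subr_le0.
  by have /andP[] := H t (introT andP (conj (ltW t0) (le_trans (ltW tZ) Zd))).
Qed.

(** * The model integral *)

Lemma sin_quotient (R : realType) : sin phi / phi @[phi --> 0^'+] --> (1 : R).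
Proof.
have [d1 d2] := is_derive_sin (0 : R).
have lim1 : h^-1 *: (sin (h *: 1 + 0) - sin 0) @[h --> 0^'] --> (1 : R).
  by rewrite -[X in _ --> X]cos0 -d2; exact: d1.
apply/cvgrPdist_lt => eps eps0.
move/cvgrPdist_lt : lim1 => /(_ _ eps0); rewrite !near_withinE; apply: filterS => h H h0.
have := H (lt0r_neq0 h0).
by rewrite addr0 sin0 subr0 /GRing.scale /= mulr1 mulrC.
Qed.

Section model.
Context (R : realType) (l : nat) (l0 : (0 < l)%N).

(** The rate at which the model integral blows up, and the width of the region
    around the waist where this happens. *)
Definition blowup_rate (phi : R) : R :=
  if (1 < l)%N then phi `^ (- ((l%:R - 1) / l%:R)) else ln phi^-1.

Definition waist_width (phi : R) : R := sin phi `^ l%:R^-1.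

Let lR : 0 < l%:R :> R. Proof. by rewrite ltr0n. Qed.

Let near_sin_lt (a : R) : 0 < a -> \forall phi \near 0^'+, sin phi < a.
Proof.
move=> a0.
have cs : {for (0 : R), continuous sin} by exact: continuous_sin.
have ns : \forall phi \near (0 : R), sin phi < a.
  by apply: (cs [set x : R | x < a]); rewrite sin0; exact: lt_nbhsl.
by rewrite near_withinE; apply: filterS ns => phi H _.
Qed.

Lemma near_angle : \forall phi \near (0 : R)^'+, [/\ 0 < phi, phi < 1 & 0 < sin phi].
Proof.
near=> phi.
have p0 : 0 < phi by near: phi; exact: nbhs_right_gt.
have p1 : phi < 1 by near: phi; apply: nbhs_right_lt; exact: ltr01.
split => //.
apply: sin_gt0_pihalf; rewrite p0 /=; near: phi; apply: nbhs_right_lt.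
by rewrite divr_gt0// pi_gt0.
Unshelve. all: by end_near. Qed.

Lemma waist_width_gt0 (phi : R) : 0 < sin phi -> 0 < waist_width phi.
Proof. exact: powR_gt0. Qed.

Lemma waist_widthX (phi : R) : 0 < sin phi -> waist_width phi ^+ l = sin phi.
Proof.
move=> s0; rewrite -powR_mulrn ?powR_ge0// -powRrM mulVf ?gt_eqF//.
by rewrite powRr1// ltW.
Qed.

Let near_width_lt (a : R) : 0 < a -> \forall phi \near 0^'+, waist_width phi < a.
Proof.
move=> a0; have := near_sin_lt (exprn_gt0 l a0); apply: filterS2 near_angle.
move=> phi [_ _ s0] sa; rewrite ltNge; apply/negP => aw.
have := lerXn2r l (ltW a0) (ltW (waist_width_gt0 s0)) aw.
by rewrite waist_widthX// leNgt sa.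
Qed.

Lemma blowup_rate_gt0 (phi : R) : 0 < phi -> phi < 1 -> 0 < blowup_rate phi.
Proof.
move=> p0 p1; rewrite /blowup_rate; case: ifP => _; first exact: powR_gt0.
by apply: ln_gt0; rewrite invf_gt1.
Qed.

Lemma blowup_rateV : (blowup_rate phi)^-1 @[phi --> 0^'+] --> (0 : R).
Proof.
rewrite /blowup_rate; case: ltnP => [l1|_].
  under eq_fun do rewrite powRN invrK.
  apply: powR_cvg0; apply: divr_gt0 => //.
  by rewrite subr_gt0 ltr1n.
apply/cvgrPdist_lt => eps eps0.
near=> phi.
have p0 : 0 < phi by near: phi; exact: nbhs_right_gt.
have pe : phi < expR (- eps^-1) by near: phi; apply: nbhs_right_lt; exact: expR_gt0.
have L : eps^-1 < ln phi^-1.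
  rewrite lnV ?posrE// ltrNr -[ltRHS]expRK ltr_ln ?posrE//; exact: expR_gt0.
have L0 : 0 < ln phi^-1 by apply: lt_trans L; rewrite invr_gt0.
rewrite sub0r normrN gtr0_norm ?invr_gt0//.
by rewrite -[ltRHS]invrK ltf_pV2 ?posrE ?invr_gt0.
Unshelve. all: by end_near. Qed.

Definition model_integrand (x : R) : R := (Num.sqrt (1 + x ^+ (2 * l)))^-1.

Lemma model_root_gt0 (x : R) : 0 < 1 + x ^+ (2 * l).
Proof. by rewrite ltr_pwDl// mulnC exprM sqr_ge0. Qed.

Let model_gt0 x : 0 < model_integrand x.
Proof. by rewrite invr_gt0 sqrtr_gt0 model_root_gt0. Qed.

Lemma model_primitive : exists J : R -> R, J 0 = 0 /\
  forall x : R, 0 <= x -> is_derive x 1 J (model_integrand x).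
Proof.
apply: antiderivative => x.
have c1 : {for x, continuous (fun t : R => 1 + t ^+ (2 * l))}.
  by apply: cvgD; [exact: cvg_cst|exact: exprn_continuous].
have c2 : {for x, continuous (fun t : R => Num.sqrt (1 + t ^+ (2 * l)))}.
  by apply: (continuous_comp c1); exact: sqrt_continuous.
have nz : Num.sqrt (1 + x ^+ (2 * l)) != 0.
  by rewrite gt_eqF// sqrtr_gt0 model_root_gt0.
exact: (cvgV nz c2).
Qed.

Context (J : R -> R) (J0 : J 0 = 0)
  (dJ : forall x : R, 0 <= x -> is_derive x 1 J (model_integrand x)).

Let J_increment (E E' : R -> R) (a b : R) : 0 <= a -> a <= b ->
  (forall x : R, a <= x -> is_derive x 1 E (E' x)) ->
  (forall x : R, a <= x -> model_integrand x <= E' x) -> J b - J a <= E b - E a.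
Proof.
move=> a0 ab dE le'; apply: (@le_increment R _ _ model_integrand E') => //.
- by move=> t /andP[/ltW xt _]; apply: dJ; exact: le_trans xt.
- by move=> t /andP[/ltW xt _]; exact: dE.
- apply: within_continuous_of => t /andP[xt _].
  exact: is_derive_continuous (dJ (le_trans a0 xt)).
- apply: within_continuous_of => t /andP[xt _].
  exact: is_derive_continuous (dE t xt).
- by move=> t /andP[/ltW xt _]; exact: le'.
Qed.

Let J_decrement (E E' : R -> R) (a b : R) : 0 <= a -> a <= b ->
  (forall x : R, a <= x -> is_derive x 1 E (E' x)) ->
  (forall x : R, a <= x -> E' x <= model_integrand x) -> E b - E a <= J b - J a.
Proof.
move=> a0 ab dE le'; apply: (@le_increment R _ _ E' model_integrand) => //.
- by move=> t /andP[/ltW xt _]; exact: dE.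
- by move=> t /andP[/ltW xt _]; apply: dJ; exact: le_trans xt.
- apply: within_continuous_of => t /andP[xt _].
  exact: is_derive_continuous (dE t xt).
- apply: within_continuous_of => t /andP[xt _].
  exact: is_derive_continuous (dJ (le_trans a0 xt)).
- by move=> t /andP[/ltW xt _]; exact: le'.
Qed.

Let J_le (a b : R) : 0 <= a -> a <= b -> J a <= J b.
Proof.
move=> a0 ab; rewrite -subr_ge0.
have -> : 0 = cst 0 b - cst 0 a :> R by rewrite subrr.
apply: (J_decrement (E := cst 0) (E' := fun=> 0)) => // x _.
exact: ltW.
Qed.

Let J_bounded : (1 < l)%N -> forall x : R, 0 <= x -> J x <= 4.
Proof.
move=> l1 x x0; rewrite -[leLHS]subr0 -J0.
have dE (t : R) : 0 <= t -> is_derive t 1 (fun t => 4 * - (1 + t)^-1)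
    (4 * (1 + t) ^- 2).
  by move=> t0; apply: (is_deriveZ (4 : R)); apply: is_derive_inv_shift;
    rewrite ltr_pwDl.
have le' (t : R) : 0 <= t -> model_integrand t <= 4 * (1 + t) ^- 2.
  move=> t0; have t1 : 0 < 1 + t by rewrite ltr_pwDl.
  have s0 : 0 < Num.sqrt (1 + t ^+ (2 * l)) by rewrite sqrtr_gt0 model_root_gt0.
  rewrite ler_pdivlMr ?exprn_gt0// mulrC ler_pdivrMr//.
  have e0 : 0 <= t ^+ (2 * l) by exact: exprn_ge0.
  have s1 : 1 <= Num.sqrt (1 + t ^+ (2 * l)).
    by rewrite -[leLHS]sqrtr1 ler_wsqrtr// lerDl.
  have [t_1|t_1] := leP t 1; first by nra.
  have t4 : t ^+ 4 <= t ^+ (2 * l).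
    by apply: ler_weXn2l; [exact: ltW|rewrite (_ : 4 = 2 * 2)%N// leq_mul2l].
  have s2 : t ^+ 2 <= Num.sqrt (1 + t ^+ (2 * l)).
    rewrite -[leLHS]ger0_norm ?sqr_ge0// -sqrtr_sqr; apply: ler_wsqrtr.
    by rewrite -exprM; lra.
  by nra.
have := J_increment (lexx 0) x0 dE le'; rewrite addr0 invr1.
have : 0 <= (1 + x)^-1 by rewrite invr_ge0 addr_ge0.
by lra.
Qed.

(** For [l = 1] the model integral is the inverse hyperbolic sine. *)
Let J_log : l = 1%N -> forall x : R, 1 <= x -> ln x <= J x <= 1 + ln x.
Proof.
move=> l1 x x1; have x0 : 0 < x by lra.
have root (t : R) : model_integrand t = (Num.sqrt (1 + t ^+ 2))^-1.
  by rewrite /model_integrand l1 muln1.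
apply/andP; split.
  have dE (t : R) : 0 <= t -> is_derive t 1 (fun t => ln (1 + t)) (1 + t)^-1.
    move=> t0.
    have d1 : is_derive t 1 (fun s : R => 1 + s) 1.
      by have := is_deriveD (is_derive_cst (1 : R) t (1 : R)) (is_derive_id t (1 : R));
        rewrite add0r.
    have tp : 0 < 1 + t by rewrite ltr_pwDl.
    have := @is_derive1_comp R (@ln R) (fun s => 1 + s) t _ _
      (is_derive1_ln tp) d1.
    by rewrite mulr1.
  have le' (t : R) : 0 <= t -> (1 + t)^-1 <= model_integrand t.
    move=> t0; rewrite root lef_pV2 ?posrE ?ltr_pwDl//; last first.
      by rewrite sqrtr_gt0 ltr_pwDl// sqr_ge0.
    rewrite -[leRHS]ger0_norm ?addr_ge0// -sqrtr_sqr; apply: ler_wsqrtr.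
    by nra.
  have := J_decrement (lexx 0) (ltW x0) dE le'.
  rewrite J0 addr0 ln1 !subr0; apply: le_trans.
  by rewrite ler_ln ?posrE; lra.
have D1 : J 1 - J 0 <= 1.
  rewrite -[leRHS]subr0.
  apply: (J_increment (E := id) (E' := fun=> 1)) => // t _.
  rewrite root invf_le1 ?sqrtr_gt0 ?ltr_pwDl ?sqr_ge0//.
  by rewrite -[leLHS]sqrtr1 ler_wsqrtr// lerDl sqr_ge0.
have D2 : J x - J 1 <= ln x - ln 1.
  apply: (J_increment (E' := fun t => t^-1)) => // t t1.
    by apply: is_derive1_ln; lra.
  have t0 : 0 < t by lra.
  rewrite root lef_pV2 ?posrE ?sqrtr_gt0 ?ltr_pwDl ?sqr_ge0//.
  by rewrite -[leLHS]gtr0_norm// -sqrtr_sqr ler_wsqrtr// lerDr.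
by move: D1 D2; rewrite J0 ln1; lra.
Qed.

(** Here the model integral converges at infinity, and [waist_width / sin] has the
   asserted power of [phi]. *)
Let model_limit_power : (1 < l)%N -> exists c : R, 0 < c /\ forall x : R, 0 < x ->
  waist_width phi / sin phi * J (x / waist_width phi) / blowup_rate phi
    @[phi --> 0^'+] --> c.
Proof.
move=> l1.
pose A := [set J x | x in [set x : R | 0 <= x]].
have supA : has_sup A.
  split; first by exists (J 0), 0 => /=.
  by exists 4 => _ [x /= x0 <-]; exact: J_bounded.
have Ale x : 0 <= x -> J x <= sup A.
  by move=> x0; apply: sup_upper_bound => //; exists x.
have J1 : 0 < J 1.
  rewrite -[ltRHS]subr0 -[X in _ - X]J0.
  have h : 0 < model_integrand 1 := model_gt0 1.
  have dE (t : R) : 0 <= t ->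
      is_derive t 1 (fun t => model_integrand 1 * t) (model_integrand 1 * 1).
    by move=> _; exact: (is_deriveZ (model_integrand 1) (is_derive_id t (1 : R))).
  have : model_integrand 1 * 1 - model_integrand 1 * 0 <= J 1 - J 0.
    apply: (@le_increment R (fun t => model_integrand 1 * t) J
      (fun=> model_integrand 1 * 1) model_integrand) => //.
    - by move=> t /andP[/ltW t0 _]; exact: dJ.
    - apply: within_continuous_of => t /andP[t0 _].
      exact: is_derive_continuous (dE t t0).
    - apply: within_continuous_of => t /andP[t0 _].
      exact: is_derive_continuous (dJ t0).
    - move=> t /andP[t0 t_1]; rewrite mulr1.
      rewrite lef_pV2 ?posrE ?sqrtr_gt0 ?model_root_gt0//.
      rewrite ler_wsqrtr// lerD2l expr1n.
      by apply: exprn_ile1; exact: ltW.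
  by apply: lt_le_trans; rewrite mulr0 subr0 mulr1.
exists (sup A); split; first exact: lt_le_trans (Ale 1 ler01).
move=> x x0; pose r : R := - ((l%:R - 1) / l%:R).
have cJ : J (x / waist_width phi) @[phi --> 0^'+] --> sup A.
  apply/cvgrPdist_lt => eps eps0.
  have [_ [y /= y0 <-] Jy] := sup_adherent eps0 supA.
  have y1 : 0 < y + 1 by rewrite ltr_wpDl.
  near=> phi.
  have [_ _ s0] : [/\ 0 < phi, phi < 1 & 0 < sin phi].
    by near: phi; exact: near_angle.
  have ws : waist_width phi < x / (y + 1).
    by near: phi; apply: near_width_lt; exact: divr_gt0.
  have w0 := waist_width_gt0 s0.
  have yx : y <= x / waist_width phi.
    rewrite ler_pdivlMr// mulrC.
    have : waist_width phi * (y + 1) < x by rewrite -ltr_pdivlMr.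
    by lra.
  have J2 := J_le y0 yx; have J3 := Ale _ (le_trans y0 yx).
  by rewrite ger0_norm ?subr_ge0//; lra.
have cr : (sin phi / phi) `^ r @[phi --> 0^'+] --> (1 : R).
  have -> : (1 : R) = 1 `^ r by rewrite powR1.
  apply: (@cvg_comp _ _ _ (fun phi : R => sin phi / phi) (fun t => t `^ r)
    _ _ _ (@sin_quotient R)).
  exact: is_derive_continuous (is_derive1_powR r ltr01).
have H : (sin phi / phi) `^ r * J (x / waist_width phi) @[phi --> 0^'+] --> sup A.
  by rewrite -[X in _ --> X]mul1r; exact: (cvgM cr cJ).
apply: cvg_trans H; apply: near_eq_cvg.
near=> phi.
have [p0 _ s0] : [/\ 0 < phi, phi < 1 & 0 < sin phi].
  by near: phi; exact: near_angle.
rewrite /blowup_rate l1 -/r /waist_width.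
have -> : sin phi `^ l%:R^-1 / sin phi = sin phi `^ r.
  have -> : r = l%:R^-1 - 1 by rewrite /r; field; rewrite gt_eqF.
  have nz : (l%:R^-1 == 1 :> R) ==> (sin phi != 0).
    by apply/implyP => _; exact: lt0r_neq0.
  by rewrite (powRB nz) powRr1// ltW.
have E : (sin phi / phi) `^ r = sin phi `^ r / phi `^ r.
  apply: (mulIf (x := phi `^ r)); first by rewrite gt_eqF// powR_gt0.
  rewrite divfK ?gt_eqF ?powR_gt0// -powRM ?divr_ge0 ?(ltW s0) ?(ltW p0)//.
  by rewrite divfK// gt_eqF.
by rewrite E mulrAC.
Unshelve. all: by end_near. Qed.

(** Up to a bounded term the integral is [- ln (sin phi)]. *)
Let model_limit_log : l = 1%N -> forall x : R, 0 < x ->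
  waist_width phi / sin phi * J (x / waist_width phi) / blowup_rate phi
    @[phi --> 0^'+] --> (1 : R).
Proof.
move=> l1 x x0; pose M : R := 1 + `|ln x| + ln 2.
have cM (s : R) : 1 + s * (M * (blowup_rate phi)^-1) @[phi --> 0^'+] --> (1 : R).
  rewrite -[X in _ --> X](_ : 1 + s * (M * 0) = 1); last by rewrite !mulr0 addr0.
  have H : M * (blowup_rate phi)^-1 @[phi --> 0^'+] --> M * 0.
    by apply: cvgM; [exact: cvg_cst|exact: blowup_rateV].
  by apply: cvgD; [exact: cvg_cst|apply: cvgM => //; exact: cvg_cst].
apply: (squeeze_cvgr _ (cM (-1)) (cM 1)).
near=> phi.
have [p0 p1 s0] : [/\ 0 < phi, phi < 1 & 0 < sin phi].
  by near: phi; exact: near_angle.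
have q1 : sin phi / phi < 2.
  by near: phi; apply: cvgr_lt (@sin_quotient R) _ _; lra.
have q2 : 2^-1 < sin phi / phi.
  by near: phi; apply: cvgr_gt (@sin_quotient R) _ _; lra.
have sx : sin phi < x by near: phi; exact: near_sin_lt.
have L0 := blowup_rate_gt0 p0 p1.
have wE : waist_width phi = sin phi.
  by rewrite /waist_width l1 invr1 powRr1// ltW.
rewrite wE divff ?gt_eqF//.
have xs : 1 <= x / sin phi by rewrite ler_pdivlMr// mul1r ltW.
have /andP[j1 j2] := J_log l1 xs.
have LE : blowup_rate phi = - ln phi.
  by rewrite /blowup_rate l1 lnV.
have q0 : 0 < sin phi / phi by exact: divr_gt0.
have lE : ln (x / sin phi) = ln x - (ln (sin phi / phi) - blowup_rate phi).
  rewrite LE opprK [in RHS]ln_div ?posrE// subrK.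
  by rewrite ln_div.
have l2 : ln (sin phi / phi) <= ln 2 by rewrite ler_ln ?posrE// ltW.
have l3 : - ln 2 <= ln (sin phi / phi).
  by rewrite -lnV ?posrE// ler_ln ?posrE ?invr_gt0// ltW.
have l4 := ler_norm (ln x); have l5 := ler_norm (- ln x).
rewrite normrN in l5.
have EM (s : R) : 1 + s * (M * (blowup_rate phi)^-1) =
    (blowup_rate phi + s * M) / blowup_rate phi.
  by field; rewrite gt_eqF.
rewrite !EM !mul1r; apply/andP; split.
  by rewrite ler_pM2r ?invr_gt0//; rewrite /M; lra.
by rewrite ler_pM2r ?invr_gt0//; rewrite /M; lra.
Unshelve. all: by end_near. Qed.

Lemma model_limit : exists c : R, 0 < c /\ forall x : R, 0 < x ->
  waist_width phi / sin phi * J (x / waist_width phi) / blowup_rate phi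
    @[phi --> 0^'+] --> c.
Proof.
have := l0; rewrite leq_eqVlt => /predU1P[l1|]; last exact: model_limit_power.
by exists 1; split=> //; exact: (model_limit_log (esym l1)).
Qed.

End model.

(** * Asymptotics at small angles *)

Lemma exprn_sub1_bounds (R : realType) (x : R) (m : nat) : 1 <= x ->
  m%:R * (x - 1) <= x ^+ m - 1 <= m%:R * x ^+ m * (x - 1).
Proof.
move=> x1; elim: m => [|m /andP[IH1 IH2]].
  by rewrite expr0 subrr !mul0r lexx.
have xm : 1 <= x ^+ m by exact: exprn_ege1.
have xm0 : 0 <= m%:R * (x - 1) by rewrite mulr_ge0// subr_ge0.
have x0 : 0 <= x - 1 by rewrite subr_ge0.
rewrite exprS -natr1; apply/andP; split; first by nra.
have h1 : x * (x ^+ m - 1) <= x * (m%:R * x ^+ m * (x - 1)).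
  by apply: ler_wpM2l => //; lra.
have h2 : x - 1 <= x * x ^+ m * (x - 1).
  by rewrite -exprS ler_peMl// exprn_ege1.
by lra.
Qed.

Section asymptotics.
Context (R : realType) (w : R -> R -> R) (hw : scaling_function w) (k : nat)
  (hk : (2 <= k)%N) (l : nat) (l0 : (0 < l)%N).

Let f := w 1.
Let f_ge1 (Z : R) : 1 <= f Z. Proof. exact: profile_ge1. Qed.

(** The leading term of [f ^ 2k - 1] at the waist. *)
Lemma profile_sandwich : vanishes_to_order (fun Z => w 1 Z - 1) 0 (2 * l) ->
  exists alpha : R, 0 < alpha /\ forall eta : R, 0 < eta < 1 ->
  exists d : R, 0 < d /\ forall Z : R, 0 <= Z <= d ->
    [/\ (alpha * (1 - eta) * Z) ^+ (2 * l) <= f Z ^+ (2 * k) - 1,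
        f Z ^+ (2 * k) - 1 <= (alpha * (1 + eta) * Z) ^+ (2 * l) &
        f Z ^+ k <= 1 + eta].
Proof.
set n := (2 * l)%N => -[g0 gn].
have n0 : (0 < n)%N by rewrite muln_gt0.
set g := (fun Z => w 1 Z - 1) in g0 gn *.
have gE (Z : R) : g Z = f Z - 1 by [].
have g_ge0 (Z : R) : 0 <= g Z by rewrite gE subr_ge0.
have dg j (z : R) : (j <= n)%N -> derivable (derive1n j g) z 1.
  by move=> _; exact: profile_derivable1n.
have TS := vanishing_sandwich dg g0.
set c := derive1n n g 0 in gn TS.
(* The leading coefficient is positive because [f] has a minimum at the waist. *)
have c0 : 0 < c.
  rewrite lt_neqAle eq_sym gn /= leNgt; apply/negP => cneg.
  have [|d [d0 H]] := TS (- c / 2); first by lra.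
  have := H d; rewrite (ltW d0) lexx => /(_ isT) /andP[_ H2].
  have dn : 0 < d ^+ n by exact: exprn_gt0.
  have : (c + - c / 2) * d ^+ n < 0 by rewrite nmulr_rlt0//; lra.
  by rewrite ltNge (le_trans _ H2)// mulr_ge0.
have nf : 0 < n`!%:R :> R by rewrite ltr0n fact_gt0.
have kk : 0 < (2 * k)%:R :> R by rewrite ltr0n muln_gt0 /= (leq_trans _ hk).
(* [f ^ 2k - 1] is equivalent to [2k * (f - 1)]. *)
pose A : R := (2 * k)%:R * (c / n`!%:R).
have A0 : 0 < A by rewrite mulr_gt0// divr_gt0.
pose alpha := A `^ n%:R^-1.
have alphan : alpha ^+ n = A.
  rewrite -powR_mulrn ?powR_ge0// -powRrM mulVf ?powRr1 ?(ltW A0)//.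
  by rewrite pnatr_eq0 -lt0n.
exists alpha; split; first exact: powR_gt0.
move=> eta /andP[eta0 eta1]; pose u := eta / 4.
have u0 : 0 < u by rewrite divr_gt0.
have [|d [d0 H]] := TS (c * u); first exact: mulr_gt0.
have cf : {for (0 : R), continuous (fun Z => f Z ^+ (2 * k))}.
  have cf0 : {for (0 : R), continuous f} by exact: scaling_continuous.
  exact: (continuous_comp cf0 (@exprn_continuous _ _ _)).
have [d' /= d'0 H'] : \forall Z \near (0 : R), f Z ^+ (2 * k) < 1 + u.
  apply: (cf [set x : R | x < 1 + u]); rewrite /f profile0// expr1n.
  by apply: lt_nbhsl; rewrite ltrDl.
exists (Num.min d (d' / 2)); split; first by rewrite lt_min d0 divr_gt0.
move=> Z /andP[Z0]; rewrite le_min => /andP[Zd Zd'].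
have fu : f Z ^+ (2 * k) <= 1 + u.
  by apply/ltW/H'; rewrite /ball_ /= sub0r normrN ger0_norm//; lra.
have /andP[T1 T2] := H Z (introT andP (conj Z0 Zd)).
have /andP[E1 E2] := exprn_sub1_bounds (2 * k) (f_ge1 Z).
have Zn : 0 <= Z ^+ n by exact: exprn_ge0.
have AZ : 0 <= A * Z ^+ n by rewrite mulr_ge0// ltW.
have gl : A * Z ^+ n * (1 - u) <= (2 * k)%:R * g Z.
  have -> : A * Z ^+ n * (1 - u) =
      (2 * k)%:R * ((c - c * u) * Z ^+ n / n`!%:R).
    by rewrite /A; field; rewrite gt_eqF.
  by rewrite (ler_pM2l kk) ler_pdivrMr// [leRHS]mulrC.
have gu : (2 * k)%:R * g Z <= A * Z ^+ n * (1 + u).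
  have -> : A * Z ^+ n * (1 + u) =
      (2 * k)%:R * ((c + c * u) * Z ^+ n / n`!%:R).
    by rewrite /A; field; rewrite gt_eqF.
  by rewrite (ler_pM2l kk) ler_pdivlMr// [leLHS]mulrC.
split.
- apply: le_trans E1; apply: le_trans gl.
  rewrite exprMn exprMn alphan mulrAC; apply: ler_wpM2l => //.
  apply: (le_trans (y := 1 - eta)); last by rewrite /u; lra.
  by rewrite -[leRHS]expr1; apply: ler_wiXn2l => //; lra.
- apply: (le_trans E2).
  have -> : (2 * k)%:R * f Z ^+ (2 * k) * (f Z - 1) =
      f Z ^+ (2 * k) * ((2 * k)%:R * g Z) by rewrite gE; ring.
  apply: (le_trans (y := (1 + u) * (A * Z ^+ n * (1 + u)))).
    have p1 : 0 <= f Z ^+ (2 * k) by apply: exprn_ge0; exact: le_trans (f_ge1 Z).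
    have p2 : 0 <= (2 * k)%:R * g Z by rewrite mulr_ge0// ltW.
    exact: ler_pM.
  rewrite exprMn exprMn alphan [leRHS]mulrAC.
  have -> : (1 + u) * (A * Z ^+ n * (1 + u)) = A * Z ^+ n * (1 + u) ^+ 2.
    by ring.
  apply: ler_wpM2l => //; apply: (le_trans (y := 1 + eta)).
    by rewrite /u; nra.
  by rewrite -[leLHS]expr1; apply: ler_weXn2l => //; lra.
- apply: (le_trans (y := f Z ^+ (2 * k))).
    by apply: ler_weXn2l => //; rewrite leq_pmull.
  by apply: (le_trans fu); rewrite /u; lra.
Qed.

(** The integral of [1 / sqrt (s ^ 2 + (b Z) ^ 2l)], [s = sin phi], is obtained
    from the case [b = s = 1] by rescaling [Z]. *)
Lemma is_derive_model (J : R -> R) (phi b Z : R) : 0 < sin phi -> 0 < b -> 0 <= Z ->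
  (forall x : R, 0 <= x -> is_derive x 1 J (model_integrand l x)) ->
  is_derive Z 1 (fun Z => b^-1 * (waist_width l phi / sin phi *
      J (b * Z / waist_width l phi)))
    (Num.sqrt (sin phi ^+ 2 + (b * Z) ^+ (2 * l)))^-1.
Proof.
move=> s0 b0 Z0 dJ; have := waist_width_gt0 l s0; have := waist_widthX l0 s0.
set v := waist_width l phi => vl v0.
have d1 : is_derive Z 1 (fun t => b * t / v) (b / v).
  have -> : (fun t => b * t / v) = (fun t => (b / v) * t).
    by apply/funext => t; rewrite mulrAC.
  have := is_deriveZ (b / v) (is_derive_id Z (1 : R)).
  by rewrite [_ *: 1]mulr1.
have bZ : 0 <= b * Z / v by rewrite divr_ge0 ?mulr_ge0// ltW.
have d2 := @is_derive1_comp R J (fun t => b * t / v) Z _ _ (dJ _ bZ) d1.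
have d3 := is_deriveZ b^-1 (is_deriveZ (v / sin phi) d2).
rewrite /= /GRing.scale /= in d3.
suff <- : b^-1 * (v / sin phi * (model_integrand l (b * Z / v) * (b / v))) =
    (Num.sqrt (sin phi ^+ 2 + (b * Z) ^+ (2 * l)))^-1 by exact: d3.
have vn : v ^+ (2 * l) = sin phi ^+ 2 by rewrite mulnC exprM vl.
have -> : sin phi ^+ 2 + (b * Z) ^+ (2 * l) =
    sin phi ^+ 2 * (1 + (b * Z / v) ^+ (2 * l)).
  by rewrite expr_div_n vn; field; rewrite gt_eqF.
rewrite sqrtrM ?sqr_ge0// sqrtr_sqr gtr0_norm// /model_integrand.
have r0 : 0 < Num.sqrt (1 + (b * Z / v) ^+ (2 * l)).
  by rewrite sqrtr_gt0 model_root_gt0.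
by field; rewrite !gt_eqF.
Qed.

(** Below [d] the integrand of [Cphi] is compared with the models of slopes [bl]
    and [bu]; above [d], where [f ^ 2k >= f d ^ 2k > 1], it is bounded by an
    integrable function independent of [phi]. *)
Lemma Cphi_sandwich (J : R -> R) (eta bl bu d : R) :
  J 0 = 0 -> (forall x : R, 0 <= x -> is_derive x 1 J (model_integrand l x)) ->
  0 <= eta -> 0 < bl -> 0 < bu -> 0 < d ->
  (forall Z : R, 0 <= Z <= d ->
    [/\ (bl * Z) ^+ (2 * l) <= f Z ^+ (2 * k) - 1,
        f Z ^+ (2 * k) - 1 <= (bu * Z) ^+ (2 * l) &
        f Z ^+ k <= 1 + eta]) ->
  let M phi b := b^-1 * (waist_width l phi / sin phi *
      J (b * d / waist_width l phi)) in
  exists D : R, forall phi : R, 0 < sin phi ->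
    (1 + eta)^-1 * M phi bu <= Cphi w k phi <= M phi bl + D.
Proof.
move=> J0 dJ eta0 bl0 bu0 d0 sand M.
have [c0 [c1 [c00 _ prof]]] := profile_linear hw.
have {}prof (Z : R) : 0 <= Z -> c0 * (1 + Z) <= w 1 Z by move=> /prof /andP[].
pose F := f d ^+ (2 * k).
have F1 : 1 < F.
  have [+ _ _] := sand d (introT andP (conj (ltW d0) (lexx d))).
  rewrite lerBrDr; apply: lt_le_trans; rewrite ltrDr.
  by rewrite exprn_gt0// mulr_gt0.
have F0 : 0 < F by exact: lt_trans F1.
pose D := (c0 ^+ 2 * Num.sqrt (1 - F^-1))^-1.
have D0 : 0 <= D by rewrite invr_ge0 mulr_ge0 ?sqrtr_ge0// sqr_ge0.
exists (D / (1 + d)) => phi s0.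
have cs : cos phi ^+ 2 = 1 - sin phi ^+ 2 by rewrite -(cos2Dsin2 phi) addrK.
have s2 : 0 < sin phi ^+ 2 by exact: exprn_gt0.
have c21 : cos phi ^+ 2 < 1 by rewrite cs gtrBl.
have [G [G0 dG]] := profile_primitive hw k c21.
have decay (Z : R) : d <= Z -> profile_integrand w k phi Z <= D * (1 + Z) ^- 2.
  move=> dZ; have Z0 : 0 <= Z by exact: le_trans (ltW d0) dZ.
  apply: (profile_integrand_decay hw hk c00 prof) => //.
    by rewrite invr_ge0 (ltW F0) invf_lt1.
  apply: (le_trans (ltW c21)); rewrite mulrC ler_pdivlMr// mul1r.
  apply: lerXn2r; rewrite ?nnegrE; [exact: le_trans ler01 (f_ge1 d)|exact: le_trans ler01 (f_ge1 Z)|].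
  by apply: profile_le => //; exact: ltW.
have /andP[L U] := Cphi_bounds hw c21 (ltW d0) G0 dG decay D0.
have dM (b Z : R) : 0 < b -> 0 <= Z -> is_derive Z 1 (fun Z => b^-1 *
    (waist_width l phi / sin phi * J (b * Z / waist_width l phi)))
    (Num.sqrt (sin phi ^+ 2 + (b * Z) ^+ (2 * l)))^-1.
  by move=> b0 Z0; exact: is_derive_model.
have cG : {within `[0, d], continuous G}.
  apply: within_continuous_of => t /andP[t0 _].
  exact: is_derive_continuous (dG t t0).
have model_pos (b Z : R) : 0 < sin phi ^+ 2 + (b * Z) ^+ (2 * l).
  by rewrite ltr_pwDl// mulnC exprM sqr_ge0.
have gapE (Z : R) : f Z ^+ (2 * k) - cos phi ^+ 2 =
    sin phi ^+ 2 + (f Z ^+ (2 * k) - 1) by rewrite cs; ring.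
have gap0 (Z : R) : 0 < f Z ^+ (2 * k) - cos phi ^+ 2.
  by rewrite gapE ltr_pwDl// subr_ge0 exprn_ege1.
have fk0 (Z : R) : 0 < f Z ^+ k by rewrite exprn_gt0// (lt_le_trans ltr01).
have e1 : 0 < 1 + eta by rewrite ltr_pwDl.
have at0 b : J (b * 0 / waist_width l phi) = 0 by rewrite mulr0 mul0r.
have lower : (1 + eta)^-1 * M phi bu <= G d.
  pose E (Z : R) := (1 + eta)^-1 * (bu^-1 *
    (waist_width l phi / sin phi * J (bu * Z / waist_width l phi))).
  pose E' (Z : R) :=
    (1 + eta)^-1 * (Num.sqrt (sin phi ^+ 2 + (bu * Z) ^+ (2 * l)))^-1.
  have dE (Z : R) : 0 <= Z -> is_derive Z 1 E (E' Z).
    by move=> Z0; exact: (is_deriveZ (1 + eta)^-1 (dM bu Z bu0 Z0)).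
  have : E d - E 0 <= G d - G 0.
    apply: (@le_increment R E G E' (profile_integrand w k phi) 0 d (ltW d0)).
    - by move=> t /andP[/ltW t0 _]; exact: dE.
    - by move=> t /andP[/ltW t0 _]; exact: dG.
    - apply: within_continuous_of => t /andP[t0 _].
      exact: is_derive_continuous (dE t t0).
    - exact: cG.
    - move=> t /andP[/ltW t0 /ltW td].
      have [_ h1 h2] := sand t (introT andP (conj t0 td)).
      rewrite /E' -invfM lef_pV2 ?posrE ?mulr_gt0 ?sqrtr_gt0//.
      apply: (ler_pM (ltW (fk0 t)) (sqrtr_ge0 _) h2).
      by apply: ler_wsqrtr; rewrite gapE lerD2l.
  by rewrite /E at0 !mulr0 G0 !subr0.
have upper : G d <= M phi bl.
  pose E (Z : R) := bl^-1 *
    (waist_width l phi / sin phi * J (bl * Z / waist_width l phi)).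
  pose E' (Z : R) := (Num.sqrt (sin phi ^+ 2 + (bl * Z) ^+ (2 * l)))^-1.
  have dE (Z : R) : 0 <= Z -> is_derive Z 1 E (E' Z).
    by move=> Z0; exact: dM.
  have : G d - G 0 <= E d - E 0.
    apply: (@le_increment R G E (profile_integrand w k phi) E' 0 d (ltW d0)).
    - by move=> t /andP[/ltW t0 _]; exact: dG.
    - by move=> t /andP[/ltW t0 _]; exact: dE.
    - exact: cG.
    - apply: within_continuous_of => t /andP[t0 _].
      exact: is_derive_continuous (dE t t0).
    - move=> t /andP[/ltW t0 /ltW td].
      have [h1 _ _] := sand t (introT andP (conj t0 td)).
      rewrite /E' lef_pV2 ?posrE ?mulr_gt0 ?sqrtr_gt0//.
      rewrite -[leLHS]mul1r.
      apply: (ler_pM ler01 (sqrtr_ge0 _) (exprn_ege1 k (f_ge1 t))).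
      by apply: ler_wsqrtr; rewrite gapE lerD2l.
  by rewrite /E at0 !mulr0 G0 !subr0.
apply/andP; split; first exact: le_trans lower L.
by apply: (le_trans U); rewrite lerD2r.
Qed.

(** The two sides of [Cphi_sandwich] have the limits [(1 + eta) ^- 2] and
    [(1 - eta)^-1] once divided by [C * blowup_rate l phi]. *)
Lemma Cphi_asymptotics : vanishes_to_order (fun Z => w 1 Z - 1) 0 (2 * l) ->
  exists C : R, 0 < C /\
    Cphi w k phi / (C * blowup_rate l phi) @[phi --> 0^'+] --> (1 : R).
Proof.
move=> /profile_sandwich[alpha [alpha0 sand]].
have [J [J0 dJ]] := model_primitive R l.
have [c [c0 lim]] := model_limit l0 J0 dJ.
have C0 : 0 < c / alpha by exact: divr_gt0.
exists (c / alpha); split => //; apply/cvgrPdist_lt => eps eps0.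
pose eta : R := Num.min (1 / 2) (eps / 4).
have eta0 : 0 < eta by rewrite lt_min !divr_gt0.
have eta2 : eta <= 1 / 2 by rewrite ge_min lexx.
have etae : eta <= eps / 4 by rewrite ge_min lexx orbT.
have eta1 : 0 < eta < 1 by rewrite eta0; lra.
have [d [d0 {}sand]] := sand eta eta1.
have bl0 : 0 < alpha * (1 - eta) by rewrite mulr_gt0// subr_gt0; lra.
have bu0 : 0 < alpha * (1 + eta) by rewrite mulr_gt0// addr_gt0.
have [D HD] := Cphi_sandwich J0 dJ (ltW eta0) bl0 bu0 d0 sand.
pose Q (b phi : R) := waist_width l phi / sin phi *
  J (b * d / waist_width l phi) / blowup_rate l phi.
have limQ b : 0 < b -> Q b phi @[phi --> 0^'+] --> c.
  by move=> b0; apply: lim; exact: mulr_gt0.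
set bl := alpha * (1 - eta) in bl0 HD; set bu := alpha * (1 + eta) in bu0 HD.
have e1 : 0 < 1 + eta by exact: addr_gt0.
have e2 : 0 < 1 - eta by lra.
pose lo (phi : R) := (1 + eta)^-1 * bu^-1 * Q bu phi.
pose up (phi : R) := bl^-1 * Q bl phi + D * (blowup_rate l phi)^-1.
have limlo : lo phi @[phi --> 0^'+] --> (1 + eta)^-1 * bu^-1 * c.
  by apply: cvgM; [exact: cvg_cst|exact: limQ].
have limup : up phi @[phi --> 0^'+] --> bl^-1 * c + D * 0.
  apply: cvgD; apply: cvgM; [exact: cvg_cst|exact: limQ|exact: cvg_cst|].
  exact: blowup_rateV.
have lo1 : c / alpha * (1 - eps) < (1 + eta)^-1 * bu^-1 * c.
  have -> : (1 + eta)^-1 * bu^-1 * c = c / alpha * ((1 + eta) ^+ 2)^-1.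
    by rewrite /bu; field; rewrite !gt_eqF.
  rewrite ltr_pM2l// -[ltRHS]mul1r ltr_pdivlMr ?exprn_gt0//.
  by nra.
have up1 : bl^-1 * c + D * 0 < c / alpha * (1 + eps).
  have -> : bl^-1 * c + D * 0 = c / alpha * (1 - eta)^-1.
    by rewrite /bl; field; rewrite !gt_eqF.
  rewrite ltr_pM2l// -[ltLHS]mul1r ltr_pdivrMr//.
  by nra.
near=> phi.
have [p0 p1 s0] : [/\ 0 < phi, phi < 1 & 0 < sin phi].
  by near: phi; exact: near_angle.
have T0 := blowup_rate_gt0 l p0 p1.
have Llo : c / alpha * (1 - eps) < lo phi.
  by near: phi; exact: cvgr_gt limlo _ lo1.
have Lup : up phi < c / alpha * (1 + eps).
  by near: phi; exact: cvgr_lt limup _ up1.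
have /andP[H1 H2] := HD phi s0.
have P1 : lo phi <= Cphi w k phi / blowup_rate l phi.
  rewrite ler_pdivlMr//; apply: le_trans H1.
  by rewrite le_eqVlt; apply/orP; left; apply/eqP; rewrite /lo /Q; field;
    rewrite !gt_eqF// waist_width_gt0.
have P2 : Cphi w k phi / blowup_rate l phi <= up phi.
  rewrite ler_pdivrMr//; apply: (le_trans H2).
  by rewrite le_eqVlt; apply/orP; left; apply/eqP; rewrite /up /Q; field;
    rewrite !gt_eqF// waist_width_gt0.
have -> : Cphi w k phi / (c / alpha * blowup_rate l phi) =
    (Cphi w k phi / blowup_rate l phi) / (c / alpha).
  by field; rewrite !gt_eqF.
rewrite ltr_distlC ltr_pdivlMr// ltr_pdivrMr//; apply/andP; split.
  by apply: lt_le_trans P1; rewrite mulrC.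
by apply: (le_lt_trans P2); rewrite mulrC.
Unshelve. all: by end_near. Qed.

End asymptotics.

Theorem theorem18 (R : realType) (m : nat) (Y : topologicalType)
    (A : atlas R m Y) (HY : closed_manifold A)
    (k kappa : nat) (hk : (2 <= k)%N) (hkappa : (k <= kappa)%N)
    (w : R -> R -> R) (hw : scaling_function w)
    (J : set R) (hJ : is_interval J) (hJo : open J) (hJ0 : J 0)
    (eps0 : R) (heps0 : 0 < eps0 <= 1)
    (S : R -> R -> Y -> R) (hS : admissible_function A eps0 J S)
    (b : R -> R -> Y -> 'rV[R]_m -> R) (hb : admissible_form A eps0 J b)
    (h : R -> R -> Y -> 'rV[R]_m -> 'rV[R]_m -> R)
    (hh : admissible_metric A eps0 J h)
    (hg : forall (e z : R) (y : Y) (p : R * 'rV[R]_m),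
        0 < e < eps0 -> J z -> p != 0 ->
        0 < pmetric w k kappa S b h e z y p p) :
  (exists z1 : R, 0 < z1 /\
    forall z0 : R, J z0 -> 0 < z0 < z1 ->
    forall K : set R, compact K -> K `<=` `]0, pi / 2] ->
    exists B e1 : R, 0 < e1 <= eps0 /\
      forall (e phi T : R) (z : R -> R) (y : R -> Y),
        0 < e < e1 -> K phi ->
        rising_geodesic A J (pmetric w k kappa S b h e) phi z0 T z y ->
        exists Rem : R,
          angular_length A (h e) z y T
            = (e ^+ k.-1)^-1 * (Cphi w k phi * cos phi + Rem) /\
          `|Rem| <= B * (if (2 < k)%N then e else e * `|ln e|)) /\
  (forall l : nat, (0 < l)%N ->
    vanishes_to_order (fun Z => w 1 Z - 1) 0 (2 * l) ->
    exists C : R, 0 < C /\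
      Cphi w k phi /
        (if (1 < l)%N then C * phi `^ (- ((l%:R - 1) / l%:R))
         else C * ln phi^-1) @[phi --> 0^'+] --> (1 : R)).
Proof.
have /andP[e00 _] := heps0.
split.
  have [C [r1 [C0 r10 r1e reduction]]] :=
    geodesic_reduction HY hk hkappa hw hJo hJ0 e00 hS hb hh.
  have [z1 [/andP[z10 z1r] length]] := reduced_length hw hk C0 r10.
  exists z1; split => // z0 _ /andP[z00 z0z1] K Kc Ksub.
  have [B [e1 [/andP[e10 e1r] bound]]] :=
    length z0 (introT andP (conj z00 z0z1)) K Kc Ksub.
  exists B, e1; split; first by rewrite e10 (le_trans e1r).
  move=> e phi T z y /andP[e0 ee1] Kphi rise.
  have er : 0 < e < r1 by rewrite e0 (lt_le_trans ee1).
  have z0r : 0 < z0 < r1 by rewrite z00 (lt_le_trans z0z1).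
  have [N mot] := reduction e phi z0 T z y er z0r rise.
  exact: (bound e phi T z N _ (introT andP (conj e0 ee1)) Kphi mot).
move=> l l0 van.
have [C [C0 lim]] := Cphi_asymptotics hw hk l0 van.
exists C; split => //; apply: cvg_trans lim; apply: near_eq_cvg; near=> phi.
by rewrite /blowup_rate; case: ifP.
Unshelve. all: by end_near. Qed.
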